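(* Let $0<\alpha<n$, $1 \leq p < n/\alpha$, $1/q = 1/p -\alpha/n$, and $w \in A_{p,q}$. Suppose $\psi_1,\psi_2$ are nonnegative functions on $\mathbb{R}^n \times (0,\infty)$ and there is $C>0$ such that $$\int_r^\infty \frac{w^p(B(a,t))^{\frac{1}{p}}}{w^q(B(a,t))^{\frac{1}{q}}} \psi_1 (a,t) \frac{dt}{t} \leq C \psi_2 (a,r)\quad\text{for all } (a,r)\in \mathbb{R}^n \times (0, \infty).$$ Then (1) if $1<p<n/\alpha$, the fractional integral operator $I_\alpha$ is bounded from $\mathcal{M}^{p,w^p}_{\psi_1}$ to $\mathcal{M}^{q,w^q}_{\psi_2}$; (2) if $p=1$, $I_\alpha$ is bounded from $\mathcal{M}^{1,w}_{\psi_1}$ to $W\mathcal{M}^{q,w^q}_{\psi_2}$.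
   Context: $I_\alpha f(x)=\int_{\mathbb{R}^n}\frac{f(y)}{|x-y|^{n-\alpha}}dy$. $B(a,r)$ is the open ball; for a weight $v$, $v(E)=\int_E v$, and $w^s(E)=\int_E w^s$. For $1<p<q<\infty$, $A_{p,q}$ is the set of weights $w$ such that $\left(\frac{1}{|B|}\int_B w^q\right)^{1/q}\left(\frac{1}{|B|}\int_B w^{-p'}\right)^{1/p'}\le C$ for all balls $B$ ($1/p+1/p'=1$); for $p=1<q$, $A_{1,q}$ is the set of weights with $\left(\frac{1}{|B|}\int_B w^q\right)^{1/q}\le C\|w\|_{L^\infty(B)}$ for all balls $B$. $\|f\|_{L^{s,v}(\Omega)}=\left(\int_\Omega |f|^s v\right)^{1/s}$, $\|f\|_{WL^{s,v}(\Omega)}=\sup_{\gamma>0}\gamma\, v(\{x\in\Omega:|f(x)|>\gamma\})^{1/s}$, $L^{s,v}_{loc}$ is the set of measurable $f$ with $\|f\chi_B\|_{L^{s,v}}<\infty$ for every ball $B$. For $1\le s<\infty$, a weight $v$ and $\psi\ge0$ on $\mathbb{R}^n\times(0,\infty)$: $\mathcal{M}^{s,v}_\psi$ consists of $f\in L^{s,v}_{loc}$ with $\|f\|_{\mathcal{M}^{s,v}_\psi}=\sup_{a,r}\frac{1}{\psi(a,r)}v(B(a,r))^{-1/s}\|f\|_{L^{s,v}(B(a,r))}<\infty$, and $W\mathcal{M}^{s,v}_\psi$ consists of $f\in L^{s,v}_{loc}$ with $\|f\|_{W\mathcal{M}^{s,v}_\psi}=\sup_{a,r}\frac{1}{\p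si(a,r)}v(B(a,r))^{-1/s}\|f\|_{WL^{s,v}(B(a,r))}<\infty$.
   Formalization: For p=1 the class A_{1,q} is taken with the standard condition (avg_B w^q)^{1/q} ||1/w||_{L^∞(B)} ≤ C (the displayed one holds for every weight), and membership in the weak Morrey space requires a finite weak norm but not f in L^{q,w^q}_loc, since part (2) fails otherwise. *)

(* Defs.v *)
(* R^n is modelled as n.-tuple R,
   which MathComp-Analysis equips with the product (Borel) sigma-algebra. *)
From HB Require Import structures.
From mathcomp Require Import all_boot all_order all_algebra.
From mathcomp Require Import all_classical all_reals all_analysis.
From mathcomp Require Import measurable_realfun.
Import Order.TTheory GRing.Theory Num.Theory.
Import numFieldNormedType.Exports.

Set Implicit Arguments.
Unset Strict Implicit.
Unset Printing Implicit Defensive.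

Local Open Scope classical_set_scope.
Local Open Scope ring_scope.

(* n-dimensional Lebesgue measure on (Borel sets of) R^n = n.-tuple R,
   defined as the iterated product measure:
   |A|_{n+1} = \int_R |{t : (x,t) in A}|_n dx,  |A|_0 = 1 if the point is in A. *)
Fixpoint lebn (R : realType) (n : nat) : set (n.-tuple R) -> \bar R :=
  match n return set (n.-tuple R) -> \bar R with
  | 0 => fun A => if `[< A [tuple] >] then 1%E else 0%E
  | n'.+1 => fun A =>
      (\int[@lebesgue_measure R]_(x in setT)
          @lebn R n' [set t | A (cons_tuple x t)])%E
  end.

Definition tdist (R : realType) (n : nat) (x y : n.-tuple R) : R :=
  Num.sqrt (\sum_(i < n) (tnth x i - tnth y i) ^+ 2).

Definition tball (R : realType) (n : nat) (a : n.-tuple R) (r : R) :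
  set (n.-tuple R) := [set y | tdist a y < r].

Local Open Scope ereal_scope.

Definition wmeas (R : realType) (n : nat) (v : n.-tuple R -> R)
  (E : set (n.-tuple R)) : \bar R :=
  \int[@lebn R n]_(x in E) (v x)%:E.

Definition Lnorm (R : realType) (n : nat) (s : R) (v : n.-tuple R -> R)
  (E : set (n.-tuple R)) (g : n.-tuple R -> \bar R) : \bar R :=
  (\int[@lebn R n]_(x in E) ((`| g x | `^ s) * (v x)%:E)) `^ (s^-1).

Definition WLnorm (R : realType) (n : nat) (s : R) (v : n.-tuple R -> R)
  (E : set (n.-tuple R)) (g : n.-tuple R -> \bar R) : \bar R :=
  ereal_sup [set y | exists gam : R, (0 < gam)%R /\
     y = gam%:E * (wmeas v [set x | E x /\ gam%:E < `| g x |]) `^ (s^-1)].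

Definition Lloc (R : realType) (n : nat) (s : R) (v : n.-tuple R -> R)
  (g : n.-tuple R -> \bar R) : Prop :=
  measurable_fun [set: n.-tuple R] g /\
  forall (a : n.-tuple R) (r : R), Lnorm s v (tball a r) g < +oo.

(* ||g||_{M^{s,v}_psi} (with the conventions 1/0 = +oo, +oo * 0 = 0 of \bar R) *)
Definition morrey_norm (R : realType) (n : nat) (s : R) (v : n.-tuple R -> R)
  (psi : n.-tuple R -> R -> R) (g : n.-tuple R -> \bar R) : \bar R :=
  ereal_sup [set y | exists (a : n.-tuple R) (r : R), (0 < r)%R /\
     y = ((psi a r)%:E)^-1 * ((wmeas v (tball a r)) `^ (s^-1))^-1
         * Lnorm s v (tball a r) g].

Definition weak_morrey_norm (R : realType) (n : nat) (s : R)
  (v : n.-tuple R -> R) (psi : n.-tuple R -> R -> R)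
  (g : n.-tuple R -> \bar R) : \bar R :=
  ereal_sup [set y | exists (a : n.-tuple R) (r : R), (0 < r)%R /\
     y = ((psi a r)%:E)^-1 * ((wmeas v (tball a r)) `^ (s^-1))^-1
         * WLnorm s v (tball a r) g].

Definition in_morrey (R : realType) (n : nat) (s : R) (v : n.-tuple R -> R)
  (psi : n.-tuple R -> R -> R) (g : n.-tuple R -> \bar R) : Prop :=
  Lloc s v g /\ morrey_norm s v psi g < +oo.

Definition in_weak_morrey (R : realType) (n : nat) (s : R)
  (v : n.-tuple R -> R) (psi : n.-tuple R -> R -> R)
  (g : n.-tuple R -> \bar R) : Prop :=
  measurable_fun [set: n.-tuple R] g /\ weak_morrey_norm s v psi g < +oo.

Definition Ialpha (R : realType) (n : nat) (alpha : R)
  (f : n.-tuple R -> R) (x : n.-tuple R) : \bar R :=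
  \int[@lebn R n]_(y in setT)
     ((f y) * ((tdist x y) `^ (n%:R - alpha))^-1)%:E.

Definition weight (R : realType) (n : nat) (w : n.-tuple R -> R) : Prop :=
  measurable_fun [set: n.-tuple R] w /\ (forall x, (0 <= w x)%R) /\
  forall (a : n.-tuple R) (r : R), wmeas w (tball a r) < +oo.

Definition wnegpow (R : realType) (n : nat) (w : n.-tuple R -> R) (s : R)
  (x : n.-tuple R) : \bar R :=
  if w x == 0%R then +oo else ((w x) `^ (- s))%:E.

Definition avg (R : realType) (n : nat) (E : set (n.-tuple R))
  (g : n.-tuple R -> \bar R) : \bar R :=
  (@lebn R n E)^-1 * \int[@lebn R n]_(x in E) g x.

Definition esssup_on (R : realType) (n : nat) (E : set (n.-tuple R))
  (g : n.-tuple R -> \bar R) : \bar R :=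
  ereal_inf [set y | exists N : set (n.-tuple R),
     measurable N /\ @lebn R n N = 0 /\ forall x, E x -> ~ N x -> g x <= y].

Definition Apq (R : realType) (n : nat) (p q : R) (w : n.-tuple R -> R) : Prop :=
  ((1 < p)%R -> exists C : R, forall (a : n.-tuple R) (r : R), (0 < r)%R ->
     (avg (tball a r) (fun x => ((w x) `^ q)%:E)) `^ (q^-1)
     * (avg (tball a r) (wnegpow w (p / (p - 1)))) `^ (((p / (p - 1))^-1))
     <= C%:E) /\
  (p = 1%R -> exists C : R, forall (a : n.-tuple R) (r : R), (0 < r)%R ->
     (avg (tball a r) (fun x => ((w x) `^ q)%:E)) `^ (q^-1)
     * esssup_on (tball a r) (wnegpow w 1%R) <= C%:E).

(* Main.v *)
(* Write u = w^q.  By Hoelder (or by the A_{1,q} condition itself) the weight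
   condition becomes the local estimate
     u(B)^{1/q} int_B |f| <= K r^{n - alpha} ||f||_{L^p(w^p, B)},
   and testing it on subsets of balls shows that u is doubling and reverse
   doubling.  In B = B(a, r) split f at B(a, L r).  The part far away contributes
   at most a sum of ||f||_{L^p(w^p, L^j B)} u(L^j B)^{-1/q} over j, which is a
   Riemann sum of the integral in the hypothesis on psi_1 and psi_2; the part
   nearby is handled by the (weak) L^p(w^p) -> L^q(w^q) bound for I_alpha.

   For p = 1 these follow from I_alpha(u 1_E) <= C u(E)^{alpha/n} w, Tonelli, and
   the choice of E as a level set of I_alpha f.

   For p > 1 let sigma = w^{-p'}, F = M_sigma(f / sigma), kap = 1 + p'/q and
   G = M_u(F^{p/kap} / u), where M_v is the maximal operator of the measure v.
   Comparing int_B f with F at all points of B gives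
     r^{alpha - n} int_B f <= C u(B)^{alpha/n} G^{kap/p},
   while the local estimate gives the bound C u(B)^{-1/q} ||f||.  Summing the
   first over small and the second over large concentric balls (Hedberg's
   argument) yields
     I_alpha f <= C ||f||^{p alpha/n} G^{kap/q},
   and M_u on L^kap(u), then M_sigma on L^p(sigma), bound int G^kap u by
   C ||f||^p.

   When w vanishes on a set of positive measure, the A_{p,q} condition forces
   w = 0 almost everywhere, and then both norms are zero. *)
Require Import Defs.
From HB Require Import structures.
From mathcomp Require Import all_boot all_order all_algebra.
From mathcomp Require Import all_classical all_reals all_analysis.
From mathcomp Require Import measurable_realfun.
From mathcomp Require Import ring lra.
Import Order.TTheory GRing.Theory Num.Theory.
Import numFieldNormedType.Exports.
Local Open Scope classical_set_scope.
Local Open Scope ring_scope.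

Set Implicit Arguments.
Unset Strict Implicit.
Unset Printing Implicit Defensive.

(** * Lebesgue measure on tuples *)

(** The usual road to the strong bound is a good-lambda inequality between I_alpha and the
    fractional maximal function, which rests on A_infinity and reverse Hölder estimates. Two
    weighted maximal operators bypass it: M_v is bounded on L^s(v), s > 1, for every doubling
    measure v, so only doubling of u and of sigma is asked for. The pattern is the pointwise bound
    of the Hardy-Littlewood maximal operator by (M_u(M_sigma(f / sigma)^(p - 1) / u))^(1 / (p - 1)),
    to which the construction reduces at alpha = 0: then kap = p' and p / kap = p - 1. In general
    kap is the exponent with u^(1 - kap) = sigma, so that the L^kap(u) norm of the inner expression
    becomes an L^p(sigma) norm of F.

    Reverse doubling enters because the bounds on concentric balls are powers of u(B) once the
    factor r^(n - alpha) is cancelled by the kernel. Such powers sum geometrically only if u(B)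
    changes by at least a fixed ratio from one ball to the next.

    The functions psi_1 and psi_2 carry no regularity, so the hypothesis relating them is used only
    through step functions lying below its integrand. *)

Section lebesgue_tuple.
Local Open Scope ereal_scope.
Variable R : realType.

Let consp n (z : R * n.-tuple R) : n.+1.-tuple R := cons_tuple z.1 z.2.

Let measurable_consp n : measurable_fun setT (@consp n).
Proof.
have := @measurable_cons _ _ (R * n.-tuple R)%type R (fun z => z.1) n
  (fun z => z.2) measurable_fst measurable_snd.
exact.
Qed.

Let lebn_ge0 n (A : set (n.-tuple R)) : 0 <= @lebn R n A.
Proof.
elim: n A => [|n IH] A /=; first by case: ifP.
by apply: integral_ge0.
Qed.

Section step.
Variables (n : nat) (m : {sigma_finite_measure set (n.-tuple R) -> \bar R}).

(** The recursion step of [lebn] as an image of a product measure, which brings sigma-additivity and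
    sigma-finiteness with it. *)
Definition lebn_step : set (n.+1.-tuple R) -> \bar R :=
  pushforward (@lebesgue_measure R \x m) (@consp n).

Let lebn_step0 : lebn_step set0 = 0.
Proof. by rewrite /lebn_step /pushforward preimage_set0 measure0. Qed.

Let lebn_step_ge0 A : 0 <= lebn_step A.
Proof. by rewrite /lebn_step /pushforward; exact: measure_ge0. Qed.

Let lebn_step_sigma_additive : semi_sigma_additive lebn_step.
Proof.
move=> F mF tF mUF; rewrite /lebn_step /pushforward preimage_bigcup.
apply: measure_semi_sigma_additive.
- by move=> k; rewrite -[X in measurable X]setTI; exact: measurable_consp.
- apply/trivIsetP => /= i j _ _ ij; rewrite -preimage_setI.
  by move/trivIsetP : tF => /(_ _ _ _ _ ij) ->//; rewrite preimage_set0.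
- by rewrite -preimage_bigcup -[X in measurable X]setTI; exact: measurable_consp.
Qed.

HB.instance Definition _ := isMeasure.Build _ _ _
  lebn_step lebn_step0 lebn_step_ge0 lebn_step_sigma_additive.

Let lebn_step_sigma_finite : sigma_finite setT lebn_step.
Proof.
have /sigma_finiteP[F [TF ndF Foo]] : sigma_finite setT (@lebesgue_measure R).
  exact: sigma_finiteT.
have /sigma_finiteP[G [TG ndG Goo]] := sigma_finiteT m.
pose dec (x : n.+1.-tuple R) : R * n.-tuple R := (thead x, behead_tuple x).
have mdec : measurable_fun setT dec.
  apply: measurable_fun_pair => /=; first exact: measurable_tnth.
  exact: measurable_behead.
have conspK : cancel (@consp n) dec.
  by move=> [a b]; congr pair; apply/val_inj.
exists (fun k => dec @^-1` (F k `*` G k)).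
  apply/esym/seteqP; split => // x _.
  have [i _ Fi] : (\bigcup_k F k) (thead x) by rewrite -TF.
  have [j _ Gj] : (\bigcup_k G k) (behead_tuple x) by rewrite -TG.
  exists (maxn i j) => //; split => /=.
    by move: Fi; apply/subsetPset/ndF/leq_maxl.
  by move: Gj; apply/subsetPset/ndG/leq_maxr.
move=> k; have [mF Fk] := Foo k; have [mG Gk] := Goo k; split.
  rewrite -[X in measurable X]setTI; apply: mdec => //.
  exact: measurableX.
rewrite /lebn_step /pushforward -comp_preimage.
rewrite (_ : dec \o @consp n = id); last first.
  by apply/funext => z /=; rewrite conspK.
rewrite preimage_id product_measure1E// lte_mul_pinfty// ge0_fin_numE//.
Qed.

HB.instance Definition _ := Measure_isSigmaFinite.Build _ _ _
  lebn_step lebn_step_sigma_finite.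

End step.

(** [lebn] is a set function given by recursion on all sets. On measurable ones the product measure
    unfolds to the same integral over sections, so the measure axioms transfer. *)
Let lebn_measureE n :
  exists m : {sigma_finite_measure set (n.-tuple R) -> \bar R},
    forall A, measurable A -> @lebn R n A = m A.
Proof.
elim: n => [|n [m mE]].
  exists (dirac [tuple]) => A mA; rewrite /= diracE.
  by case: ifPn => /asboolP hA; [rewrite mem_set|rewrite memNset].
exists (lebn_step m) => A mA; rewrite /= /lebn_step /pushforward.
have mA' : measurable (@consp n @^-1` A).
  by rewrite -[X in measurable X]setTI; exact: measurable_consp.
apply: eq_integral => x _ /=; rewrite mE.
  congr (m _); apply/seteqP; split => t /=.
    by move=> At; rewrite /xsection/= inE.
  by rewrite /xsection/= inE.
rewrite [X in measurable X](_ : _ = xsection (@consp n @^-1` A) x).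
  exact: measurable_xsection.
by apply/seteqP; split => t /=; rewrite /xsection/= inE.
Qed.

Variable n : nat.

Let lebn0 : @lebn R n set0 = 0.
Proof. by have [m mE] := lebn_measureE n; rewrite mE// measure0. Qed.

Let lebn_sigma_additive : semi_sigma_additive (@lebn R n).
Proof.
have [m mE] := lebn_measureE n => F mF tF mUF; rewrite mE//.
rewrite [X in X @ _](_ : _ = (fun k => \sum_(0 <= i < k) m (F i))).
  exact: measure_semi_sigma_additive.
by apply/funext => k; apply: eq_bigr => i _; rewrite mE.
Qed.

HB.instance Definition _ := isMeasure.Build _ _ _
  (@lebn R n) lebn0 (@lebn_ge0 n) lebn_sigma_additive.

Let lebn_sigma_finite : sigma_finite setT (@lebn R n).
Proof.
have [m mE] := lebn_measureE n.
have [F TF Foo] := sigma_finiteT m; exists F => // k.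
by have [mF Fk] := Foo k; split=> //; rewrite mE.
Qed.

HB.instance Definition _ := Measure_isSigmaFinite.Build _ _ _
  (@lebn R n) lebn_sigma_finite.

End lebesgue_tuple.

(** * Euclidean balls *)

Section balls.
Variable R : realType.
Implicit Types n : nat.

Lemma measurable_tdist2 n :
  measurable_fun [set: n.-tuple R * n.-tuple R] (fun z => tdist z.1 z.2).
Proof.
apply: (@measurableT_comp _ _ _ _ _ _ (@Num.sqrt R)).
  by apply: continuous_measurable_fun; exact: sqrt_continuous.
apply: measurable_sum => i; apply: measurable_funX.
by apply: measurable_funB; apply: (measurableT_comp (measurable_tnth i)).
Qed.

Lemma measurable_tdist n (a : n.-tuple R) :
  measurable_fun setT (tdist a).
Proof.
exact: (measurableT_comp (@measurable_tdist2 n) (pair1_measurable a)).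
Qed.

Lemma measurable_tball n (a : n.-tuple R) r : measurable (tball a r).
Proof.
rewrite (_ : tball a r = setT `&` tdist a @^-1` [set` `]-oo, r[%R]).
  exact: measurable_tdist.
by rewrite setTI; apply/seteqP; split=> y; rewrite /tball/= in_itv.
Qed.

Lemma tdist_ge0 n (x y : n.-tuple R) : 0 <= tdist x y.
Proof. exact: sqrtr_ge0. Qed.

Lemma tdistxx n (x : n.-tuple R) : tdist x x = 0.
Proof.
by rewrite /tdist big1 ?sqrtr0// => i _; rewrite subrr expr0n.
Qed.

Lemma tdistC n (x y : n.-tuple R) : tdist x y = tdist y x.
Proof.
by rewrite /tdist; congr Num.sqrt; apply: eq_bigr => i _; rewrite -opprB sqrrN.
Qed.

Lemma tdist_sqr n (x y : n.-tuple R) :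
  tdist x y ^+ 2 = \sum_(i < n) (tnth x i - tnth y i) ^+ 2.
Proof. by rewrite sqr_sqrtr// sumr_ge0// => i _; exact: sqr_ge0. Qed.

Lemma tdist0_eq n (x y : n.-tuple R) : tdist x y = 0 -> x = y.
Proof.
move=> d0; have := tdist_sqr x y; rewrite d0 expr0n/= => /esym/eqP.
rewrite psumr_eq0; last by move=> i _; exact: sqr_ge0.
move=> /allP h; apply: eq_from_tnth => i; apply/eqP.
by have := h i (mem_index_enum i); rewrite sqrf_eq0 subr_eq0.
Qed.

(* Titu's inequality [(a + b)^2 <= (A + B) (a^2 / A + b^2 / B)] summed over the
   coordinates, with [A], [B] the two distances. *)
Lemma tdist_triangle n (x y z : n.-tuple R) :
  tdist x z <= tdist x y + tdist y z.
Proof.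
have [/tdist0_eq ->|A0] := eqVneq (tdist x y) 0; first by rewrite tdistxx add0r.
have [/tdist0_eq ->|B0] := eqVneq (tdist y z) 0; first by rewrite tdistxx addr0.
have Ap : 0 < tdist x y by rewrite lt_neqAle eq_sym A0 tdist_ge0.
have Bp : 0 < tdist y z by rewrite lt_neqAle eq_sym B0 tdist_ge0.
rewrite -ler_sqr ?nnegrE ?addr_ge0 ?tdist_ge0// tdist_sqr.
set A := tdist x y in A0 Ap *; set B := tdist y z in B0 Bp *.
apply: (@le_trans _ _ (\sum_(i < n) ((A + B) / A * (tnth x i - tnth y i) ^+ 2 +
   (A + B) / B * (tnth y i - tnth z i) ^+ 2))).
  apply: ler_sum => i _; set a := tnth x i - tnth y i; set b := tnth y i - tnth z i.
  have -> : tnth x i - tnth z i = a + b by rewrite /a /b addrA subrK.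
  rewrite -subr_ge0.
  have -> : (A + B) / A * a ^+ 2 + (A + B) / B * b ^+ 2 - (a + b) ^+ 2 =
     (B * a - A * b) ^+ 2 / (A * B) by field; rewrite A0 B0.
  by rewrite divr_ge0 ?sqr_ge0// mulr_ge0// ltW.
rewrite big_split/= -!mulr_sumr -!tdist_sqr -/A -/B.
by rewrite le_eqVlt; apply/orP; left; apply/eqP; field; rewrite A0 B0.
Qed.

Lemma tball_subset n (a b : n.-tuple R) r s :
  tdist a b + r <= s -> tball a r `<=` tball b s.
Proof.
move=> h y; rewrite /tball/= => ay.
apply: (le_lt_trans (tdist_triangle b a y)); rewrite tdistC.
by apply: lt_le_trans h; rewrite ltrD2l.
Qed.

Lemma tball_set0 n (a : n.-tuple R) r : ~ 0 < r -> tball a r = set0.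
Proof.
move=> r0; apply/seteqP; split => // x; rewrite /tball/= => h.
by apply: r0; apply: le_lt_trans h; exact: tdist_ge0.
Qed.

Lemma tball_le n (a : n.-tuple R) r s : r <= s -> tball a r `<=` tball a s.
Proof. by move=> rs; apply: tball_subset; rewrite tdistxx add0r. Qed.

(** The recursion defining [lebn] computes the volume of a cube exactly; balls are measured only by
    comparison with cubes. *)
Definition tcube n (a : n.-tuple R) (r : R) : set (n.-tuple R) :=
  [set y | forall i, `|tnth a i - tnth y i| < r].

Lemma lebn_tcube n (a : n.-tuple R) r : 0 < r ->
  @lebn R n (tcube a r) = ((2 * r) ^+ n)%:E.
Proof.
move=> r0; elim: n a => [|n IH] a /=.
  by rewrite ifT//; apply/asboolP => -[].
rewrite [a]tuple_eta; set a0 := thead a; set a' := behead_tuple a.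
have cubeE x t : tcube (cons_tuple a0 a') r (cons_tuple x t) <->
    ball a0 r x /\ tcube a' r t.
  split=> [h|[xb h] i].
    split; first by have := h ord0; rewrite !tnth0.
    by move=> i; have := h (lift ord0 i); rewrite !tnthS.
  by case: (unliftP ord0 i) => [j ->|->]; rewrite ?tnth0// !tnthS; exact: h.
transitivity (\int[@lebesgue_measure R]_(x in setT)
    (((2 * r) ^+ n)%:E * (\1_(ball a0 r) x)%:E))%E.
  apply: eq_integral => x _; rewrite indicE.
  have [xb|xb] := boolP (x \in _).
    rewrite mule1 -(IH a'); congr (@lebn R n _); rewrite inE in xb.
    by apply/seteqP; split => t /= => [/cubeE[]//|ht]; apply/cubeE.
  rewrite mule0 -(measure0 (@lebn R n)); congr (@lebn R n _).
  apply/seteqP; split => t //= /cubeE[xb' _].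
  by move: xb; rewrite notin_setE.
rewrite ge0_integralZl//=; last 2 first.
- apply/measurable_EFinP; apply: measurable_indic; exact: measurable_ball.
- by rewrite lee_fin exprn_ge0// mulr_ge0// ltW.
rewrite integral_indic//= ?setIT; last exact: measurable_ball.
rewrite lebesgue_measure_ball ?ltW// -EFinM exprSr; congr (EFin (_ * _)).
by rewrite mulr_natl.
Qed.

Lemma measurable_tcube n (a : n.-tuple R) r : measurable (tcube a r).
Proof.
rewrite (_ : tcube a r =
  \bigcap_(i in [set: 'I_n]) ((fun y => tnth y i) @^-1` (ball (tnth a i) r))).
  apply: fin_bigcap_measurable; first exact: finite_finset.
  move=> i _; rewrite -[X in measurable X]setTI.
  by apply: measurable_tnth => //; exact: measurable_ball.
by apply/seteqP; split => y /= h i; [move=> _; exact: h | exact: (h i)].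
Qed.

(** Dividing by n + 1 instead of the square root of n keeps the inclusion in the open ball strict
    and the case n = 0 uniform: n < (n + 1)^2. *)
Lemma tcube_subset_tball n (a : n.-tuple R) r : 0 < r ->
  tcube a (r / n.+1%:R) `<=` tball a r.
Proof.
move=> r0 y h; rewrite /tball/=.
rewrite -ltr_sqr ?nnegrE ?tdist_ge0 ?ltW// tdist_sqr.
apply: (@le_lt_trans _ _ (\sum_(i < n) (r / n.+1%:R) ^+ 2)).
  apply: ler_sum => i _; rewrite -real_normK ?num_real//.
  by rewrite ler_sqr ?nnegrE// ltW// divr_gt0.
rewrite sumr_const card_ord expr_div_n -[ltLHS]mulr_natl mulrA.
rewrite ltr_pdivrMr ?exprn_gt0// mulrC ltr_pM2l ?exprn_gt0// -natrX ltr_nat.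
by rewrite (@leq_trans (n.+1))// leq_pmulr.
Qed.

Lemma tball_volume n (a : n.-tuple R) r : 0 < r ->
  (((2 / n.+1%:R) ^+ n * r ^+ n)%:E <= @lebn R n (tball a r) <=
   (2 ^+ n * r ^+ n)%:E)%E.
Proof.
move=> r0; apply/andP; split.
  have d0 : 0 < r / n.+1%:R by rewrite divr_gt0.
  have -> : (2 / n.+1%:R) ^+ n * r ^+ n = (2 * (r / n.+1%:R)) ^+ n.
    by rewrite -exprMn mulrA mulrAC.
  rewrite -(lebn_tcube a d0); apply: le_measure; rewrite ?inE.
  - exact: measurable_tcube.
  - exact: measurable_tball.
  exact: tcube_subset_tball.
rewrite -exprMn -(lebn_tcube a r0); apply: le_measure; rewrite ?inE.
- exact: measurable_tball.
- exact: measurable_tcube.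
move=> y h i; apply: le_lt_trans h.
rewrite -ler_sqr ?nnegrE ?tdist_ge0// tdist_sqr real_normK ?num_real//.
rewrite (bigD1 i)//= lerDl sumr_ge0// => j _; exact: sqr_ge0.
Qed.

End balls.

(** * Geometric series and real interpolation *)

Section series_bounds.
Variable R : realType.

Lemma nneseries_le_bound (u : nat -> \bar R) (y : \bar R) :
  (forall k, 0 <= u k)%E -> (forall N, \sum_(0 <= k < N) u k <= y)%E ->
  (\sum_(k <oo) u k <= y)%E.
Proof.
move=> u0 uy; apply: lime_le; first by apply: is_cvg_nneseries.
exact: nearW.
Qed.

Lemma nneseries_ge_term (u : nat -> \bar R) k :
  (forall k, 0 <= u k)%E -> (u k <= \sum_(k <oo) u k)%E.
Proof.
move=> u0; apply: le_trans (nneseries_lim_ge k.+1 _) => //.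
by rewrite big_nat_recr//= leeDr// sume_ge0.
Qed.

Lemma powR_gt1 (a r : R) : 1 < a -> 0 < r -> 1 < a `^ r.
Proof.
move=> a1 r0; suff : 1 `^ r < a `^ r by rewrite powR1.
by apply: gt0_ltr_powR; rewrite ?nnegrE// (le_trans ler01)// ltW.
Qed.

Lemma powRXn (a r : R) k : 0 <= a -> (a ^+ k) `^ r = (a `^ r) ^+ k.
Proof.
by move=> a0; rewrite -powR_mulrn// -powRrM mulrC powRrM powR_mulrn// powR_ge0.
Qed.

(** A geometric sum is at most g / (g - 1) times its last term, and the last term kept here lies
    below [y]. *)
Lemma sum_geometric_below (g del y : R) N :
  1 < g -> 0 <= del -> 0 <= y ->
  \sum_(0 <= k < N | del * g ^+ k < y) del * g ^+ k <= g / (g - 1) * y.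
Proof.
move=> g1 d0 y0; have g10 : 0 < g - 1 by rewrite subr_gt0.
have gp : 0 < g by lra.
elim: N => [|N IH]; first by rewrite big_geq// mulr_ge0// divr_ge0// ltW.
rewrite big_mkcond big_nat_recr//= -big_mkcond/=.
case: ifPn => hN; last by rewrite addr0.
apply: (@le_trans _ _ (\sum_(0 <= k < N.+1) del * g ^+ k)).
  rewrite big_nat_recr//= lerD2r big_mkcond/=.
  by apply: ler_sum => i _; case: ifP => // _; rewrite mulr_ge0// exprn_ge0// ltW.
have -> : \sum_(0 <= k < N.+1) del * g ^+ k = del * (g ^+ N.+1 - 1) / (g - 1).
  rewrite -mulr_sumr big_mkord subrX1; field.
  by rewrite gt_eqF.
rewrite ler_pdivrMr//.
have -> : g / (g - 1) * y * (g - 1) = g * y by field; rewrite gt_eqF.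
rewrite exprS.
have : del * g ^+ N <= y by exact: ltW.
move=> /(ler_wpM2l (ltW gp)); lra.
Qed.

Lemma expr_unbounded (g y : R) : 1 < g -> exists k : nat, y < g ^+ k.
Proof.
move=> g1; have bernoulli k : 1 + k%:R * (g - 1) <= g ^+ k.
  elim: k => [|k IH]; first by rewrite mul0r addr0 expr0.
  rewrite exprS -natr1.
  have h1 : g * (1 + k%:R * (g - 1)) <= g * g ^+ k by rewrite ler_wpM2l//; lra.
  have h2 : 0 <= k%:R * (g - 1) ^+ 2 by rewrite mulr_ge0// sqr_ge0.
  by rewrite expr2 in h2; lra.
exists (Num.truncn (y / (g - 1))).+1; apply: lt_le_trans (bernoulli _).
have g10 : 0 < g - 1 by rewrite subr_gt0.
have := truncnS_gt (y / (g - 1)); rewrite ltr_pdivrMr// => h.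
by apply: (lt_le_trans h); rewrite lerDr.
Qed.

(** Strict on the left, to land in an open level set, or in an open ball of a shrinking family. The
    variant that follows is strict on the right, for growing balls. *)
Lemma expr_bracket (g y : R) : 1 < g -> 1 < y ->
  exists k : nat, g ^+ k < y <= g ^+ k.+1.
Proof.
move=> g1 y1.
have ex : exists k, y <= g ^+ k.
  by have [k /ltW hk] := expr_unbounded y g1; exists k.
case: (ex_minnP ex) => -[|k] hk kmin; first by move: hk; rewrite expr0 leNgt y1.
exists k; rewrite hk andbT ltNge; apply/negP => /kmin.
by rewrite ltnn.
Qed.

Lemma expr_bracket_le (g y : R) : 1 < g -> 1 <= y ->
  exists k : nat, g ^+ k <= y < g ^+ k.+1.
Proof.
move=> g1 y1.
have ex : exists k, y < g ^+ k by exact: expr_unbounded.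
case: (ex_minnP ex) => -[|k] hk kmin; first by move: hk; rewrite expr0 ltNge y1.
exists k; rewrite hk andbT leNgt; apply/negP => /kmin.
by rewrite ltnn.
Qed.

End series_bounds.

(** The factor 2^s A comes from replacing F by twice the dyadic level below it and applying the weak
    bound there. The rest is the geometric sum of lam^(s - 1) over the dyadic lam below 2 f. *)
Definition weak11_const (R : realType) (A s : R) : R :=
  2 `^ s * A * (2 `^ (s - 1) / (2 `^ (s - 1) - 1) * 2 `^ (s - 1)).

Section marcinkiewicz.
Local Open Scope ereal_scope.
Context d (T : measurableType d) (R : realType).
Variable mu : {measure set T -> \bar R}.
Variable v : T -> R.
Hypothesis mv : measurable_fun setT v.
Hypothesis v0 : forall x, (0 <= v x)%R.

Variables (f F : T -> \bar R) (A s : R).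
Hypothesis mf : measurable_fun setT f.
Hypothesis mF : measurable_fun setT F.
Hypothesis f0 : forall x, 0 <= f x.
Hypothesis F0 : forall x, 0 <= F x.
Hypothesis s1 : (1 < s)%R.
Hypothesis A0 : (0 <= A)%R.

(** Weak type (1,1) with the L^infinity bound built in: the part of [f] below [lam / 2] has already
    been discarded. *)
Hypothesis weak : forall lam : R, (0 < lam)%R ->
  lam%:E * \int[mu]_(x in [set x | lam%:E < F x]) (v x)%:E <=
  A%:E * \int[mu]_(x in [set x | (lam / 2)%:E < f x]) (f x * (v x)%:E).

Let c := weak11_const A s.

Let mlevel (h : T -> \bar R) (y : \bar R) : measurable_fun setT h ->
  measurable [set x | y < h x].
Proof.
by move=> mh; rewrite -[X in measurable X]setTI; exact: emeasurable_fun_o_infty.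
Qed.

Section truncated.
Variable m : nat.
(** Dyadic levels from 2^-m upwards, indexed by naturals. Letting [m] grow recovers all of F > 0 by
    monotone convergence. *)
Let lam k : R := (2 ^+ k / 2 ^+ m)%R.

Let lam_gt0 k : (0 < lam k)%R.
Proof. by rewrite /lam divr_gt0// exprn_gt0. Qed.

(** A single summand suffices when F x is finite: the level with lam k < F x <= 2 lam k. *)
Let layer_le x : (lam 0%N)%:E < F x ->
  F x `^ s * (v x)%:E <= \sum_(k <oo)
    ((2 * lam k) `^ s)%:E * ((fun x => (v x)%:E) \_ [set x | (lam k)%:E < F x]) x.
Proof.
move=> Fx.
pose u k := ((2 * lam k) `^ s)%:E *
  ((fun x => (v x)%:E) \_ [set x | (lam k)%:E < F x]) x.
rewrite -[leRHS]/(\sum_(k <oo) u k).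
have u0 k : 0 <= u k.
  rewrite /u mule_ge0 ?lee_fin ?powR_ge0// patchE; case: ifP => // _.
  by rewrite lee_fin.
case FxE : (F x) Fx => [r| |]; last 2 first.
(* An infinite F x lies above every level, and the summands are unbounded unless the density
   vanishes at x. *)
- move=> _; have [->|vx] := eqVneq (v x) 0%R.
    by rewrite mule0; exact: nneseries_ge0.
  have vp : (0 < v x)%R by rewrite lt_neqAle eq_sym vx v0.
  rewrite [leLHS](_ : _ = +oo); last first.
    by rewrite poweRyr ?gt_eqF ?(lt_trans _ s1)// gt0_mulye.
  rewrite leye_eq; apply/eqP/eqyP => M M0.
  have g1 : (1 < 2 `^ s)%R by rewrite powR_gt1 ?ltr1n// (lt_trans _ s1).
  have [k hk] := expr_unbounded (M / (v x * (2 * lam 0%N) `^ s)) g1.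
  apply: le_trans (nneseries_ge_term k u0); rewrite /u patchE mem_set//=.
    rewrite -EFinM lee_fin.
    have -> : lam k = (2 ^+ k * lam 0%N)%R by rewrite /lam expr0 mul1r.
    rewrite mulrCA powRM// ?mulr_ge0 ?exprn_ge0 ?ltW//.
    move: hk; rewrite ltr_pdivrMr; last first.
      by rewrite mulr_gt0// powR_gt0// mulr_gt0.
    rewrite powRXn// => /lt_le_trans; apply; rewrite le_eqVlt.
    by apply/predU1P; left; ring.
  by rewrite /= FxE ltry.
- by move=> _; have := F0 x; rewrite FxE.
- rewrite lte_fin => lr.
  have [k /andP[k1 k2]] : exists k, (2 ^+ k < 2 ^+ m * r <= 2 ^+ k.+1)%R.
    apply: expr_bracket; first by rewrite ltr1n.
    by move: lr; rewrite /lam expr0 ltr_pdivrMr ?exprn_gt0// mulrC.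
  have lamr : (lam k < r)%R by rewrite /lam ltr_pdivrMr ?exprn_gt0// mulrC.
  apply: le_trans (nneseries_ge_term k u0); rewrite /u patchE mem_set//=.
    rewrite ?poweR_EFin -!EFinM lee_fin ler_wpM2r//.
    apply: ge0_ler_powR; rewrite ?nnegrE ?(le_trans _ (ltW s1))//.
    - exact: (le_trans (ltW (lam_gt0 k)) (ltW lamr)).
    - by rewrite mulr_ge0// ltW.
    - by rewrite /lam mulrA ler_pdivlMr ?exprn_gt0// -exprS mulrC.
  by rewrite /= FxE lte_fin.
Qed.

(** The levels that count are those below 2 f x. As s > 1, the powers lam^(s - 1) grow
    geometrically, so their sum is of the order of the largest one. *)
Let layer_ge x : \sum_(k <oo) ((lam k) `^ (s - 1))%:E *
    ((fun x => f x * (v x)%:E) \_ [set x | (lam k / 2)%:E < f x]) x <=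
  (2 `^ (s - 1) / (2 `^ (s - 1) - 1) * 2 `^ (s - 1))%:E * (f x `^ s * (v x)%:E).
Proof.
have g1 : (1 < 2 `^ (s - 1) :> R)%R by rewrite powR_gt1 ?ltr1n ?subr_gt0.
set C := (X in X%:E * _).
have C0 : (0 < C)%R.
  by rewrite /C mulr_gt0 ?powR_gt0// divr_gt0 ?powR_gt0// subr_gt0.
apply: nneseries_le_bound => [k|N].
  rewrite mule_ge0 ?lee_fin ?powR_ge0// patchE; case: ifP => // _.
  by rewrite mule_ge0 ?lee_fin.
have [vx|vx] := eqVneq (v x) 0%R.
  rewrite vx !mule0 big1// => k _.
  by rewrite patchE; case: ifP; rewrite ?vx ?mule0.
have vp : (0 < v x)%R by rewrite lt_neqAle eq_sym vx v0.
case fxE : (f x) => [r| |]; last 2 first.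
- rewrite poweRyr ?gt_eqF ?(lt_trans _ s1)// gt0_mulye//.
  by rewrite mulry gtr0_sg// mul1e leey.
- by have := f0 x; rewrite fxE.
have r0 : (0 <= r)%R by have := f0 x; rewrite fxE lee_fin.
have -> : \sum_(0 <= k < N) ((lam k) `^ (s - 1))%:E *
    ((fun x => f x * (v x)%:E) \_ [set x | (lam k / 2)%:E < f x]) x =
  ((\sum_(0 <= k < N | (lam k < 2 * r)%R) (lam k) `^ (s - 1)) * (r * v x))%:E.
  rewrite mulr_suml -sumEFin [RHS]big_mkcond; apply: eq_bigr => k _.
  rewrite patchE; case: (ltP (lam k) (2 * r)%R) => h.
    by rewrite mem_set ?fxE -?EFinM//= fxE lte_fin ltr_pdivrMr// mulrC.
  rewrite memNset ?mule0//= fxE lte_fin ltr_pdivrMr// mulrC.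
  by apply/negP; rewrite -leNgt.
rewrite poweR_EFin -!EFinM lee_fin.
have -> : (C * (r `^ s * v x) = C * r `^ (s - 1) * (r * v x))%R.
  by rewrite -(mulr_powRB1 r0 (lt_trans ltr01 s1)); ring.
rewrite ler_wpM2r ?mulr_ge0//.
have lamE k : (lam k `^ (s - 1) = (lam 0%N) `^ (s - 1) * (2 `^ (s - 1)) ^+ k)%R.
  have -> : lam k = (2 ^+ k * lam 0%N)%R by rewrite /lam expr0 mul1r.
  by rewrite powRM ?exprn_ge0 ?ltW// powRXn// mulrC.
have -> : (C * r `^ (s - 1) =
    2 `^ (s - 1) / (2 `^ (s - 1) - 1) * (2 * r) `^ (s - 1))%R.
  by rewrite powRM// /C !mulrA.
have d0 : (0 <= lam 0%N `^ (s - 1))%R by exact: powR_ge0.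
apply: le_trans (sum_geometric_below N g1 d0 (powR_ge0 _ _)).
rewrite big_mkcond [leRHS]big_mkcond/=; apply: ler_sum => k _.
case: ifPn => h1; rewrite -lamE; last by case: ifP => // _; exact: powR_ge0.
rewrite ifT//; apply: gt0_ltr_powR; rewrite ?subr_gt0 ?nnegrE ?mulr_ge0//.
Qed.

(** Layer by layer, the weak inequality turns lam^s times the mass of F > lam into lam^(s - 1) times
    an integral of f. Exchanging sum and integral before and after reduces the claim to [layer_le]
    and [layer_ge]. *)
Lemma truncated_layer_bound : \int[mu]_(x in [set x | (lam 0%N)%:E < F x])
    (F x `^ s * (v x)%:E) <= c%:E * \int[mu]_x (f x `^ s * (v x)%:E).
Proof.
have mvE : measurable_fun setT (fun x => (v x)%:E) by exact/measurable_EFinP.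
have mfv : measurable_fun setT (fun x => f x * (v x)%:E).
  exact: emeasurable_funM.
have mp (h : T -> \bar R) : measurable_fun setT h ->
    measurable_fun setT (fun x => h x `^ s * (v x)%:E).
  move=> mh; apply: emeasurable_funM => //.
  exact: (measurableT_comp (measurable_poweR s)).
have mvl k : measurable_fun setT
    ((fun x => (v x)%:E) \_ [set x | (lam k)%:E < F x]).
  by apply/(measurable_restrictT _ (mlevel _ mF)).1; exact: measurable_funTS.
have mfl k : measurable_fun setT
    ((fun x => f x * (v x)%:E) \_ [set x | (lam k / 2)%:E < f x]).
  by apply/(measurable_restrictT _ (mlevel _ mf)).1; exact: measurable_funTS.
have cpow k : (lam k `^ s = lam k * lam k `^ (s - 1))%R.
  by rewrite mulr_powRB1 ?ltW// (lt_trans _ s1).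
apply: (@le_trans _ _ (\int[mu]_x (\sum_(k <oo)
    ((2 * lam k) `^ s)%:E *
    ((fun x => (v x)%:E) \_ [set x | (lam k)%:E < F x]) x))).
  rewrite integral_mkcond; apply: ge0_le_integral => //.
  - move=> x _; apply: erestrict_ge0 => y _.
    by rewrite mule_ge0 ?poweR_ge0 ?lee_fin.
  - apply/(measurable_restrictT _ (mlevel _ mF)).1.
    by apply: measurable_funTS; exact: mp.
  - apply: ge0_emeasurable_sum => [k x _ _|k _].
      rewrite mule_ge0 ?lee_fin ?powR_ge0// erestrict_ge0// => y _.
      by rewrite lee_fin.
    exact: measurable_funeM.
  move=> x _; rewrite patchE; case: ifPn => [|_].
    by rewrite inE; exact: layer_le.
  apply: nneseries_ge0 => k _ _.
  by rewrite mule_ge0 ?lee_fin ?powR_ge0// erestrict_ge0// => y _; rewrite lee_fin.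
rewrite integral_nneseries//; last 2 first.
- by move=> k; exact: measurable_funeM.
- move=> k x _.
  by rewrite mule_ge0 ?lee_fin ?powR_ge0// erestrict_ge0// => y _; rewrite lee_fin.
apply: (@le_trans _ _ (\sum_(k <oo) (2 `^ s * A)%:E * \int[mu]_x
  (((lam k) `^ (s - 1))%:E *
    ((fun x => f x * (v x)%:E) \_ [set x | (lam k / 2)%:E < f x]) x))).
  apply: lee_nneseries => k _.
    move=> _; apply: integral_ge0 => x _.
    rewrite mule_ge0 ?lee_fin ?powR_ge0// erestrict_ge0// => y _.
    by rewrite lee_fin.
  rewrite !ge0_integralZl//; last 4 first.
  - by move=> x _; apply: erestrict_ge0 => y _; rewrite mule_ge0 ?lee_fin.
  - by rewrite lee_fin powR_ge0.
  - by move=> x _; apply: erestrict_ge0 => y _; rewrite lee_fin.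
  - by rewrite lee_fin powR_ge0.
  rewrite -!integral_mkcond powRM ?(ltW (lam_gt0 k))// cpow.
  have := weak (lam_gt0 k).
  move=> /(lee_wpmul2l (x := (2 `^ s * lam k `^ (s - 1))%:E)).
  rewrite !muleA -!EFinM => /(_ _).
  rewrite lee_fin mulr_ge0 ?powR_ge0// => /(_ erefl).
  have -> : (2 `^ s * (lam k * lam k `^ (s - 1)) =
    2 `^ s * lam k `^ (s - 1) * lam k)%R by ring.
  by have -> : (2 `^ s * A * lam k `^ (s - 1) = 2 `^ s * lam k `^ (s - 1) * A)%R
    by ring.
rewrite nneseriesZl; last first.
  move=> k _; apply: integral_ge0 => x _.
  rewrite mule_ge0 ?lee_fin ?powR_ge0// erestrict_ge0// => y _.
  by rewrite mule_ge0 ?lee_fin.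
rewrite -integral_nneseries//; last 2 first.
- by move=> k; exact: measurable_funeM.
- move=> k x _; rewrite mule_ge0 ?lee_fin ?powR_ge0// erestrict_ge0// => y _.
  by rewrite mule_ge0 ?lee_fin.
rewrite /c /weak11_const [(2 `^ s * A * _)%:E]EFinM -muleA.
rewrite lee_wpmul2l ?lee_fin ?mulr_ge0 ?powR_ge0//.
rewrite -ge0_integralZl//; last 3 first.
- exact: mp.
- by move=> x _; rewrite mule_ge0 ?poweR_ge0 ?lee_fin.
- have g1 : (1 < 2 `^ (s - 1) :> R)%R by rewrite powR_gt1 ?ltr1n ?subr_gt0.
  by rewrite lee_fin mulr_ge0 ?powR_ge0// divr_ge0 ?powR_ge0// subr_ge0 ltW.
apply: ge0_le_integral => //.
- move=> x _; apply: nneseries_ge0 => k _ _.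
  rewrite mule_ge0 ?lee_fin ?powR_ge0// erestrict_ge0// => y _.
  by rewrite mule_ge0 ?lee_fin.
- apply: ge0_emeasurable_sum => [k x _ _|k _].
    rewrite mule_ge0 ?lee_fin ?powR_ge0// erestrict_ge0// => y _.
    by rewrite mule_ge0 ?lee_fin.
  exact: measurable_funeM.
- by apply: measurable_funeM; exact: mp.
Qed.

End truncated.

Lemma marcinkiewicz_weak11 : \int[mu]_x (F x `^ s * (v x)%:E) <=
  (weak11_const A s)%:E * \int[mu]_x (f x `^ s * (v x)%:E).
Proof.
have mFv : measurable_fun setT (fun x => F x `^ s * (v x)%:E).
  apply: emeasurable_funM; last exact/measurable_EFinP.
  exact: (measurableT_comp (measurable_poweR s)).
pose G m := [set x | (2 ^+ 0 / 2 ^+ m)%:E < F x].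
have mG m : measurable (G m) by exact: mlevel.
have Fv0 x : 0 <= F x `^ s * (v x)%:E by rewrite mule_ge0 ?poweR_ge0 ?lee_fin.
have ndG : nondecreasing_seq G.
  move=> i j ij; rewrite subsetEset => x; apply: le_lt_trans.
  by rewrite lee_fin ler_pM2l// lef_pV2 ?posrE// ler_eXn2l ?ltr1n.
have UG : \bigcup_m G m = [set x | 0 < F x].
  apply/seteqP; split => [x [m _]|x /= Fx].
    by apply: lt_trans; rewrite lte_fin.
  case FxE : (F x) Fx => [r| |//].
  - rewrite lte_fin => r0; have [k hk] := expr_unbounded r^-1 (ltr1n R 2).
    exists k => //; rewrite /G/= FxE lte_fin expr0 mul1r.
    by rewrite -[ltRHS]invrK ltf_pV2 ?posrE ?invr_gt0.
  - by move=> _; exists 0%N => //; rewrite /G/= FxE ltry.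
have -> : \int[mu]_x (F x `^ s * (v x)%:E) =
    \int[mu]_(x in [set x | 0 < F x]) (F x `^ s * (v x)%:E).
  rewrite [RHS]integral_mkcond; apply: eq_integral => x _.
  rewrite patchE; case: ifPn => //; rewrite notin_setE/= => /negP.
  rewrite -leNgt => Fx; have -> : F x = 0 by apply/eqP; rewrite eq_le Fx F0.
  by rewrite poweR0r ?mul0e// gt_eqF// (lt_trans _ s1).
rewrite -UG; have cv := @ge0_nondecreasing_set_cvg_integral _ _ _ G _ mu ndG mG
  (fun i => measurable_funTS mFv) (fun i x _ => Fv0 x).
rewrite -(cvg_lim _ cv)//; apply: lime_le; first by apply: cvgP cv.
by apply: nearW => m; exact: truncated_layer_bound.
Qed.

End marcinkiewicz.

(** * Maximal functions of doubling weights *)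

Section rational_balls.
Variables (R : realType) (n : nat).

(* Countably many balls, so that the maximal function is measurable and the
   covering lemma is applied to finitely many of them; indices that encode no
   pair give the unit ball at the origin. *)
Definition rational_ball (i : nat) : n.-tuple R * R :=
  if unpickle i is Some qr then
    ([tuple of map ratr (qr : n.-tuple rat * rat).1],
     if 0 < qr.2 then ratr qr.2 else 1)
  else ([tuple of nseq n 0], 1).

Definition rball i : set (n.-tuple R) :=
  tball (rational_ball i).1 (rational_ball i).2.

Lemma rational_ball_gt0 i : 0 < (rational_ball i).2.
Proof.
rewrite /rational_ball; case: unpickle => [[a r]|//] /=.
by case: ifP => //; rewrite ltr0q.
Qed.

(** The factor 4 here is the one for which doubling is assumed below; it also absorbs the factor 3
    of the covering lemma. *)
Lemma rball_approx (a : n.-tuple R) r : 0 < r ->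
  exists i, [/\ tball a r `<=` rball i, rball i `<=` tball a (4 * r) &
    (rational_ball i).2 <= 4 * r].
Proof.
move=> r0; have d0 : 0 < r / n.+1%:R by rewrite divr_gt0.
set d := r / _ in d0.
have /choice[q hq] : forall i : 'I_n, exists q : rat,
    `|tnth a i - ratr q| < d.
  move=> i; have /rat_in_itvoo[q] : tnth a i - d < tnth a i + d by lra.
  rewrite in_itv/= => /andP[q1 q2]; exists q; rewrite ltr_norml; lra.
(* The centre moves by less than [r]: a radius above 2 r still covers the given ball, and one below
   3 r stays within its 4-fold dilation. *)
have /rat_in_itvoo[rho] : 2 * r < 3 * r by lra.
rewrite in_itv/= => /andP[rho1 rho2].
have rho0 : 0 < rho by rewrite -(ltr0q R); lra.
exists (pickle ([tuple q i | i < n], rho)).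
rewrite /rball /rational_ball pickleK/= rho0.
set c := [tuple of map _ _].
have ac : tdist a c < r.
  apply: tcube_subset_tball => // i.
  by rewrite /c tnth_map tnth_mktuple; exact: hq.
split; last lra.
  by apply: tball_subset; lra.
by apply: tball_subset; rewrite tdistC; lra.
Qed.

End rational_balls.

(** * Vitali's covering lemma for finitely many balls *)

Section vitali.
Variables (R : realType) (n : nat) (c : nat -> n.-tuple R) (r : nat -> R).
Hypothesis r0 : forall i, 0 < r i.

(** Greedy choice: a ball of largest radius is kept, and the balls meeting it lie in its 3-fold
    dilation because their radii are no larger. The induction continues with the balls disjoint from
    it. *)
Lemma vitali_selection (s : seq nat) : exists t : seq nat,
  [/\ {subset t <= s}, uniq t,
      trivIset [set` t] (fun i => tball (c i) (r i)) &
      forall i, i \in s -> exists2 j, j \in t &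
        tball (c i) (r i) `<=` tball (c j) (3 * r j)].
Proof.
have [N] := ubnP (size s); elim: N s => // N IH s sN.
have [->|s0] := eqVneq s [::].
  by exists [::]; split => //; move=> i j /=.
have [j js jmax] : exists2 j, j \in s & forall i, i \in s -> r i <= r j.
  clear sN; elim: s s0 => // x s IHs _; have [->|s0] := eqVneq s [::].
    by exists x; rewrite ?inE// => i; rewrite inE => /eqP ->.
  have [j js jmax] := IHs s0; have [xj|jx] := leP (r x) (r j).
    by exists j => [|i]; rewrite !inE ?js ?orbT// => /predU1P[->//|/jmax].
  exists x => [|i]; rewrite !inE ?eqxx// => /predU1P[->//|/jmax].
  by move=> /le_trans; apply; exact: ltW.
pose B i := tball (c i) (r i).
pose s' := [seq i <- s | `[< B i `&` B j = set0 >]].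
have Bc i : B i (c i) by rewrite /B /tball/= tdistxx.
have [|t [ts ut tt ht]] := IH s'.
  rewrite -ltnS (leq_trans _ sN)// ltnS size_filter.
  rewrite ltn_neqAle count_size andbT -all_count.
  apply/negP => /allP /(_ j js)/asboolP; rewrite setIid => Bj.
  by have := Bc j; rewrite Bj.
have ts' i : i \in t -> i \in s /\ B i `&` B j = set0.
  by move=> /ts; rewrite mem_filter => /andP[/asboolP].
exists (j :: t); split => [i|||i is_].
- by rewrite inE => /predU1P[->//|/ts'[]].
- rewrite /= ut andbT; apply/negP => /ts'[_]; rewrite setIid => Bj.
  by have := Bc j; rewrite Bj.
- apply/trivIsetP => i k /=; rewrite !inE.
  move=> /predU1P[->|it] /predU1P[->|kt]; rewrite ?eqxx// => ik.
  + by rewrite setIC; exact: (ts' _ kt).2.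
  + exact: (ts' _ it).2.
  + by move/trivIsetP : tt; apply.
have [ij|/asboolP ij] := pselect (B i `&` B j = set0).
  have [|k kt hk] := ht i; first by rewrite mem_filter is_ andbT; apply/asboolP.
  by exists k => //; rewrite inE kt orbT.
exists j; first by rewrite mem_head.
move/asboolP/eqP/set0P : ij => [x [xi xj]].
apply: tball_subset; rewrite tdistC; have := jmax i is_.
have := tdist_triangle (c j) x (c i); rewrite [tdist x _]tdistC.
by move: xi xj; rewrite /B /tball/=; lra.
Qed.

End vitali.

Section integral_subadditivity.
Local Open Scope ereal_scope.
Context d (T : measurableType d) (R : realType).
Variable mu : {measure set T -> \bar R}.
Variable h : T -> \bar R.
Hypothesis mh : measurable_fun setT h.
Hypothesis h0 : forall x, 0 <= h x.

Lemma ge0_integral_split (A B : set T) : measurable A -> measurable B ->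
  \int[mu]_(x in A) h x =
  \int[mu]_(x in A `&` B) h x + \int[mu]_(x in A `\` B) h x.
Proof.
move=> mA mB; rewrite -[in LHS](setUIDK A B) ge0_integral_setU//.
- exact: measurableI.
- exact: measurableD.
- exact: measurable_funTS.
- rewrite disj_set2E; apply/eqP/seteqP; split => // x /=.
  by move=> [[_ xB] [_]].
Qed.

Lemma ge0_integral_bigsetU_le (I : Type) (s : seq I) (P : pred I)
    (F : I -> set T) : (forall i, measurable (F i)) ->
  \int[mu]_(x in \big[setU/set0]_(i <- s | P i) F i) h x <=
  \sum_(i <- s | P i) \int[mu]_(x in F i) h x.
Proof.
move=> mF; elim: s => [|i s IH]; first by rewrite !big_nil integral_set0.
rewrite !big_cons; case: ifPn => // Pi.
have mU : measurable (\big[setU/set0]_(j <- s | P j) F j).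
  by apply: bigsetU_measurable.
rewrite (@ge0_integral_split _ (F i))//; last exact: measurableU.
apply: leeD; first by rewrite setIidr//; exact: subsetUl.
apply: le_trans IH; apply: ge0_subset_integral => //.
- by apply: measurableD => //; exact: measurableU.
- exact: measurable_funTS.
- by move=> x [[|]//].
Qed.

End integral_subadditivity.

(** * Weak and strong type of the maximal operator of a doubling weight *)

Section maximal_function.
Local Open Scope ereal_scope.
Variables (R : realType) (n : nat) (v : n.-tuple R -> R) (D : R).
Hypothesis mv : measurable_fun setT v.
Hypothesis v0 : forall x, (0 <= v x)%R.
Hypothesis v_gt0 : forall a r, (0 < r)%R -> 0 < wmeas v (tball a r).
Hypothesis v_fin : forall a r, wmeas v (tball a r) < +oo.
Hypothesis D0 : (0 <= D)%R.
Hypothesis v_doubling : forall a r, (0 < r)%R ->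
  wmeas v (tball a (4 * r)) <= D%:E * wmeas v (tball a r).

Local Notation rball := (@rball R n).

Let V i : R := fine (wmeas v (rball i)).

Let VE i : (V i)%:E = wmeas v (rball i).
Proof.
rewrite fineK// ge0_fin_numE; first exact: v_fin.
by apply: integral_ge0 => x _; rewrite lee_fin.
Qed.

Let V_gt0 i : (0 < V i)%R.
Proof. by rewrite -lte_fin VE; apply: v_gt0; exact: rational_ball_gt0. Qed.

Let mB i : measurable (rball i).
Proof. exact: measurable_tball. Qed.

(** Noncentred maximal function for the measure with density [v]. The indicator gives balls missing
    x the value 0, which does not affect a supremum of nonnegative averages. *)
Definition maxf (g : n.-tuple R -> \bar R) (x : n.-tuple R) : \bar R :=
  esups (fun i => (\int[@lebn R n]_(y in rball i) (g y * (v y)%:E)) *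
    ((V i)^-1)%:E * (\1_(rball i) x)%:E) 0%N.

Section fixed_function.
Variable g : n.-tuple R -> \bar R.
Hypothesis mg : measurable_fun setT g.
Hypothesis g0 : forall x, 0 <= g x.

Let mgv : measurable_fun setT (fun x => g x * (v x)%:E).
Proof. by apply: emeasurable_funM => //; exact/measurable_EFinP. Qed.

Let gv0 x : 0 <= g x * (v x)%:E.
Proof. by rewrite mule_ge0 ?lee_fin. Qed.

Lemma measurable_maxf : measurable_fun setT (maxf g).
Proof.
apply: measurable_fun_esups => i; apply: measurable_funeM.
by apply/measurable_EFinP; exact: measurable_indic.
Qed.

Let le_maxf i x : rball i x ->
  \int[@lebn R n]_(y in rball i) (g y * (v y)%:E) <= (V i)%:E * maxf g x.
Proof.
move=> xi; rewrite muleC -lee_pdivrMr//.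
apply: ereal_sup_ubound; exists i => //=.
by rewrite indicE mem_set// mule1.
Qed.

Lemma maxf_ge0 x : 0 <= maxf g x.
Proof.
apply: (@le_trans _ _ (\int[@lebn R n]_(y in rball 0%N) (g y * (v y)%:E) *
    ((V 0%N)^-1)%:E * (\1_(rball 0%N) x)%:E)).
  by rewrite !mule_ge0 ?integral_ge0 ?lee_fin ?invr_ge0// ltW.
by apply: ereal_sup_ubound; exists 0%N.
Qed.

(** An arbitrary ball is enlarged to a rational one inside its 4-fold dilation, and doubling pays
    for the larger mass. *)
Lemma maxf_average a r x : (0 < r)%R -> tball a r x ->
  \int[@lebn R n]_(y in tball a r) (g y * (v y)%:E) <=
  D%:E * wmeas v (tball a r) * maxf g x.
Proof.
move=> r0 xa; have [i [ai ia _]] := rball_approx a r0.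
apply: (@le_trans _ _ (\int[@lebn R n]_(y in rball i) (g y * (v y)%:E))).
  apply: ge0_subset_integral => //; first exact: measurable_tball.
  exact: measurable_funTS.
apply: (le_trans (le_maxf (ai _ xa))); rewrite VE.
apply: lee_wpmul2r; first exact: maxf_ge0.
apply: le_trans (v_doubling a r0).
apply: ge0_subset_integral => //; first exact: measurable_tball.
- by apply: measurable_funTS; exact/measurable_EFinP.
- by move=> y _; rewrite lee_fin.
Qed.

Variable lam : R.
Hypothesis lam0 : (0 < lam)%R.

Let J i := `[< lam%:E * (V i)%:E <
  \int[@lebn R n]_(y in rball i) (g y * (v y)%:E) >].

Let level_maxf : [set x | lam%:E < maxf g x] =
  \bigcup_N \big[setU/set0]_(0 <= i < N | J i) rball i.
Proof.
apply/seteqP; split => x /=.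
  move=> /ereal_sup_gt[_ [i _ <-]].
  rewrite indicE; have [xi|_] := boolP (x \in _); last first.
    by rewrite mule0 lte_fin ltNge ltW.
  rewrite mule1 lte_pdivlMr// => hi; exists i.+1 => //.
  rewrite -bigcup_seq_cond; exists i; last by rewrite inE in xi.
  by rewrite /= mem_index_iota/= ltnSn/=; apply/asboolP.
move=> [N _]; rewrite -bigcup_seq_cond => -[i /= /andP[_ /asboolP Ji] xi].
apply: (@lt_le_trans _ _ (\int[@lebn R n]_(y in rball i) (g y * (v y)%:E) *
    ((V i)^-1)%:E * (\1_(rball i) x)%:E)).
  by rewrite indicE mem_set// mule1 lte_pdivlMr.
by apply: ereal_sup_ubound; exists i.
Qed.

Let level_g : measurable [set x | (lam / 2)%:E < g x].
Proof.
by rewrite -[X in measurable X]setTI; exact: emeasurable_fun_o_infty.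
Qed.

(* On a selected ball the part of [g] below [lam / 2] contributes at most half
   of the average, hence the truncation of the right-hand side. *)
Let selected_ball i : J i -> lam%:E * wmeas v (rball i) <= 2%:E *
  \int[@lebn R n]_(y in rball i `&` [set x | (lam / 2)%:E < g x])
    (g y * (v y)%:E).
Proof.
set G := [set x | _ < g x]; move/asboolP.
rewrite (ge0_integral_split _ _ _ (mB i) level_g)// -/G -VE => Ji.
set X := integral _ _ _ in Ji *.
have X0 : 0 <= X by apply: integral_ge0.
have hY : \int[@lebn R n]_(y in rball i `\` G) (g y * (v y)%:E) <=
    (lam / 2)%:E * (V i)%:E.
  have mBG : measurable (rball i `\` G) by exact: measurableD.
  apply: (@le_trans _ _ (\int[@lebn R n]_(y in rball i `\` G)
      ((lam / 2)%:E * (v y)%:E))).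
    apply: ge0_le_integral => //.
    - exact: measurable_funTS.
    - apply: measurable_funTS; apply: measurable_funeM.
      exact/measurable_EFinP.
    - move=> x [_]; rewrite /G/= => /negP; rewrite -leNgt => gx.
      by rewrite lee_wpmul2r ?lee_fin.
  rewrite VE -ge0_integralZl//.
  - apply: ge0_subset_integral => //.
    + apply: measurable_funTS; apply: measurable_funeM.
      exact/measurable_EFinP.
    + by move=> x _; rewrite mule_ge0// lee_fin// divr_ge0// ltW.
  - by apply: measurable_funTS; exact/measurable_EFinP.
  - by move=> x _; rewrite lee_fin.
  - by rewrite lee_fin divr_ge0// ltW.
have {}Ji := lt_le_trans Ji (leeD2l X hY).
case: X X0 Ji => [x| |//].
- rewrite lee_fin => x0; rewrite -!EFinM -EFinD lte_fin lee_fin => h.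
  by have := V_gt0 i; nra.
- by move=> _ _; rewrite mulry gtr0_sg// mul1e leey.
Qed.

(** The finite unions [U N] exhaust the level set. The dilations of the disjoint balls selected
    among them cover [U N] at the cost of [D], and disjointness lets the integrals over the selected
    balls add up; the 2 is that of [selected_ball]. *)
Lemma maxf_weak11 :
  lam%:E * \int[@lebn R n]_(x in [set x | lam%:E < maxf g x]) (v x)%:E <=
  (2 * D)%:E *
     \int[@lebn R n]_(x in [set x | (lam / 2)%:E < g x]) (g x * (v x)%:E).
Proof.
have mvE : measurable_fun setT (fun x => (v x)%:E) by exact/measurable_EFinP.
have vE0 x : 0 <= (v x)%:E by rewrite lee_fin.
pose U N := \big[setU/set0]_(0 <= i < N | J i) rball i.
have mU N : measurable (U N) by exact: bigsetU_measurable.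
have ndU : nondecreasing_seq U.
  apply/nondecreasing_seqP => N; rewrite subsetEset /U.
  by rewrite big_mkcond [X in _ `<=` X]big_mkcond big_nat_recr//=; exact: subsetUl.
have := @ge0_nondecreasing_set_cvg_integral _ _ _ U _ (@lebn R n) ndU mU
  (fun i => measurable_funTS mvE) (fun i x _ => vE0 x).
rewrite level_maxf => cv; rewrite -(cvg_lim _ cv)// -limeMl//; last exact: cvgP cv.
apply: lime_le; first by apply: is_cvgeMl => //; exact: cvgP cv.
apply: nearW => N.
have [t [ts ut tt ht]] := vitali_selection (fun i => (rational_ball R n i).1)
  (fun i => rational_ball_gt0 R n i) [seq i <- index_iota 0 N | J i].
have Jt i : i \in t -> J i by move=> /ts; rewrite mem_filter => /andP[].
apply: (@le_trans _ _ (lam%:E * \sum_(j <- t) D%:E * wmeas v (rball j))).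
  rewrite lee_wpmul2l ?lee_fin ?(ltW lam0)//.
  apply: (@le_trans _ _ (\int[@lebn R n]_(x in \big[setU/set0]_(j <- t)
      tball (rational_ball R n j).1 (4 * (rational_ball R n j).2)) (v x)%:E)).
    apply: ge0_subset_integral => //.
    - by apply: bigsetU_measurable => j _; exact: measurable_tball.
    - exact: measurable_funTS.
    - rewrite /U -bigcup_seq_cond -bigcup_seq => x [i /= /andP[iN Ji] xi].
      have [|j jt ij] := ht i; first by rewrite mem_filter Ji.
      exists j => //; apply: tball_le (ij _ xi).
      by rewrite ler_wpM2r ?ler_nat// ltW// rational_ball_gt0.
  apply: le_trans (ge0_integral_bigsetU_le _ _ _ _ _ _) _ => //.
    by move=> j; exact: measurable_tball.
  by apply: lee_sum => j _; apply: v_doubling; exact: rational_ball_gt0.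
rewrite ge0_sume_distrr; last first.
  by move=> i _; rewrite mule_ge0 ?lee_fin// integral_ge0.
apply: (@le_trans _ _ (\sum_(j <- t) (2 * D)%:E *
  \int[@lebn R n]_(y in rball j `&` [set x | (lam / 2)%:E < g x])
    (g y * (v y)%:E))).
  rewrite big_seq [leRHS]big_seq; apply: lee_sum => j jt.
  have /(lee_wpmul2l (x := D%:E)) := selected_ball (Jt _ jt).
  rewrite lee_fin D0 => /(_ erefl).
  by rewrite muleCA [D%:E * (2%:E * _)]muleA -EFinM [(D * 2)%R]mulrC.
rewrite -ge0_sume_distrr; last by move=> j _; exact: integral_ge0.
rewrite lee_wpmul2l ?lee_fin ?mulr_ge0//.
rewrite -ge0_integral_bigsetU//.
- apply: ge0_subset_integral => //.
  + by apply: bigsetU_measurable => j _; exact: measurableI.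
  + exact: measurable_funTS.
  + by rewrite -bigcup_seq => x [j _ []].
- by move=> j; exact: measurableI.
- apply/trivIsetP => i k /= it kt ik; rewrite setIACA.
  by move/trivIsetP : tt => /(_ i k it kt ik) ->; rewrite set0I.
- exact: measurable_funTS.
Qed.

End fixed_function.

Lemma maxf_strong (s : R) (g : n.-tuple R -> \bar R) : (1 < s)%R ->
  measurable_fun setT g -> (forall x, 0 <= g x) ->
  \int[@lebn R n]_x (maxf g x `^ s * (v x)%:E) <=
  (weak11_const (2 * D) s)%:E * \int[@lebn R n]_x (g x `^ s * (v x)%:E).
Proof.
move=> s1 mg g0; apply: marcinkiewicz_weak11 => //.
- exact: measurable_maxf.
- by move=> x; exact: maxf_ge0.
- by rewrite mulr_ge0.
- by move=> lam lam0; exact: maxf_weak11.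
Qed.

End maximal_function.

(** * Hölder's inequality on a set and positivity of integrals *)

Section integral_tools.
Local Open Scope ereal_scope.
Context d (T : measurableType d) (R : realType).
Variable mu : {measure set T -> \bar R}.

Lemma measurable_patch (E : set T) (h : T -> \bar R) : measurable E ->
  measurable_fun setT h -> measurable_fun setT (h \_ E).
Proof.
by move=> mE mh; apply/(measurable_restrictT _ mE).1; exact: measurable_funTS.
Qed.

Lemma hoelder_on (E : set T) (f g : T -> R) (p q : R) : measurable E ->
  measurable_fun setT f -> measurable_fun setT g ->
  (forall x, 0 <= f x)%R -> (forall x, 0 <= g x)%R ->
  (0 < p)%R -> (0 < q)%R -> (p^-1 + q^-1 = 1)%R ->
  \int[mu]_(x in E) (f x * g x)%:E <=
  (\int[mu]_(x in E) (f x `^ p)%:E) `^ p^-1 *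
  (\int[mu]_(x in E) (g x `^ q)%:E) `^ q^-1.
Proof.
move=> mE mf mg f0 g0 p0 q0 pq.
have mr (h : T -> R) : measurable_fun setT h ->
    measurable_fun setT (fun x => h x * \1_E x)%R.
  by move=> mh; apply: measurable_funM => //; exact: measurable_indic.
have intE (h : T -> R) (r : R) : (forall x, 0 <= h x)%R -> (0 < r)%R ->
    \int[mu]_x `|(h x * \1_E x)%:E| `^ r = \int[mu]_(x in E) (h x `^ r)%:E.
  move=> h0 r0; rewrite [RHS]integral_mkcond; apply: eq_integral => x _.
  rewrite patchE indicE; case: ifPn => xE.
    by rewrite mulr1 /= ger0_norm.
  by rewrite mulr0 /= normr0 powR0 ?gt_eqF.
have := hoelder mu (mr _ mf) (mr _ mg) p0 q0 pq.
rewrite Lnorm1 unlock /= !intE//; congr (_ <= _).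
rewrite [RHS]integral_mkcond; apply: eq_integral => x _.
rewrite patchE /= indicE; case: ifPn => xE.
  by rewrite !mulr1 ger0_norm// mulr_ge0.
by rewrite !mulr0 normr0.
Qed.

Lemma integral_gt0 (E : set T) (f : T -> R) : measurable E ->
  measurable_fun setT f -> (forall x, 0 < f x)%R -> 0 < mu E ->
  0 < \int[mu]_(x in E) (f x)%:E.
Proof.
move=> mE mf f0 E0; rewrite lt0e integral_ge0 ?andbT; last first.
  by move=> x _; rewrite lee_fin ltW.
apply/eqP => h.
have : ae_eq mu E (EFin \o f) (cst 0).
  apply/ae_eq_integral_abs => //.
    by apply: measurable_funTS; exact/measurable_EFinP.
  by rewrite -[RHS]h; apply: eq_integral => x _; rewrite /= gtr0_norm.
move=> [N [mN N0 EN]]; move: E0; rewrite (subset_measure0 _ mN)// ?ltxx//.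
move=> x Ex; apply: EN => /= /(_ Ex)/eqP; rewrite eqe => /eqP fx.
by have := f0 x; rewrite fx ltxx.
Qed.

End integral_tools.

(** * Dyadic decomposition of the fractional integral *)

Section kernel.
Local Open Scope ereal_scope.
Variables (R : realType) (n : nat) (alpha : R).
Hypothesis alpha_lt : (alpha < n%:R)%R.
Variable f : n.-tuple R -> R.
Hypothesis mf : measurable_fun setT f.
Hypothesis f0 : forall x, (0 <= f x)%R.

Let beta := (n%:R - alpha)%R.
Let beta0 : (0 < beta)%R. Proof. by rewrite subr_gt0. Qed.

Lemma measurable_riesz_kernel (x : n.-tuple R) :
  measurable_fun setT (fun y => ((tdist x y) `^ (n%:R - alpha))^-1)%R.
Proof.
under eq_fun do rewrite -powRN.
apply: (@measurableT_comp _ _ _ _ _ _ (@powR R ^~ (- (n%:R - alpha))%R)).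
  exact: measurable_powR.
exact: measurable_tdist.
Qed.

Section dyadic.
Variables (x : n.-tuple R) (L rho : R).
Hypotheses (L1 : (1 < L)%R) (rho0 : (0 < rho)%R).

Let term (c r : R) y : \bar R :=
  (c `^ (- beta))%:E * ((EFin \o f) \_ (tball x r)) y.

Let term_ge0 c r y : 0 <= term c r y.
Proof.
by rewrite mule_ge0 ?lee_fin ?powR_ge0// erestrict_ge0// => z _; rewrite lee_fin.
Qed.

Let le_term c r y : (0 < c)%R -> (c <= tdist x y)%R -> (tdist x y < r)%R ->
  (f y * ((tdist x y) `^ (n%:R - alpha))^-1)%:E <= term c r y.
Proof.
move=> c0 cd dr; rewrite /term patchE mem_set//= -EFinM lee_fin mulrC.
rewrite ler_wpM2r// powRN lef_pV2 ?posrE ?powR_gt0//; last exact: lt_le_trans cd.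
by apply: ge0_ler_powR; rewrite ?nnegrE ?tdist_ge0 ?(ltW beta0) ?(ltW c0).
Qed.

(** Each y lies in one annulus around x; there the kernel is at most its value on the inner radius,
    and the annulus is enlarged to a ball. The radius [rho] separating the two sums is free: it
    serves to balance them, or to make the first one vanish. *)
Lemma Ialpha_dyadic : Ialpha alpha f x <=
  \sum_(j <oo) ((rho / L ^+ j.+1) `^ (- beta))%:E *
    \int[@lebn R n]_(y in tball x (rho / L ^+ j)) (f y)%:E +
  \sum_(j <oo) ((rho * L ^+ j) `^ (- beta))%:E *
    \int[@lebn R n]_(y in tball x (rho * L ^+ j.+1)) (f y)%:E.
Proof.
have L0 : (0 < L)%R by exact: lt_trans L1.
have mfE : measurable_fun setT (EFin \o f) by exact/measurable_EFinP.
have mrestr r : measurable_fun setT ((EFin \o f) \_ (tball x r)).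
  by apply: measurable_patch => //; exact: measurable_tball.
have mterm c r : measurable_fun setT (term c r) by exact: measurable_funeM.
have int_term c r : \int[@lebn R n]_y term c r y =
    (c `^ (- beta))%:E * \int[@lebn R n]_(y in tball x r) (f y)%:E.
  rewrite ge0_integralZl//; last 2 first.
  - by move=> y _; apply: erestrict_ge0 => z _; rewrite lee_fin.
  - by rewrite lee_fin powR_ge0.
  by rewrite -integral_mkcond.
pose inner j := term (rho / L ^+ j.+1) (rho / L ^+ j).
pose outer j := term (rho * L ^+ j) (rho * L ^+ j.+1).
have -> : \sum_(j <oo) ((rho / L ^+ j.+1) `^ (- beta))%:E *
    \int[@lebn R n]_(y in tball x (rho / L ^+ j)) (f y)%:E =
    \int[@lebn R n]_y \sum_(j <oo) inner j y.
  rewrite integral_nneseries//; last 2 first.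
  - by move=> j; exact: mterm.
  - by move=> j y _; exact: term_ge0.
  by apply: eq_eseriesr => j _; rewrite int_term.
have -> : \sum_(j <oo) ((rho * L ^+ j) `^ (- beta))%:E *
    \int[@lebn R n]_(y in tball x (rho * L ^+ j.+1)) (f y)%:E =
    \int[@lebn R n]_y \sum_(j <oo) outer j y.
  rewrite integral_nneseries//; last 2 first.
  - by move=> j; exact: mterm.
  - by move=> j y _; exact: term_ge0.
  by apply: eq_eseriesr => j _; rewrite int_term.
have s_ge0 u y : (forall j, 0 <= u j y) -> 0 <= \sum_(j <oo) u j y :> \bar R.
  by move=> u0; exact: nneseries_ge0.
rewrite -ge0_integralD//; last 4 first.
- by move=> y _; apply: nneseries_ge0 => j _ _; exact: term_ge0.
- by apply: ge0_emeasurable_sum => [j y _ _|j _]; [exact: term_ge0|exact: mterm].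
- by move=> y _; apply: nneseries_ge0 => j _ _; exact: term_ge0.
- by apply: ge0_emeasurable_sum => [j y _ _|j _]; [exact: term_ge0|exact: mterm].
apply: ge0_le_integral => //.
- by move=> y _; rewrite lee_fin mulr_ge0// invr_ge0 powR_ge0.
- apply/measurable_EFinP; apply: measurable_funM => //.
  exact: measurable_riesz_kernel.
- apply: emeasurable_funD; apply: ge0_emeasurable_sum => [j y _ _|j _];
    by [exact: term_ge0|exact: mterm].
(* At y = x the formal kernel is the inverse of 0, that is 0, although no annulus contains that
   point. *)
move=> y _; have [->|xy] := eqVneq (tdist x y) 0%R.
  rewrite powR0 ?gt_eqF// invr0 mulr0 adde_ge0//;
    by apply: nneseries_ge0 => j _ _; exact: term_ge0.
have d0 : (0 < tdist x y)%R by rewrite lt_neqAle eq_sym xy tdist_ge0.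
have [dlt|dge] := ltP (tdist x y) rho.
  have [j /andP[j1 j2]] : exists j, (L ^+ j < rho / tdist x y <= L ^+ j.+1)%R.
    by apply: expr_bracket => //; rewrite ltr_pdivlMr// mul1r.
  apply: (@le_trans _ _ (inner j y)).
    apply: le_term; first by rewrite divr_gt0// exprn_gt0.
      by rewrite ler_pdivrMr ?exprn_gt0// mulrC -ler_pdivrMr.
    by rewrite ltr_pdivlMr ?exprn_gt0// mulrC -ltr_pdivlMr.
  apply: (le_trans (@nneseries_ge_term _ (inner^~ y) j _)) => [k|].
    exact: term_ge0.
  by apply: leeDl; apply: nneseries_ge0 => k _ _; exact: term_ge0.
have [j /andP[j1 j2]] : exists j, (L ^+ j <= tdist x y / rho < L ^+ j.+1)%R.
  by apply: expr_bracket_le => //; rewrite ler_pdivlMr// mul1r.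
apply: (@le_trans _ _ (outer j y)).
  apply: le_term; first by rewrite mulr_gt0// exprn_gt0.
    by rewrite mulrC -ler_pdivlMr.
  by rewrite mulrC -ltr_pdivrMr.
apply: (le_trans (@nneseries_ge_term _ (outer^~ y) j _)) => [k|].
    exact: term_ge0.
by apply: leeDr; apply: nneseries_ge0 => k _ _; exact: term_ge0.
Qed.

End dyadic.
End kernel.

(** * Growth of the mass of balls *)

Section powR_inequalities.
Variable R : realType.
Implicit Types a b c r : R.

Lemma powR_le a b r : 0 <= r -> 0 <= a -> a <= b -> a `^ r <= b `^ r.
Proof.
by move=> r0 a0 ab; apply: ge0_ler_powR; rewrite ?nnegrE// (le_trans a0).
Qed.

Lemma powRK a r : r != 0 -> 0 <= a -> (a `^ r) `^ r^-1 = a.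
Proof. by move=> r0 a0; rewrite -powRrM mulfV// powRr1. Qed.

Lemma powRVK a r : r != 0 -> 0 <= a -> (a `^ r^-1) `^ r = a.
Proof. by move=> r0 a0; rewrite -powRrM mulVf// powRr1. Qed.

Lemma powR_root_le a b c r : 0 < r -> 0 <= a -> 0 <= b -> 0 <= c ->
  a `^ r^-1 <= c * b `^ r^-1 -> a <= c `^ r * b.
Proof.
move=> r0 a0 b0 c0 h; rewrite -[a](@powRVK a r) ?gt_eqF//.
rewrite -[b in leRHS](@powRVK b r) ?gt_eqF//.
rewrite -powRM ?powR_ge0//; apply: powR_le => //; first exact: ltW.
exact: powR_ge0.
Qed.

Lemma lee_poweR (x y : \bar R) r : 0 <= r -> (0 <= x)%E -> (x <= y)%E ->
  (x `^ r <= y `^ r)%E.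
Proof.
by move=> r0 x0 xy; apply: gt0_ler_poweR;
  rewrite ?in_itv/= ?leey ?andbT// (le_trans x0 xy).
Qed.

End powR_inequalities.

(** The weight condition tested on functions: in this form it serves p = 1, p > 1 and the dual
    weight alike. *)
Definition local_estimate (R : realType) (n : nat) (alpha p q K : R)
    (w : n.-tuple R -> R) : Prop :=
  forall (f : n.-tuple R -> R) a (r : R),
  measurable_fun setT f -> (forall x, 0 <= f x) -> 0 < r ->
  (wmeas (fun x => (w x `^ q)%R) (tball a r) `^ q^-1 *
    \int[@lebn R n]_(x in tball a r) (f x)%:E <=
  (K * r `^ (n%:R - alpha))%:E *
  (\int[@lebn R n]_(x in tball a r) (f x `^ p * w x `^ p)%:E) `^ p^-1)%E.

Section weight_growth.
Local Open Scope ereal_scope.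
Variables (R : realType) (n : nat) (alpha p q K : R) (w : n.-tuple R -> R).
Hypothesis n_gt0 : (0 < n)%N.
Hypothesis alpha_gt0 : (0 < alpha)%R.
Hypothesis p_ge1 : (1 <= p)%R.
Hypothesis q_gt0 : (0 < q)%R.
Hypothesis pqE : (q^-1 = p^-1 - alpha / n%:R)%R.
Hypothesis mw : measurable_fun setT w.
Hypothesis w_gt0 : forall x, (0 < w x)%R.
Hypothesis K_ge0 : (0 <= K)%R.

Let u x := (w x `^ q)%R.
Hypothesis u_fin : forall a r, wmeas u (tball a r) < +oo.

Hypothesis local_bound : local_estimate alpha p q K w.

Definition ball_mass a r : R := fine (wmeas (fun x => w x `^ q)%R (tball a r)).

Lemma measurable_wpow (s : R) : measurable_fun setT (fun x => w x `^ s)%R.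
Proof.
by apply: (@measurableT_comp _ _ _ _ _ _ (@powR R ^~ s)).
Qed.

Lemma wmeas_ge0 (s : R) E : 0 <= wmeas (fun x => w x `^ s)%R E.
Proof. by apply: integral_ge0 => x _; rewrite lee_fin powR_ge0. Qed.

Lemma wmeas_subset (s : R) A B : measurable A -> measurable B -> A `<=` B ->
  wmeas (fun x => w x `^ s)%R A <= wmeas (fun x => w x `^ s)%R B.
Proof.
move=> mA mB AB; apply: ge0_subset_integral => //.
  by apply: measurable_funTS; apply/measurable_EFinP; exact: measurable_wpow.
by move=> x _; rewrite lee_fin powR_ge0.
Qed.

Lemma lebn_tball_gt0 (a : n.-tuple R) r : (0 < r)%R ->
  0 < @lebn R n (tball a r).
Proof.
move=> r0; have /andP[h _] := tball_volume a r0.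
by apply: lt_le_trans h; rewrite lte_fin mulr_gt0// exprn_gt0// divr_gt0.
Qed.

Lemma ball_massE a r :
  (ball_mass a r)%:E = wmeas (fun x => w x `^ q)%R (tball a r).
Proof. by rewrite fineK// ge0_fin_numE ?wmeas_ge0//; exact: u_fin. Qed.

Lemma ball_mass_gt0 a r : (0 < r)%R -> (0 < ball_mass a r)%R.
Proof.
move=> r0; rewrite -lte_fin ball_massE; apply: integral_gt0.
- exact: measurable_tball.
- exact: measurable_wpow.
- by move=> x; rewrite powR_gt0.
- exact: lebn_tball_gt0.
Qed.

Lemma ball_mass_le a b r s : tball a r `<=` tball b s ->
  (ball_mass a r <= ball_mass b s)%R.
Proof.
by move=> h; rewrite -lee_fin !ball_massE; apply: wmeas_subset => //;
  exact: measurable_tball.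
Qed.

Let p_gt0 : (0 < p)%R. Proof. exact: lt_le_trans p_ge1. Qed.
Let n0 : (0 < n%:R :> R)%R. Proof. by rewrite ltr0n. Qed.

Let pq : (p < q)%R.
Proof.
rewrite -[p]invrK -[q]invrK ltf_pV2 ?posrE ?invr_gt0// pqE.
by rewrite ltrBlDr ltrDl divr_gt0.
Qed.

(** Hölder between w^p and 1 with exponents q / p and q / (q - p); the power left on the volume of
    [E] is 1/p - 1/q = alpha / n. *)
Let wp_le E : measurable E ->
  (\int[@lebn R n]_(x in E) (w x `^ p)%:E) `^ p^-1 <=
  (wmeas u E) `^ q^-1 * (@lebn R n E) `^ (alpha / n%:R).
Proof.
move=> mE; have qp0 : (0 < q - p)%R by rewrite subr_gt0.
have h : \int[@lebn R n]_(x in E) (w x `^ p)%:E <=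
    (wmeas u E) `^ (q / p)^-1 * (@lebn R n E) `^ (q / (q - p))^-1.
  have e1 : \int[@lebn R n]_(x in E) ((w x `^ p) `^ (q / p))%:E = wmeas u E.
    by apply: eq_integral => x _; rewrite -powRrM mulrC divfK ?gt_eqF.
  have e2 : \int[@lebn R n]_(x in E) (cst 1%R x `^ (q / (q - p)))%:E =
      @lebn R n E.
    under eq_integral do rewrite /= powR1.
    by rewrite (integral_cst _ mE) mul1e.
  have qp1 : (0 < q / p)%R by rewrite divr_gt0.
  have qp2 : (0 < q / (q - p))%R by rewrite divr_gt0.
  have qp3 : ((q / p)^-1 + (q / (q - p))^-1 = 1)%R by field; rewrite !gt_eqF.
  have mc : measurable_fun setT (cst 1%R : n.-tuple R -> R).
    exact: measurable_cst.
  have := hoelder_on (@lebn R n) mE (measurable_wpow p) mc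
    (fun x => powR_ge0 _ _) (fun=> ler01) qp1 qp2 qp3.
  by rewrite e1 e2; under eq_integral do rewrite mulr1.
have I0 : 0 <= \int[@lebn R n]_(x in E) (w x `^ p)%:E by exact: wmeas_ge0.
apply: (le_trans (lee_poweR _ I0 h)); first by rewrite invr_ge0 ltW.
rewrite poweRM ?poweR_ge0// -!poweRrM.
have -> : ((q / p)^-1 / p = q^-1)%R by field; rewrite !gt_eqF.
have -> : ((q / (q - p))^-1 / p = alpha / n%:R)%R.
  have -> : (alpha / n%:R = p^-1 - q^-1)%R by rewrite pqE; ring.
  by field; rewrite !gt_eqF.
by [].
Qed.

Lemma wmeas_wpow_fin a r : (0 < r)%R ->
  wmeas (fun x => w x `^ p)%R (tball a r) < +oo.
Proof.
move=> r0; apply: (@lty_poweRy _ _ p^-1); first by rewrite gt_eqF// invr_gt0.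
apply: (le_lt_trans (wp_le (measurable_tball a r))).
have /andP[_ h] := tball_volume a r0.
rewrite lte_mul_pinfty ?poweR_ge0//.
  by rewrite fin_num_poweR// ge0_fin_numE ?wmeas_ge0//; exact: u_fin.
by rewrite poweR_lty// (le_lt_trans h) ?ltry.
Qed.

(** The local estimate for the indicator of [E]; r^(n - alpha) and the power alpha / n of the volume
    combine to r^n. In other words u(E) / u(B) is at least a constant times (|E| / |B|)^q, as for
    A_infinity weights. *)
Lemma mass_comparison E a r : measurable E -> E `<=` tball a r -> (0 < r)%R ->
  @lebn R n E * (ball_mass a r `^ q^-1)%:E <=
  (K * 2 `^ alpha * r ^+ n)%:E * (wmeas u E) `^ q^-1.
Proof.
move=> mE EB r0; have mB := measurable_tball a r.
have mI : measurable_fun setT (\1_E : n.-tuple R -> R).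
  exact: measurable_indic.
have I0 x : (0 <= \1_E x :> R)%R by rewrite indicE.
have := local_bound a mI I0 r0.
have -> : \int[@lebn R n]_(x in tball a r) (\1_E x)%:E = @lebn R n E.
  by rewrite integral_indic// setIidl.
have -> : \int[@lebn R n]_(x in tball a r) (\1_E x `^ p * w x `^ p)%:E =
    \int[@lebn R n]_(x in E) (w x `^ p)%:E.
  rewrite [LHS]integral_mkcond [RHS]integral_mkcond; apply: eq_integral => x _.
  rewrite !patchE indicE; case: (boolP (x \in E)) => xE.
    rewrite ifT ?powR1 ?mul1r//; apply: mem_set; apply: EB; exact: set_mem.
  by rewrite powR0 ?gt_eqF// mul0r; case: ifP.
rewrite -ball_massE poweR_EFin muleC => /le_trans; apply.
apply: (@le_trans _ _ ((K * r `^ (n%:R - alpha))%:E * (wmeas u E `^ q^-1 *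
    ((2 ^+ n * r ^+ n)%:E) `^ (alpha / n%:R)))).
  rewrite lee_wpmul2l ?lee_fin ?mulr_ge0 ?powR_ge0//.
  apply: (le_trans (wp_le mE)); rewrite lee_wpmul2l ?poweR_ge0//.
  apply: lee_poweR; rewrite ?divr_ge0 ?(ltW alpha_gt0)// ?measure_ge0//.
  have /andP[_] := tball_volume a r0; apply: le_trans.
  by apply: le_measure; rewrite ?inE.
rewrite poweR_EFin muleCA muleC -EFinM; rewrite lee_wpmul2r ?poweR_ge0//.
rewrite lee_fin -exprMn powRXn ?mulr_ge0 ?(ltW r0)//.
rewrite -powR_mulrn ?powR_ge0// -powRrM divfK ?gt_eqF// powRM ?(ltW r0)//.
rewrite -(powR_mulrn n (ltW r0)) -[n%:R in leRHS](subrK alpha).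
rewrite [in leRHS]powRD; last by rewrite (gt_eqF r0) implybT.
by rewrite le_eqVlt; apply/predU1P; left; ring.
Qed.

Let lebn_fin E a r : measurable E -> E `<=` tball a r -> (0 < r)%R ->
  (fine (@lebn R n E))%:E = @lebn R n E.
Proof.
move=> mE EB r0; rewrite fineK// ge0_fin_numE//.
have /andP[_ h] := tball_volume a r0.
apply: le_lt_trans (ltry (2 ^+ n * r ^+ n)); apply: le_trans h.
by apply: le_measure; rewrite ?inE//; exact: measurable_tball.
Qed.

Let mass_comparison_fin E a r : measurable E -> E `<=` tball a r -> (0 < r)%R ->
  (fine (@lebn R n E) * ball_mass a r `^ q^-1 <=
   K * 2 `^ alpha * r ^+ n * fine (wmeas u E) `^ q^-1)%R.
Proof.
move=> mE EB r0; rewrite -lee_fin [X in X <= _]EFinM [X in _ <= X]EFinM.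
rewrite (lebn_fin mE EB r0); apply: (le_trans (mass_comparison mE EB r0)).
suff -> : (fine (wmeas u E) `^ q^-1)%:E = wmeas u E `^ q^-1 by [].
rewrite -poweR_EFin fineK// ge0_fin_numE ?wmeas_ge0//.
apply: le_lt_trans (u_fin a r); apply: wmeas_subset => //.
exact: measurable_tball.
Qed.

Let c := ((2 / n.+1%:R) ^+ n : R)%R.
Let c_gt0 : (0 < c)%R. Proof. by rewrite exprn_gt0// divr_gt0. Qed.
Let K2 := (K * 2 `^ alpha)%R.
Let K2_ge0 : (0 <= K2)%R. Proof. by rewrite mulr_ge0// powR_ge0. Qed.

Lemma ball_mass_doubling lam : (1 <= lam)%R -> exists2 D : R, (0 < D)%R &
  forall a r, (0 < r)%R -> (ball_mass a (lam * r) <= D * ball_mass a r)%R.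
Proof.
move=> lam1; have lam0 : (0 < lam)%R by exact: lt_le_trans lam1.
(* The first summand is [mass_comparison] with the smaller ball as [E], where [c] is the lower
   volume constant; the second makes the constant positive. *)
exists ((K2 * lam ^+ n / c) `^ q + 1)%R.
  by rewrite ltr_wpDl// powR_ge0.
move=> a r r0; have lr0 : (0 < lam * r)%R by rewrite mulr_gt0.
apply: (@le_trans _ _ ((K2 * lam ^+ n / c) `^ q * ball_mass a r)%R); last first.
  by rewrite ler_wpM2r ?(ltW (ball_mass_gt0 a r0))// lerDl.
apply: powR_root_le => //; rewrite ?(ltW (ball_mass_gt0 _ _))//.
  by rewrite divr_ge0 ?(ltW c_gt0)// mulr_ge0// exprn_ge0// ltW.
have sub : tball a r `<=` tball a (lam * r).
  by apply: tball_le; rewrite ler_peMl// ltW.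
have := mass_comparison_fin (measurable_tball a r) sub lr0.
have /andP[h _] := tball_volume a r0.
rewrite -(lebn_fin (measurable_tball a r) sub lr0) lee_fin -/c in h.
move=> /(le_trans (ler_wpM2r (powR_ge0 _ _) h)).
rewrite -/(ball_mass a r) -/K2 exprMn => h2.
rewrite -(@ler_pM2l _ (c * r ^+ n))%R; last by rewrite mulr_gt0// exprn_gt0.
apply: (le_trans h2); rewrite le_eqVlt; apply/predU1P; left.
by field; rewrite gt_eqF.
Qed.

(* Most of the Lebesgue measure of [B(a, L r)] lies outside [B(a, r)] when [L] is
   large, hence so does a fixed fraction of its mass. *)
Lemma ball_mass_reverse_doubling : exists L theta : R,
  [/\ (4 <= L)%R, (0 < theta < 1)%R & forall a r, (0 < r)%R ->
      (ball_mass a r <= theta * ball_mass a (L * r))%R].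
Proof.
(* Since n >= 1, this gives c L^n >= 2 * 2^n: by the volume bounds B(a, r) takes up at most half of
   the lower bound for the volume of B(a, L r). *)
pose L : R := (4 + 2 * 2 ^+ n / c)%R.
have L4 : (4 <= L)%R by rewrite lerDl divr_ge0 ?(ltW c_gt0)// mulr_ge0// exprn_ge0.
have L0 : (0 < L)%R by lra.
have Ln : (2 * 2 ^+ n <= c * L ^+ n)%R.
  apply: (@le_trans _ _ (c * L)%R).
    rewrite /L mulrDr [X in (_ <= _ + X)%R]mulrC divfK ?gt_eqF//.
    by rewrite lerDr mulr_ge0// ltW.
  rewrite ler_pM2l// -[X in (X <= _)%R]expr1; apply: ler_weXn2l => //; lra.
(* The fraction of the mass that [mass_comparison] guarantees to an annulus of volume at least c / 2
   * (L r)^n; K2 + 1 avoids dividing by zero. *)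
pose del : R := ((c / (2 * (K2 + 1))) `^ q)%R.
have K21 : (0 < K2 + 1)%R by rewrite ltr_wpDl.
have del0 : (0 < del)%R by rewrite powR_gt0// divr_gt0// mulr_gt0.
have main a r : (0 < r)%R ->
    (del * ball_mass a (L * r) <= ball_mass a (L * r) - ball_mass a r)%R.
  move=> r0; have Lr0 : (0 < L * r)%R by rewrite mulr_gt0.
  have sub : tball a r `<=` tball a (L * r).
    by apply: tball_le; rewrite ler_peMl ?(ltW r0)//; lra.
  pose E := tball a (L * r) `\` tball a r.
  have mB s := @measurable_tball R n a s.
  have mE : measurable E by exact: measurableD.
  have EB : E `<=` tball a (L * r) by move=> x [].
  have splitE (h : n.-tuple R -> R) : measurable_fun setT h ->
      (forall x, 0 <= h x)%R ->
      wmeas h (tball a (L * r)) = wmeas h (tball a r) + wmeas h E.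
    move=> mh h0; rewrite /wmeas (ge0_integral_split _ _ _ (mB _) (mB r)).
    - by rewrite setIidr.
    - exact/measurable_EFinP.
    - by move=> x; rewrite lee_fin.
  have uE : fine (wmeas u E) = (ball_mass a (L * r) - ball_mass a r)%R.
    apply/eqP; rewrite eq_sym subr_eq addrC -eqe EFinD !ball_massE fineK.
      by rewrite -splitE// => [|x]; [exact: measurable_wpow|exact: powR_ge0].
    rewrite ge0_fin_numE ?wmeas_ge0//; apply: le_lt_trans (u_fin a (L * r)).
    exact: wmeas_subset.
  have vE : (c / 2 * L ^+ n * r ^+ n <= fine (@lebn R n E))%R.
    have /andP[h1 _] := tball_volume a Lr0.
    have /andP[_ h2] := tball_volume a r0.
    have wmeas1 A : measurable A -> wmeas (cst 1%R) A = @lebn R n A.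
      by move=> mA; rewrite -[RHS]mul1e -(integral_cst _ mA).
    have := splitE (cst 1%R) (measurable_cst _) (fun=> ler01).
    rewrite !wmeas1// => h3.
    move: h1 h2; rewrite -/c h3 -(lebn_fin mE EB Lr0).
    rewrite -(lebn_fin (mB r) sub Lr0) -EFinD !lee_fin exprMn => h1 h2.
    have rn : (0 < r ^+ n)%R by rewrite exprn_gt0.
    have := ler_wpM2r (ltW rn) Ln; lra.
  have h := mass_comparison_fin mE EB Lr0.
  have uE0 : (0 <= fine (wmeas u E))%R by rewrite fine_ge0// wmeas_ge0.
  have rn : (0 < L ^+ n * r ^+ n)%R by rewrite mulr_gt0// exprn_gt0.
  pose X : R := (2 * (K2 + 1) / c)%R.
  have X0 : (0 <= X)%R by rewrite divr_ge0 ?(ltW c_gt0)// mulr_ge0// ltW.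
  have : (ball_mass a (L * r) <= X `^ q * fine (wmeas u E))%R.
    apply: powR_root_le => //; first exact/ltW/ball_mass_gt0.
    rewrite -(@ler_pM2l _ (c / 2 * (L ^+ n * r ^+ n)))%R; last first.
      by rewrite mulr_gt0// divr_gt0.
    have U0 : (0 <= ball_mass a (L * r) `^ q^-1)%R by exact: powR_ge0.
    move: (le_trans (ler_wpM2r U0 vE) h); rewrite -mulrA => /le_trans; apply.
    rewrite -/K2 exprMn /X.
    have -> : (c / 2 * (L ^+ n * r ^+ n) * (2 * (K2 + 1) / c *
        fine (wmeas u E) `^ q^-1) =
      (K2 + 1) * (L ^+ n * r ^+ n) * fine (wmeas u E) `^ q^-1)%R.
      by field; rewrite gt_eqF.
    rewrite ler_wpM2r ?powR_ge0// ler_wpM2r ?(ltW rn)//; lra.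
  move=> /(ler_wpM2l (ltW del0)); rewrite mulrA {2}/del -powRM//.
    have -> : (c / (2 * (K2 + 1)) * X = 1)%R.
      by rewrite /X; field; rewrite !gt_eqF.
    by rewrite powR1 mul1r uE.
  by rewrite divr_ge0 ?(ltW c_gt0)// mulr_ge0// ltW.
exists L, (1 - del)%R; split => // [|a r r0]; last first.
  by have := main a r r0; lra.
apply/andP; split; last by lra.
(* Positivity of 1 - del is read off one ball: multiplied by a positive mass it dominates another
   positive mass. *)
have U1 := ball_mass_gt0 [tuple of nseq n 0%R] (@ltr01 R).
have U2 := ball_mass_gt0 [tuple of nseq n 0%R] (_ : 0 < L * 1)%R.
have := main [tuple of nseq n 0%R] 1%R ltr01.
rewrite mulr1 in U2 *; move: (U2 L0).
set x := ball_mass _ L in U2 *; set y := ball_mass _ 1 in U1 *.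
by move=> x0 h; rewrite -(pmulr_lgt0 _ x0); lra.
Qed.

End weight_growth.

(** * Sums over dilated balls *)

Section riesz_potential.
Local Open Scope ereal_scope.
Variables (R : realType) (n : nat) (alpha : R).
Implicit Types f g : n.-tuple R -> R.

Lemma measurable_kernel2 : measurable_fun [set: n.-tuple R * n.-tuple R]
  (fun z => ((tdist z.1 z.2) `^ (n%:R - alpha))^-1)%R.
Proof.
under eq_fun do rewrite -powRN.
apply: (@measurableT_comp _ _ _ _ _ _ (@powR R ^~ (- (n%:R - alpha))%R)).
  exact: measurable_powR.
exact: measurable_tdist2.
Qed.

Lemma kernel_ge0 (x y : n.-tuple R) :
  (0 <= ((tdist x y) `^ (n%:R - alpha))^-1)%R.
Proof. by rewrite invr_ge0 powR_ge0. Qed.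

Lemma measurable_integrand f x : measurable_fun setT f ->
  measurable_fun setT (fun y => (f y * ((tdist x y) `^ (n%:R - alpha))^-1)%:E).
Proof.
move=> mf; apply/measurable_EFinP; apply: measurable_funM => //.
exact: measurable_riesz_kernel.
Qed.

(** For signed [f] the integral is the difference of those of the positive and negative parts, each
    measurable in x by Tonelli. *)
Lemma measurable_Ialpha f : measurable_fun setT f ->
  measurable_fun setT (Ialpha alpha f).
Proof.
move=> mf.
pose h (z : n.-tuple R * n.-tuple R) : \bar R :=
  (f z.2 * ((tdist z.1 z.2) `^ (n%:R - alpha))^-1)%:E.
have mh : measurable_fun setT h.
  apply/measurable_EFinP; apply: measurable_funM; last exact: measurable_kernel2.
  exact: measurableT_comp.
rewrite (_ : Ialpha alpha f = (fun x => fubini_F (@lebn R n) (h^\+) x -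
    fubini_F (@lebn R n) (h^\-) x)); last first.
  apply/funext => x; rewrite /Ialpha [LHS]integralE.
  by congr (_ - _); apply: eq_integral => y _; rewrite ?funeposE ?funenegE.
apply: emeasurable_funB.
- apply: measurable_fun_fubini_tonelli_F => //; exact: measurable_funepos.
- apply: measurable_fun_fubini_tonelli_F => //; exact: measurable_funeneg.
Qed.

Lemma Ialpha_ge0 f x : (forall y, 0 <= f y)%R -> 0 <= Ialpha alpha f x.
Proof.
by move=> f0; apply: integral_ge0 => y _; rewrite lee_fin mulr_ge0// kernel_ge0.
Qed.

Lemma abse_Ialpha f x : measurable_fun setT f ->
  `|Ialpha alpha f x| <= Ialpha alpha (fun y => `|f y|%R) x.
Proof.
move=> mf; apply: (le_trans (le_abse_integral _ _ _)) => //.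
  exact: measurable_integrand.
rewrite le_eqVlt; apply/predU1P; left; apply: eq_integral => y _.
by rewrite /= normrM [X in (_ * X)%R]ger0_norm// kernel_ge0.
Qed.

Lemma IalphaD f g x : measurable_fun setT f -> measurable_fun setT g ->
  (forall y, 0 <= f y)%R -> (forall y, 0 <= g y)%R ->
  Ialpha alpha (fun y => f y + g y)%R x = Ialpha alpha f x + Ialpha alpha g x.
Proof.
move=> mf mg f0 g0; rewrite /Ialpha -ge0_integralD//.
- by apply: eq_integral => y _; rewrite mulrDl EFinD.
- by move=> y _; rewrite lee_fin mulr_ge0// kernel_ge0.
- exact: measurable_integrand.
- by move=> y _; rewrite lee_fin mulr_ge0// kernel_ge0.
- exact: measurable_integrand.
Qed.

End riesz_potential.

Section lower_integral.
Local Open Scope ereal_scope.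
Import HBNNSimple.

(* The integral of a nonnegative function that is not measurable is a supremum
   over simple functions, so monotonicity needs no measurability. *)
Lemma ge0_le_integral_nonmeasurable d (T : measurableType d) (R : realType)
    (mu : {measure set T -> \bar R}) (E : set T) (f g : T -> \bar R) :
  (forall x, E x -> 0 <= f x) -> (forall x, E x -> f x <= g x) ->
  \int[mu]_(x in E) f x <= \int[mu]_(x in E) g x.
Proof.
move=> f0 fg; have g0 x : E x -> 0 <= g x.
  by move=> Ex; exact: le_trans (f0 _ Ex) (fg _ Ex).
rewrite !ge0_integralE//; apply: ge_ereal_sup => _ [h /= hf <-].
apply: ereal_sup_ubound; exists h => //= x; apply: (le_trans (hf x)).
by rewrite !patchE; case: ifPn => // /set_mem; exact: fg.
Qed.

End lower_integral.

Section morrey_sum.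
Local Open Scope ereal_scope.
Variables (R : realType) (n : nat) (alpha p q K L D : R) (w : n.-tuple R -> R).
Hypothesis alpha_lt : (alpha < n%:R)%R.
Hypothesis p_gt0 : (0 < p)%R.
Hypothesis q_gt0 : (0 < q)%R.
Hypothesis mw : measurable_fun setT w.
Hypothesis w_gt0 : forall x, (0 < w x)%R.
Hypothesis K_ge0 : (0 <= K)%R.
Hypothesis L_ge4 : (4 <= L)%R.
Hypothesis D_gt0 : (0 < D)%R.

Let u x := (w x `^ q)%R.
Hypothesis u_fin : forall a r, wmeas u (tball a r) < +oo.
Hypothesis local_bound : local_estimate alpha p q K w.
Hypothesis mass_doubling : forall a (r : R), (0 < r)%R ->
  (ball_mass q w a (L * r) <= D * ball_mass q w a r)%R.

Local Notation U := (ball_mass q w).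
Local Opaque ball_mass.

Variable f : n.-tuple R -> R.
Hypothesis mf : measurable_fun setT f.
Hypothesis f_ge0 : forall x, (0 <= f x)%R.

Definition ball_norm a r : \bar R :=
  (\int[@lebn R n]_(x in tball a r) (f x `^ p * w x `^ p)%:E) `^ p^-1.

(** A common majorant for both parts of the potential on B(a, r). It starts at radius L r, because
    the near part is [f] on B(a, L r) and the first term has to control it. *)
Definition morrey_sum a r : \bar R := \sum_(j <oo)
  ball_norm a (L ^+ j.+1 * r) *
  ((ball_mass q w a (L ^+ j.+1 * r) `^ q^-1)^-1)%:E.

Let L0 : (0 < L)%R. Proof. by apply: lt_le_trans L_ge4. Qed.
Let Lj j r : (0 < r)%R -> (0 < L ^+ j * r)%R.
Proof. by move=> r0; rewrite mulr_gt0// exprn_gt0. Qed.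

Let U_gt0 a r : (0 < r)%R -> (0 < U a r)%R.
Proof. exact: ball_mass_gt0. Qed.

Lemma ball_norm_ge0 a r : 0 <= ball_norm a r.
Proof. exact: poweR_ge0. Qed.

Lemma ball_norm_le a r s : (r <= s)%R -> ball_norm a r <= ball_norm a s.
Proof.
move=> rs; have p0 : (0 <= p^-1)%R by rewrite invr_ge0 ltW.
apply: lee_poweR => //.
  by apply: integral_ge0 => x _; rewrite lee_fin mulr_ge0 ?powR_ge0.
apply: ge0_subset_integral.
- exact: measurable_tball.
- exact: measurable_tball.
- apply: measurable_funTS; apply/measurable_EFinP; apply: measurable_funM.
    by apply: measurable_wpow.
  exact: measurable_wpow.
- by move=> x _; rewrite lee_fin mulr_ge0 ?powR_ge0.
- exact: tball_le.
Qed.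

Let term_ge0 a r s : 0 <= ball_norm a r * ((U a s `^ q^-1)^-1)%:E.
Proof. by rewrite mule_ge0 ?ball_norm_ge0// lee_fin invr_ge0 powR_ge0. Qed.

Lemma morrey_sum_ge0 a r : 0 <= morrey_sum a r.
Proof. by apply: nneseries_ge0 => j _ _; exact: term_ge0. Qed.

Lemma integral_ball_le a r : (0 < r)%R ->
  \int[@lebn R n]_(x in tball a r) (f x)%:E <=
  (K * r `^ (n%:R - alpha))%:E *
  (ball_norm a r * ((U a r `^ q^-1)^-1)%:E).
Proof.
move=> r0; rewrite muleA lee_pdivlMr ?powR_gt0 ?U_gt0// muleC.
have := local_bound a mf f_ge0 r0.
by rewrite -(ball_massE u_fin) poweR_EFin.
Qed.

(** L^2 / (L - 1) is the ratio of the radius L^(j + 2) r of the ball around a to the radius (L - 1)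
    L^j r at which the kernel is evaluated. *)
Let C1 := (K * (L ^+ 2 / (L - 1)) `^ (n%:R - alpha))%R.

Lemma Ialpha_tail a r x : (0 < r)%R -> tball a r x ->
  Ialpha alpha (fun y => f y * \1_(~` tball a (L * r)) y)%R x <=
  C1%:E * morrey_sum a r.
Proof.
move=> r0 xa; set f2 := fun y => _.
have mB s z := @measurable_tball R n z s.
have mf2 : measurable_fun setT f2.
  by apply: measurable_funM => //; apply: measurable_indic; exact: measurableC.
have f20 y : (0 <= f2 y)%R by rewrite mulr_ge0.
have L1 : (1 < L)%R by apply: lt_le_trans L_ge4; rewrite ltr1n.
have L10 : (0 < L - 1)%R by rewrite subr_gt0.
(* For x in B(a, r) every point outside B(a, L r) is at distance at least (L - 1) r from x, so with
   this radius the inner sum vanishes. *)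
have rho0 : (0 < (L - 1) * r)%R by rewrite mulr_gt0.
apply: (le_trans (Ialpha_dyadic alpha_lt mf2 f20 x L1 rho0)).
rewrite [X in X + _]eseries0 ?add0e; last first.
  move=> j _ _; rewrite integral0_eq ?mule0// => y yx.
  rewrite /f2 indicE memNset ?mulr0//= => /(_ _); apply.
  have := tdist_triangle a x y; move: xa yx; rewrite /tball/=.
  have : ((L - 1) * r / L ^+ j <= (L - 1) * r)%R.
    rewrite ler_pdivrMr ?exprn_gt0// ler_peMr ?(ltW rho0)//.
    by rewrite exprn_ege1// ltW.
  lra.
apply: (@le_trans _ _ (\sum_(j <oo) C1%:E * (ball_norm a (L ^+ j.+2 * r) *
    ((U a (L ^+ j.+2 * r) `^ q^-1)^-1)%:E))).
  apply: lee_nneseries => j _.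
    by rewrite mule_ge0 ?lee_fin ?powR_ge0// integral_ge0// => y _; rewrite lee_fin.
  apply: (@le_trans _ _ ((((L - 1) * r * L ^+ j) `^ (- (n%:R - alpha)))%:E *
      \int[@lebn R n]_(y in tball a (L ^+ j.+2 * r)) (f y)%:E)).
    rewrite lee_wpmul2l ?lee_fin ?powR_ge0//.
    apply: (@le_trans _ _ (\int[@lebn R n]_(y in tball a (L ^+ j.+2 * r))
        (f2 y)%:E)).
      apply: ge0_subset_integral => //.
      - by apply: measurable_funTS; exact/measurable_EFinP.
      - by move=> y _; rewrite lee_fin.
      - apply: tball_subset; rewrite tdistC.
        have : (1 <= L ^+ j.+1)%R by rewrite exprn_ege1// ltW.
        move: xa; rewrite /tball/= => xa Lj1.
        have -> : (L ^+ j.+2 * r = (L - 1) * r * L ^+ j.+1 + L ^+ j.+1 * r)%R.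
          by rewrite exprS; ring.
        have : (1 * r <= L ^+ j.+1 * r)%R by rewrite ler_wpM2r// ltW.
        by rewrite mul1r; lra.
    apply: ge0_le_integral => //.
    - by move=> y _; rewrite lee_fin.
    - by apply: measurable_funTS; exact/measurable_EFinP.
    - by apply: measurable_funTS; exact/measurable_EFinP.
    - by move=> y _; rewrite lee_fin /f2 ler_piMr// indicE; case: (_ \in _).
  apply: (@le_trans _ _ ((((L - 1) * r * L ^+ j) `^ (- (n%:R - alpha)))%:E *
      ((K * (L ^+ j.+2 * r) `^ (n%:R - alpha))%:E *
    (ball_norm a (L ^+ j.+2 * r) * ((U a (L ^+ j.+2 * r) `^ q^-1)^-1)%:E)))).
    by rewrite lee_wpmul2l ?lee_fin ?powR_ge0// integral_ball_le// Lj.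
  rewrite muleA -EFinM lee_wpmul2r// lee_fin powRN mulrCA /C1.
  rewrite ler_wpM2l// ler_pdivrMl ?powR_gt0 ?mulr_gt0 ?exprn_gt0//.
  rewrite -powRM ?mulr_ge0 ?invr_ge0 ?exprn_ge0 ?(ltW L10) ?(ltW r0) ?(ltW L0)//.
  rewrite le_eqVlt; apply/predU1P; left; congr (_ `^ _)%R.
  by rewrite !exprS; field; rewrite gt_eqF.
rewrite nneseriesZl; last by move=> j _; exact: term_ge0.
have C10 : (0 <= C1)%R by rewrite mulr_ge0// powR_ge0.
apply: lee_wpmul2l; first by rewrite lee_fin.
(* The sum obtained starts at radius L^2 r: it is [morrey_sum] without its first term. *)
apply: nneseries_le_bound => [j|N]; first exact: term_ge0.
apply: le_trans (nneseries_lim_ge N.+1 _) => [|j _ _]; last exact: term_ge0.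
by rewrite big_nat_recl//= leeDr// term_ge0.
Qed.

Local Opaque ball_norm.

Section hypothesis_integral.
Variables (a : n.-tuple R) (r M : R) (psi : R -> R).
Hypothesis r0 : (0 < r)%R.
Hypothesis M0 : (0 <= M)%R.
Hypothesis psi0 : forall t, (0 < t)%R -> (0 <= psi t)%R.
(** The bound supplied by the Morrey norm, of which [M] will be the value, on the balls centred at
    [a]. *)
Hypothesis ball_norm_psi : forall t, (0 < t)%R ->
  ball_norm a t <=
  (M * psi t)%:E * wmeas (fun x => w x `^ p)%R (tball a t) `^ p^-1.

Let G t := wmeas (fun x => w x `^ p)%R (tball a t) `^ p^-1 *
  (wmeas u (tball a t) `^ q^-1)^-1 * (psi t / t)%:E.

Let rad j := (L ^+ j * r)%R.
Let rad_gt0 j : (0 < rad j)%R. Proof. exact: Lj. Qed.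
Let radS j : rad j.+1 = (L * rad j)%R. Proof. by rewrite /rad exprS mulrA. Qed.
Let L1 : (1 < L)%R. Proof. by apply: lt_le_trans L_ge4; rewrite ltr1n. Qed.
Let rad_le i j : (i <= j)%N -> (rad i <= rad j)%R.
Proof. by move=> ij; rewrite ler_wpM2r ?(ltW r0)// ler_weXn2l// ltW. Qed.

(** A lower bound for the integrand between two consecutive radii: the increasing norm is taken at
    the left end, the decreasing factors at the right end. *)
Let b j := (M^-1 * ((U a (rad j.+2) `^ q^-1)^-1 / rad j.+2))%:E *
  ball_norm a (rad j.+1).

Let b_ge0 j : 0 <= b j.
Proof.
by rewrite mule_ge0 ?ball_norm_ge0// lee_fin !mulr_ge0// invr_ge0 ?powR_ge0// ltW.
Qed.

Let b_le j t : (0 < M)%R -> (rad j.+1 < t)%R -> (t < rad j.+2)%R -> b j <= G t.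
Proof.
move=> Mp t1 t2; have t0 : (0 < t)%R by exact: lt_trans t1.
have UtE : (wmeas u (tball a t) `^ q^-1)^-1 = ((U a t `^ q^-1)^-1)%:E.
  by rewrite -(ball_massE u_fin) poweR_EFin inver gt_eqF ?powR_gt0 ?U_gt0.
have step1 : (M^-1)%:E * ball_norm a (rad j.+1) <=
    (psi t)%:E * wmeas (fun x => w x `^ p)%R (tball a t) `^ p^-1.
  rewrite lee_pdivrMl// muleA -EFinM.
  by apply: le_trans (ball_norm_psi t0); apply: ball_norm_le; exact: ltW.
have step2 : ((U a (rad j.+2) `^ q^-1)^-1 / rad j.+2 <=
    (U a t `^ q^-1)^-1 / t)%R.
  have U1 := U_gt0 a t0; have U2 := U_gt0 a (rad_gt0 j.+2).
  have U12 : (U a t <= U a (rad j.+2))%R.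
    by apply: ball_mass_le => //; apply: tball_le; exact: ltW.
  have q0 : (0 <= q^-1)%R by rewrite invr_ge0 ltW.
  have P1 : (0 < U a t `^ q^-1)%R by exact: powR_gt0.
  have P2 : (0 < U a (rad j.+2) `^ q^-1)%R by exact: powR_gt0.
  have P12 : (U a t `^ q^-1 <= U a (rad j.+2) `^ q^-1)%R.
    by apply: powR_le => //; exact: ltW.
  apply: ler_pM.
  - by rewrite invr_ge0 powR_ge0.
  - by rewrite invr_ge0; exact: ltW.
  - by rewrite lef_pV2;
      [exact: P12|rewrite posrE; exact: P2|rewrite posrE; exact: P1].
  - by rewrite lef_pV2 ?posrE//; exact: ltW.
rewrite /b mulrC EFinM -muleA /G UtE.
apply: (@le_trans _ _ (((U a t `^ q^-1)^-1 / t)%:E * ((psi t)%:E *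
    wmeas (fun x => w x `^ p)%R (tball a t) `^ p^-1))).
  apply: lee_pmul => //.
    by rewrite lee_fin divr_ge0 ?invr_ge0 ?powR_ge0// ltW.
  by rewrite mule_ge0 ?lee_fin ?invr_ge0// ball_norm_ge0.
rewrite muleA -EFinM muleC -muleA -EFinM le_eqVlt; apply/predU1P; left.
by congr (_ * _%:E); ring.
Qed.

Let mI j : measurable (`]rad j.+1, rad j.+2[%classic : set R).
Proof. exact: measurable_itv. Qed.

(** The open intervals are disjoint, so at most one summand is nonzero at t. *)
Let step_sum_le N t : (0 < M)%R -> (r < t)%R ->
  \sum_(0 <= j < N) b j * (\1_(`]rad j.+1, rad j.+2[%classic : set R) t)%:E <= G t.
Proof.
move=> Mp rt; have t0 : (0 < t)%R by exact: lt_trans rt.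
have G0 : 0 <= G t.
  rewrite !mule_ge0 ?poweR_ge0 ?inve_ge0 ?poweR_ge0// lee_fin divr_ge0 ?psi0//.
  exact: ltW.
elim: N => [|N IH]; first by rewrite big_geq.
rewrite big_nat_recr//= indicE.
have [tN|tN] := boolP (t \in _); last by rewrite mule0 adde0.
rewrite mule1 big1_seq ?add0e.
  by move: tN; rewrite inE/= in_itv/= => /andP[t1 t2]; exact: b_le.
move=> j /=; rewrite mem_index_iota => /andP[_ jN].
rewrite indicE memNset ?mule0//= in_itv/= => /andP[_ tj].
move: tN; rewrite inE/= in_itv/= => /andP[t1 _].
have := rad_le (_ : j.+2 <= N.+1)%N; rewrite ltnS => /(_ jN) h.
by have := lt_trans t1 tj; rewrite ltNge h.
Qed.

(** L / (L - 1) compensates the relative length of an interval of radii, and the power of [D]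
    compares the masses at its two ends. *)
Let C2 := (L / (L - 1) * D `^ q^-1)%R.

Let coefficient_le j : ((U a (rad j.+1) `^ q^-1)^-1 <=
  C2 * ((U a (rad j.+2) `^ q^-1)^-1 / rad j.+2 * (rad j.+2 - rad j.+1)))%R.
Proof.
have rj := rad_gt0 j.+1.
have -> : (C2 * ((U a (rad j.+2) `^ q^-1)^-1 / rad j.+2 *
    (rad j.+2 - rad j.+1)) = D `^ q^-1 / U a (rad j.+2) `^ q^-1)%R.
  rewrite /C2 [rad j.+2]radS; set y := (U a _ `^ q^-1)%R.
  have y0 : y != 0%R by rewrite gt_eqF// powR_gt0// U_gt0// mulr_gt0.
  by field; rewrite y0 subr_eq0 !gt_eqF.
have U1 := U_gt0 a (rad_gt0 j.+1); have U2 := U_gt0 a (rad_gt0 j.+2).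
rewrite ler_pdivlMr ?powR_gt0// ler_pdivrMl ?powR_gt0//.
rewrite -powRM ?(ltW U1) ?(ltW D_gt0)//; apply: powR_le.
- by rewrite invr_ge0 ltW.
- exact: ltW.
- rewrite [leRHS]mulrC [rad j.+2]radS; exact: mass_doubling.
Qed.

Lemma morrey_sum_le (X : R) :
  \int[@lebesgue_measure R]_(t in [set t : R | (r < t)%R])
    (wmeas (fun x => w x `^ p)%R (tball a t) `^ p^-1 *
     (wmeas u (tball a t) `^ q^-1)^-1 * (psi t / t)%:E) <= X%:E ->
  morrey_sum a r <= (C2 * M * X)%:E.
Proof.
move=> integral_psi.
have C20 : (0 <= C2)%R.
  by rewrite mulr_ge0 ?powR_ge0// divr_ge0 ?subr_ge0 ?(ltW L1)// ltW.
(* The step functions carry the factor 1 / M; for M = 0 all ball norms vanish instead. *)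
have [M_eq0|Mn0] := eqVneq M 0%R.
  rewrite M_eq0 mulr0 mul0r /morrey_sum eseries0// => j _ _.
  have := ball_norm_psi (rad_gt0 j.+1); rewrite M_eq0 mul0r mul0e => h.
  have -> : ball_norm a (rad j.+1) = 0.
    by apply/eqP; rewrite eq_le h ball_norm_ge0.
  by rewrite mul0e.
have Mp : (0 < M)%R by rewrite lt_neqAle eq_sym Mn0.
apply: nneseries_le_bound => [j|N]; first exact: term_ge0.
have mstep j : measurable_fun [set t : R | (r < t)%R]
    (fun t : R => b j * (\1_(`]rad j.+1, rad j.+2[%classic : set R) t)%:E).
  apply: measurable_funeM; apply/measurable_EFinP.
  exact: measurable_indic.
have mr : measurable [set t : R | (r < t)%R].
  rewrite (_ : mkset _ = `]r, +oo[%classic); first exact: measurable_itv.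
  by apply/seteqP; split => t /=; rewrite in_itv/= andbT.
have intb : \sum_(0 <= j < N) b j * (rad j.+2 - rad j.+1)%:E <= X%:E.
  apply: le_trans integral_psi.
  apply: (@le_trans _ _ (\int[@lebesgue_measure R]_(t in [set t : R | (r < t)%R])
    \sum_(0 <= j < N) b j * (\1_(`]rad j.+1, rad j.+2[%classic : set R) t)%:E)).
    rewrite ge0_integral_sum//; last by move=> j t _; rewrite mule_ge0// lee_fin.
    apply: lee_sum => j _.
    rewrite ge0_integralZl//; last first.
    - by apply/measurable_EFinP; exact: measurable_indic.
    rewrite integral_indic// setIidl; last first.
      move=> t /=; rewrite in_itv/= => /andP[+ _]; apply: le_lt_trans.
      by have := rad_le (leq0n j.+1); rewrite /rad expr0 mul1r.
    have <- : lebesgue_measure (`]rad j.+1, rad j.+2[%classic : set R) =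
        (rad j.+2 - rad j.+1)%:E.
      by rewrite lebesgue_measure_itv/= lte_fin [rad j.+2]radS ltr_pMl// L1 -EFinB.
    exact: lexx.
  (* As [psi] is an arbitrary nonnegative function, the comparison is one of lower integrals. *)
  apply: ge0_le_integral_nonmeasurable => t /= rt.
    by apply: sume_ge0 => j _; rewrite mule_ge0// lee_fin.
  exact: step_sum_le.
have := lee_wpmul2l (_ : 0 <= (C2 * M)%:E) intb.
rewrite lee_fin mulr_ge0// => /(_ erefl); rewrite -EFinM; apply: le_trans.
rewrite ge0_sume_distrr; last first.
  move=> j _; rewrite mule_ge0// lee_fin subr_ge0.
  exact: rad_le.
apply: lee_sum => j _; rewrite muleC -/(rad j.+1) /b.
rewrite [X in _ <= _ * X]muleC !muleA -!EFinM.
rewrite lee_wpmul2r ?ball_norm_ge0// lee_fin.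
apply: (le_trans (coefficient_le j)); rewrite le_eqVlt; apply/predU1P; left.
by field; rewrite !gt_eqF// ?powR_gt0 ?U_gt0.
Qed.

End hypothesis_integral.

End morrey_sum.

(** * From local estimates to Morrey spaces *)

Section quotient.
Local Open Scope ereal_scope.
Variable R : realType.
Implicit Types (psi c M : R) (N : \bar R).

(** At psi = 0 the convention 1/0 = +oo makes a finite quotient force N = 0, and conversely +oo * 0
    = 0 in the next lemma. *)
Lemma le_of_morrey_quotient psi c M N : (0 <= psi)%R -> (0 < c)%R -> 0 <= N ->
  (psi%:E)^-1 * (c%:E)^-1 * N <= M%:E -> N <= (M * psi * c)%:E.
Proof.
move=> psi0 c0 N0; rewrite !inver (gt_eqF c0).
have [->|psin0] := eqVneq psi 0%R.
  rewrite gt0_mulye ?lte_fin ?invr_gt0// mulr0 mul0r.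
  have [->//|Nn0] := eqVneq N 0.
  by rewrite gt0_mulye ?lt0e ?Nn0// leye_eq.
have psip : (0 < psi)%R by rewrite lt_neqAle eq_sym psin0.
rewrite -EFinM -invfM muleC lee_pdivrMr ?mulr_gt0// -EFinM.
by rewrite mulrA.
Qed.

Lemma morrey_quotient_le psi c M N : (0 <= psi)%R -> (0 < c)%R -> 0 <= N ->
  (0 <= M)%R -> N <= (M * psi * c)%:E -> (psi%:E)^-1 * (c%:E)^-1 * N <= M%:E.
Proof.
move=> psi0 c0 N0 M0; rewrite !inver (gt_eqF c0).
have [->|psin0] := eqVneq psi 0%R.
  rewrite mulr0 mul0r => N_le0; have -> : N = 0 by apply/eqP; rewrite eq_le N_le0.
  by rewrite mule0.
have psip : (0 < psi)%R by rewrite lt_neqAle eq_sym psin0.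
by rewrite -EFinM -invfM muleC lee_pdivrMr ?mulr_gt0// -EFinM mulrA.
Qed.

Lemma poweR_addr_le (x y : \bar R) (s : R) : (0 < s)%R -> 0 <= x -> 0 <= y ->
  (x + y) `^ s <= (2 `^ s)%:E * (x `^ s + y `^ s).
Proof.
move=> s0; wlog xy : x y / x <= y => [H x0 y0|x0 y0].
  have [xy|yx] := leP x y; first exact: H.
  by rewrite addeC [x `^ s + _]addeC; apply: H => //; exact: ltW.
apply: (@le_trans _ _ ((2%:E * y) `^ s)).
  apply: lee_poweR; [exact: ltW|exact: adde_ge0|].
  by rewrite -[2%R]/(1 + 1)%R EFinD ge0_muleDl ?lee_fin// mul1e leeD2r.
rewrite poweRM ?lee_fin// poweR_EFin lee_wpmul2l ?lee_fin ?powR_ge0//.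
by rewrite leeDr// poweR_ge0.
Qed.

End quotient.

(* The summand [1] makes the constants positive, so that the bounds are trivial
   when a norm is infinite. *)
Definition strong_const (R : realType) (q D C1 C3 : R) : R :=
  2 * (C3 `^ q * D + C1 `^ q) `^ q^-1 + 1.

Definition weak_const (R : realType) (q D C1 C3 : R) : R :=
  2 * C3 * D `^ q^-1 + 2 * C1 + 1.

Definition near_part (R : realType) (n : nat) (L : R) (f : n.-tuple R -> R)
    (a : n.-tuple R) (r : R) (y : n.-tuple R) : R :=
  f y * \1_(tball a (L * r)) y.

Definition zygmund_condition (R : realType) (n : nat) (p q : R)
    (w : n.-tuple R -> R) (psi1 psi2 : n.-tuple R -> R -> R) (C : R) : Prop :=
  forall a r, 0 < r ->
  (\int[@lebesgue_measure R]_(t in [set t : R | (r < t)%R])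
    (wmeas (fun x => (w x `^ p)%R) (tball a t) `^ p^-1 *
     (wmeas (fun x => (w x `^ q)%R) (tball a t) `^ q^-1)^-1 *
     (psi1 a t / t)%R%:E) <= (C * psi2 a r)%:E)%E.

Definition strong_estimate (R : realType) (n : nat) (alpha p q C3 : R)
    (w : n.-tuple R -> R) : Prop :=
  forall g : n.-tuple R -> R, measurable_fun setT g -> (forall x, 0 <= g x) ->
  (\int[@lebn R n]_x (Ialpha alpha g x `^ q * (w x `^ q)%:E) <=
    (C3 `^ q)%:E *
    ((\int[@lebn R n]_x (g x `^ p * w x `^ p)%:E) `^ p^-1) `^ q)%E.

(** Cutting the level set by a ball makes its mass finite, so that a power of it can be cancelled in
    the proof. *)
Definition weak_estimate (R : realType) (n : nat) (alpha p q C3 : R)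
    (w : n.-tuple R -> R) : Prop :=
  forall (g : n.-tuple R -> R) a r (lam : R),
  measurable_fun setT g -> (forall x, 0 <= g x) -> 0 < lam ->
  (lam%:E * wmeas (fun x => (w x `^ q)%R)
      (tball a r `&` [set x | lam%:E < Ialpha alpha g x]) `^ q^-1
    <= C3%:E * (\int[@lebn R n]_x (g x `^ p * w x `^ p)%:E) `^ p^-1)%E.

Section morrey_transfer.
Local Open Scope ereal_scope.
Variables (R : realType) (n : nat) (alpha p q K L D C3 : R) (w : n.-tuple R -> R).
Hypothesis alpha_lt : (alpha < n%:R)%R.
Hypothesis p_gt0 : (0 < p)%R.
Hypothesis q_gt0 : (0 < q)%R.
Hypothesis mw : measurable_fun setT w.
Hypothesis w_gt0 : forall x, (0 < w x)%R.
Hypothesis K_ge0 : (0 <= K)%R.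
Hypothesis L_ge4 : (4 <= L)%R.
Hypothesis D_gt0 : (0 < D)%R.
Hypothesis C3_ge0 : (0 <= C3)%R.

Let u x := (w x `^ q)%R.
Hypothesis u_fin : forall a r, wmeas u (tball a r) < +oo.
Hypothesis local_bound : local_estimate alpha p q K w.
Hypothesis mass_doubling : forall a (r : R), (0 < r)%R ->
  (ball_mass q w a (L * r) <= D * ball_mass q w a r)%R.

Local Notation U := (ball_mass q w).

Section fixed_function.
Variable f : n.-tuple R -> R.
Hypothesis mf : measurable_fun setT f.

Variables (af : n.-tuple R -> R) (C1 : R).
Hypothesis afE : af = fun x => `|f x|%R.
Hypothesis C1E : C1 = (K * (L ^+ 2 / (L - 1)) `^ (n%:R - alpha))%R.

Lemma measurable_af : measurable_fun setT af.
Proof. by rewrite afE; exact: measurableT_comp. Qed.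

Lemma af_ge0 x : (0 <= af x)%R. Proof. by rewrite afE normr_ge0. Qed.

Local Notation S a r := (morrey_sum p q L w af a r).

Lemma C1_ge0 : (0 <= C1)%R. Proof. by rewrite C1E mulr_ge0// powR_ge0. Qed.
Lemma L_gt0 : (0 < L)%R. Proof. by apply: lt_le_trans L_ge4. Qed.

Local Notation near a r := (near_part L af a r).

Lemma measurable_near a r : measurable_fun setT (near a r).
Proof.
apply: measurable_funM; first exact: measurable_af.
by apply: measurable_indic; exact: measurable_tball.
Qed.

Lemma near_ge0 a r y : (0 <= near a r y)%R.
Proof. by rewrite mulr_ge0 ?af_ge0. Qed.

Lemma Ialpha_near_tail a r x : (0 < r)%R -> tball a r x ->
  `|Ialpha alpha f x| <= Ialpha alpha (near a r) x + C1%:E * S a r.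
Proof.
move=> r0 xa; apply: (le_trans (abse_Ialpha _ _ mf)).
pose far y := (af y * \1_(~` tball a (L * r)) y)%R.
have mtail : measurable_fun setT far.
  apply: measurable_funM; first exact: measurable_af.
  by apply: measurable_indic; apply: measurableC; exact: measurable_tball.
have far0 y : (0 <= far y)%R by rewrite mulr_ge0 ?af_ge0.
have -> : Ialpha alpha (fun y => `|f y|%R) x =
    Ialpha alpha (near a r) x + Ialpha alpha far x.
  rewrite -(IalphaD _ _ (measurable_near a r) mtail (near_ge0 a r) far0).
  suff -> : (fun y => `|f y|%R) = (fun y => near a r y + far y)%R by [].
  apply/funext => y; rewrite /near_part /far -mulrDr afE.
  by rewrite !indicE in_setC; case: (_ \in _); rewrite /= ?addr0 ?add0r mulr1.
apply: leeD2l; rewrite C1E.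
exact: (Ialpha_tail alpha_lt mw w_gt0 K_ge0 L_ge4 u_fin local_bound
  measurable_af af_ge0 r0 xa).
Qed.

Lemma near_norm a r :
  (\int[@lebn R n]_x (near a r x `^ p * w x `^ p)%:E) `^ p^-1 =
  ball_norm p w af a (L * r).
Proof.
suff -> : \int[@lebn R n]_x (near a r x `^ p * w x `^ p)%:E =
    \int[@lebn R n]_(x in tball a (L * r)) (af x `^ p * w x `^ p)%:E by [].
rewrite [RHS]integral_mkcond; apply: eq_integral => x _.
rewrite patchE /near_part indicE; case: (_ \in _); first by rewrite mulr1.
by rewrite mulr0 powR0 ?mul0r// gt_eqF.
Qed.

Local Opaque near_part ball_norm ball_mass.

Lemma U_gt0 a r : (0 < r)%R -> (0 < U a r)%R.
Proof. exact: (ball_mass_gt0 mw w_gt0 u_fin). Qed.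

(** The first term of the sum alone, its mass at radius L r being moved to r by doubling. *)
Lemma ball_norm_le_sum a r : (0 < r)%R ->
  ball_norm p w af a (L * r) <= (D `^ q^-1 * U a r `^ q^-1)%:E * S a r.
Proof.
move=> r0; have Lr0 : (0 < L * r)%R by apply: mulr_gt0 => //; exact: L_gt0.
have : ball_norm p w af a (L ^+ 1 * r) *
    ((U a (L ^+ 1 * r) `^ q^-1)^-1)%:E <= S a r.
  apply: (@nneseries_ge_term _ (fun j => ball_norm p w af a (L ^+ j.+1 * r) *
    ((U a (L ^+ j.+1 * r) `^ q^-1)^-1)%:E) 0%N) => k.
  apply: mule_ge0; first exact: ball_norm_ge0.
  by rewrite lee_fin invr_ge0; exact: powR_ge0.
rewrite expr1 lee_pdivrMr; last by apply: powR_gt0; exact: U_gt0.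
move=> /le_trans; apply; rewrite muleC; apply: lee_wpmul2r.
  exact: morrey_sum_ge0.
rewrite lee_fin -powRM; [|exact: ltW|by apply: ltW; exact: U_gt0].
apply: powR_le; first by rewrite invr_ge0; exact: ltW.
  by apply: ltW; exact: U_gt0.
exact: mass_doubling.
Qed.

Lemma u_ge0 x : (0 <= u x)%R. Proof. exact: powR_ge0. Qed.
Lemma measurable_u : measurable_fun setT (fun x => (u x)%:E).
Proof. by apply/measurable_EFinP; exact: measurable_wpow. Qed.

Lemma ball_strong_bound a r :
  strong_estimate alpha p q C3 w ->
  (0 < r)%R ->
  Defs.Lnorm q u (tball a r) (Ialpha alpha f) <=
  (strong_const q D C1 C3 * U a r `^ q^-1)%:E * S a r.
Proof.
move=> strong r0; have mB := @measurable_tball R n a r.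
have C10 := C1_ge0.
have cst0 : (0 <= C3 `^ q * D + C1 `^ q)%R.
  apply: addr_ge0; last exact: powR_ge0.
  by apply: mulr_ge0; [exact: powR_ge0|exact: ltW].
have sc0 : (0 < strong_const q D C1 C3)%R.
  apply: ltr_wpDl; last exact: ltr01.
  by apply: mulr_ge0; [exact: ler0n|exact: powR_ge0].
have U0 := U_gt0 a r0.
have S0 : 0 <= S a r by exact: morrey_sum_ge0.
have CS0 : 0 <= C1%:E * S a r by apply: mule_ge0; rewrite ?lee_fin.
(* On the ball the tail is at most a constant, which contributes only its q-th power times the mass
   of the ball. *)
have main : \int[@lebn R n]_(x in tball a r)
     (`|Ialpha alpha f x| `^ q * (u x)%:E) <=
   (2 `^ q)%:E * ((C3 `^ q)%:E * ball_norm p w af a (L * r) `^ q +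
      (C1%:E * S a r) `^ q * (U a r)%:E).
  have mI : measurable_fun setT (Ialpha alpha (near a r)).
    by apply: measurable_Ialpha; exact: measurable_near.
  have I0 x : 0 <= Ialpha alpha (near a r) x.
    by apply: Ialpha_ge0; exact: near_ge0.
  have Iq0 x : 0 <= Ialpha alpha (near a r) x `^ q * (u x)%:E.
    by apply: mule_ge0; [exact: poweR_ge0|rewrite lee_fin; exact: u_ge0].
  have mIq : measurable_fun setT
      (fun x => Ialpha alpha (near a r) x `^ q * (u x)%:E).
    apply: emeasurable_funM; last exact: measurable_u.
    exact: (measurableT_comp (measurable_poweR q)).
  have mTq : measurable_fun setT (fun x => (C1%:E * S a r) `^ q * (u x)%:E).
    by apply: measurable_funeM; exact: measurable_u.
  have Tq0 x : 0 <= (C1%:E * S a r) `^ q * (u x)%:E.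
    by apply: mule_ge0; [exact: poweR_ge0|rewrite lee_fin; exact: u_ge0].
  have q20 : 0 <= (2 `^ q)%:E by rewrite lee_fin; exact: powR_ge0.
  apply: (@le_trans _ _ (\int[@lebn R n]_(x in tball a r)
    ((2 `^ q)%:E * (Ialpha alpha (near a r) x `^ q * (u x)%:E +
     (C1%:E * S a r) `^ q * (u x)%:E)))).
    apply: ge0_le_integral.
    - exact: mB.
    - move=> x _; apply: mule_ge0; first exact: poweR_ge0.
      by rewrite lee_fin; exact: u_ge0.
    - apply: measurable_funTS; apply: emeasurable_funM; last exact: measurable_u.
      apply: (measurableT_comp (measurable_poweR q)).
      apply: (measurableT_comp (@abse_measurable R setT)).
      exact: measurable_Ialpha.
    - apply: measurable_funTS; apply: measurable_funeM.
      by apply: emeasurable_funD; [exact: mIq|exact: mTq].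
    - move=> x xB; rewrite -ge0_muleDl ?poweR_ge0// muleA.
      apply: lee_wpmul2r; first by rewrite lee_fin; exact: u_ge0.
      apply: le_trans (poweR_addr_le q_gt0 (I0 x) CS0).
      apply: lee_poweR; [exact: ltW|exact: abse_ge0|].
      exact: Ialpha_near_tail.
  rewrite ge0_integralZl; last 4 first.
  - exact: mB.
  - by apply: measurable_funTS; apply: emeasurable_funD; [exact: mIq|exact: mTq].
  - by move=> x _; apply: adde_ge0; [exact: Iq0|exact: Tq0].
  - exact: q20.
  apply: lee_wpmul2l; first exact: q20.
  rewrite ge0_integralD; last 5 first.
  - exact: mB.
  - by move=> x _; exact: Iq0.
  - by apply: measurable_funTS; exact: mIq.
  - by move=> x _; exact: Tq0.
  - by apply: measurable_funTS; exact: mTq.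
  apply: leeD.
    rewrite -near_norm.
    apply: le_trans (strong _ (measurable_near a r) (near_ge0 a r)).
    apply: ge0_subset_integral.
    - exact: mB.
    - exact: measurableT.
    - exact: mIq.
    - by move=> x _; exact: Iq0.
    - exact: subsetT.
  rewrite ge0_integralZl; last 4 first.
  - exact: mB.
  - by apply: measurable_funTS; exact: measurable_u.
  - by move=> x _; rewrite lee_fin; exact: u_ge0.
  - exact: poweR_ge0.
  by rewrite (ball_massE u_fin); exact: lexx.
have [Sy|Sfin] := eqVneq (S a r) +oo.
  rewrite Sy gt0_muley; first exact: leey.
  by rewrite lte_fin; apply: mulr_gt0 => //; exact: powR_gt0.
have Sf : S a r \is a fin_num by rewrite ge0_fin_numE// lt_neqAle Sfin leey.
move: S0 CS0 main; rewrite /Defs.Lnorm -(fineK Sf); set s := fine (S a r).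
rewrite lee_fin => s0 _ main.
have X0 : (0 <= 2 * (C3 `^ q * D + C1 `^ q) `^ q^-1)%R.
  by apply: mulr_ge0; [exact: ler0n|exact: powR_ge0].
have XU0 : (0 <= 2 * (C3 `^ q * D + C1 `^ q) `^ q^-1 * U a r `^ q^-1)%R.
  by apply: mulr_ge0; [exact: X0|exact: powR_ge0].
have main2 : \int[@lebn R n]_(x in tball a r)
     (`|Ialpha alpha f x| `^ q * (u x)%:E) <=
     ((2 * (C3 `^ q * D + C1 `^ q) `^ q^-1 * U a r `^ q^-1 * s) `^ q)%:E.
  apply: (le_trans main).
  have -> : ((2 * (C3 `^ q * D + C1 `^ q) `^ q^-1 * U a r `^ q^-1 * s) `^ q =
    2 `^ q * (C3 `^ q * (D * U a r * s `^ q) + C1 `^ q * s `^ q * U a r))%R.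
    rewrite (powRM _ XU0 s0) (powRM _ X0 (powR_ge0 _ _)).
    rewrite (powRM _ (ler0n _ _) (powR_ge0 _ _)).
    rewrite (powRVK _ cst0) ?gt_eqF// (powRVK _ (ltW U0)) ?gt_eqF//.
    by ring.
  rewrite EFinM; apply: lee_wpmul2l; first by rewrite lee_fin; exact: powR_ge0.
  rewrite EFinD; apply: leeD.
    rewrite EFinM; apply: lee_wpmul2l; first by rewrite lee_fin; exact: powR_ge0.
    have := ball_norm_le_sum a r0; rewrite -(fineK Sf) -/s -EFinM => h.
    apply: (le_trans (lee_poweR (ltW q_gt0) (ball_norm_ge0 _ _ _ _ _) h)).
    rewrite poweR_EFin lee_fin (powRM _ _ s0); last first.
      by apply: mulr_ge0; exact: powR_ge0.
    rewrite (powRM _ (powR_ge0 _ _) (powR_ge0 _ _)).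
    by rewrite (powRVK _ (ltW D_gt0)) ?gt_eqF// (powRVK _ (ltW U0)) ?gt_eqF.
  by rewrite -[C1%:E * s%:E]EFinM poweR_EFin -EFinM lee_fin (powRM _ C10 s0) lexx.
have int0 : 0 <= \int[@lebn R n]_(x in tball a r)
     (`|Ialpha alpha f x| `^ q * (u x)%:E).
  apply: integral_ge0 => x _.
  by apply: mule_ge0; [exact: poweR_ge0|rewrite lee_fin; exact: u_ge0].
have qi0 : (0 <= q^-1)%R by rewrite invr_ge0; exact: ltW.
apply: (le_trans (lee_poweR qi0 int0 main2)).
rewrite poweR_EFin powRK ?gt_eqF//; last by apply: mulr_ge0.
rewrite -EFinM lee_fin; apply: ler_wpM2r => //; apply: ler_wpM2r.
  exact: powR_ge0.
by rewrite /strong_const lerDl ler01.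
Qed.

Lemma ball_weak_bound a r :
  weak_estimate alpha p q C3 w ->
  (0 < r)%R ->
  WLnorm q u (tball a r) (Ialpha alpha f) <=
  (weak_const q D C1 C3 * U a r `^ q^-1)%:E * S a r.
Proof.
move=> weak r0; have mB := @measurable_tball R n a r.
have C10 := C1_ge0.
have D10 : (0 <= D `^ q^-1)%R by exact: powR_ge0.
have C3D0 : (0 <= 2 * C3 * D `^ q^-1)%R.
  by apply: mulr_ge0 => //; apply: mulr_ge0.
have C120 : (0 <= 2 * C1)%R by apply: mulr_ge0.
have wc0 : (0 < weak_const q D C1 C3)%R by rewrite /weak_const; lra.
have U0 := U_gt0 a r0.
have Uq0 : (0 < U a r `^ q^-1)%R by exact: powR_gt0.
have S0 : 0 <= S a r by exact: morrey_sum_ge0.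
have qi0 : (0 <= q^-1)%R by rewrite invr_ge0; exact: ltW.
apply: ge_ereal_sup => _ [gam [gam0 ->]].
have [Sy|Sfin] := eqVneq (S a r) +oo.
  rewrite Sy gt0_muley; first exact: leey.
  by rewrite lte_fin; exact: mulr_gt0.
have Sf : S a r \is a fin_num by rewrite ge0_fin_numE// lt_neqAle Sfin leey.
have mlev (h : n.-tuple R -> \bar R) y : measurable_fun setT h ->
    measurable (tball a r `&` [set x | y < h x]).
  by move=> mh; apply: emeasurable_fun_o_infty => //; exact: measurable_funTS.
have mI : measurable_fun setT (Ialpha alpha f) by exact: measurable_Ialpha.
have mE : measurable [set x | tball a r x /\ gam%:E < `|Ialpha alpha f x|].
  apply: (mlev (fun x => `|Ialpha alpha f x|)).
  exact: (measurableT_comp (@abse_measurable R setT)).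
set s := fine (S a r).
have sE : S a r = s%:E by rewrite fineK.
have s0 : (0 <= s)%R by rewrite -lee_fin -sE.
rewrite sE -EFinM.
(* Either the tail is at most half of [gam], so the near part exceeds the other half on the level
   set, or [gam] is below twice the tail bound and the mass of the whole ball suffices. *)
have [h|h] := leP (C1 * s)%R (gam / 2)%R.
  have g20 : (0 < gam / 2)%R by rewrite divr_gt0.
  have near_level : gam%:E *
      wmeas u [set x | tball a r x /\ gam%:E < `|Ialpha alpha f x|] `^ q^-1 <=
      2%:E * ((gam / 2)%:E * wmeas u (tball a r `&`
      [set x | (gam / 2)%:E < Ialpha alpha (near a r) x]) `^ q^-1).
    rewrite muleA -EFinM [(2 * _)%R]mulrC divfK ?pnatr_eq0//.
    apply: lee_wpmul2l; first by rewrite lee_fin; exact: ltW.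
    apply: lee_poweR; [exact: qi0|exact: wmeas_ge0|].
    apply: wmeas_subset; [exact: mw|exact: mE| |].
      by apply: mlev; apply: measurable_Ialpha; exact: measurable_near.
    move=> x /= [xB gx]; split; first exact: xB.
    have hle : (C1 * s)%:E <= (gam / 2)%:E by rewrite lee_fin.
    have := lt_le_trans gx (Ialpha_near_tail r0 xB).
    rewrite sE -EFinM => /lt_le_trans/(_ (leeD2l _ hle)).
    rewrite [X in X%:E < _](splitr gam) EFinD lteD2rE//.
  apply: (le_trans near_level).
  apply: (@le_trans _ _
    (2%:E * (C3%:E * ((D `^ q^-1 * U a r `^ q^-1)%:E * S a r)))).
    apply: lee_wpmul2l; first by rewrite lee_fin.
    apply: (le_trans (weak _ a r _ (measurable_near a r) (near_ge0 a r) g20)).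
    rewrite near_norm; apply: lee_wpmul2l; first by rewrite lee_fin.
    exact: ball_norm_le_sum.
  rewrite sE -!EFinM lee_fin.
  have -> : (2 * (C3 * (D `^ q^-1 * U a r `^ q^-1 * s)) =
    2 * C3 * D `^ q^-1 * U a r `^ q^-1 * s)%R by ring.
  apply: ler_wpM2r => //; apply: ler_wpM2r; first exact: ltW.
  by rewrite /weak_const; lra.
apply: (@le_trans _ _ (gam%:E * wmeas u (tball a r) `^ q^-1)).
  apply: lee_wpmul2l; first by rewrite lee_fin; exact: ltW.
  apply: lee_poweR; [exact: qi0|exact: wmeas_ge0|].
  by apply: wmeas_subset; [exact: mw|exact: mE|exact: mB|move=> x []].
rewrite -(ball_massE u_fin) poweR_EFin -EFinM lee_fin.
apply: (@le_trans _ _ (2 * C1 * s * U a r `^ q^-1)%R).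
  by apply: ler_wpM2r; [exact: ltW|lra].
rewrite -[leRHS]mulrA [(U a r `^ q^-1 * s)%R]mulrC mulrA.
apply: ler_wpM2r; first exact: ltW.
by apply: ler_wpM2r => //; rewrite /weak_const; lra.
Qed.

End fixed_function.

Section conclusion.
Variables (psi1 psi2 : n.-tuple R -> R -> R) (C : R).
Hypothesis wp_fin : forall a (r : R), (0 < r)%R ->
  wmeas (fun x => w x `^ p)%R (tball a r) < +oo.
Hypothesis psi1_ge0 : forall a r, (0 < r)%R -> (0 <= psi1 a r)%R.
Hypothesis psi2_ge0 : forall a r, (0 < r)%R -> (0 <= psi2 a r)%R.
Hypothesis C_gt0 : (0 < C)%R.
Hypothesis psi_hyp : zygmund_condition p q w psi1 psi2 C.

Local Notation C2 := (L / (L - 1) * D `^ q^-1)%R.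
Local Notation tail_const := (K * (L ^+ 2 / (L - 1)) `^ (n%:R - alpha))%R.
Local Notation mnorm f := (morrey_norm p (fun x => w x `^ p)%R psi1 (EFin \o f)).

Lemma C2_ge0 : (0 <= C2)%R.
Proof.
have L40 := L_ge4; apply: mulr_ge0; last exact: powR_ge0.
by apply: divr_ge0; lra.
Qed.

Lemma morrey_norm_ge0 (s : R) v psi (g : n.-tuple R -> \bar R) :
  (forall a r, (0 < r)%R -> (0 <= psi a r)%R) -> 0 <= morrey_norm s v psi g.
Proof.
move=> psi0; pose a : n.-tuple R := [tuple of nseq n 0%R].
apply: (@le_trans _ _ (((psi a 1)%:E)^-1 * ((wmeas v (tball a 1)) `^ (s^-1))^-1
  * Defs.Lnorm s v (tball a 1) g)).
  apply: mule_ge0; last exact: poweR_ge0.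
  apply: mule_ge0; rewrite inve_ge0; last exact: poweR_ge0.
  by rewrite lee_fin psi0.
by apply: ereal_sup_ubound; exists a, 1%R.
Qed.

Lemma morrey_normE f :
  in_morrey p (fun x => w x `^ p)%R psi1 (EFin \o f) ->
  mnorm f = (fine (mnorm f))%:E /\ (0 <= fine (mnorm f))%R.
Proof.
move=> [_ fin]; have M0 := @morrey_norm_ge0 p (fun x => w x `^ p)%R psi1
  (EFin \o f) psi1_ge0.
by split; [rewrite fineK// ge0_fin_numE|exact: fine_ge0].
Qed.

Lemma morrey_sum_psi f a r :
  in_morrey p (fun x => w x `^ p)%R psi1 (EFin \o f) -> (0 < r)%R ->
  morrey_sum p q L w (fun x => `|f x|)%R a r <=
  (C2 * fine (mnorm f) * (C * psi2 a r))%:E.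
Proof.
move=> Mf r0; have [ME M0] := morrey_normE Mf; have [[mf _] _] := Mf.
have maf : measurable_fun setT (fun x => `|f x|%R).
  by apply: measurableT_comp => //; exact/measurable_EFinP.
apply: (morrey_sum_le p_gt0 q_gt0 mw w_gt0 L_ge4 D_gt0 u_fin mass_doubling maf
  r0 M0 (psi1_ge0 a)) (psi_hyp a r0) => t t0.
have W0 : 0 < wmeas (fun x => w x `^ p)%R (tball a t).
  apply: integral_gt0.
  - exact: measurable_tball.
  - exact: measurable_wpow.
  - by move=> x; exact: powR_gt0.
  - exact: lebn_tball_gt0.
have Wf : wmeas (fun x => w x `^ p)%R (tball a t) \is a fin_num.
  by rewrite ge0_fin_numE ?(ltW W0)// wp_fin.
rewrite -(fineK Wf) poweR_EFin -EFinM; apply: le_of_morrey_quotient.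
- exact: psi1_ge0.
- by apply: powR_gt0; rewrite fine_gt0// W0 -ge0_fin_numE// ltW.
- exact: ball_norm_ge0.
rewrite -ME -poweR_EFin fineK//.
by apply: ereal_sup_ubound; exists a, t.
Qed.

(** The first conclusion provides local finiteness, the second the norm bound. *)
Lemma quotient_bound f (sc : R) a r (X : \bar R) :
  in_morrey p (fun x => w x `^ p)%R psi1 (EFin \o f) -> (0 < r)%R ->
  (0 <= sc)%R -> 0 <= X ->
  X <= (sc * U a r `^ q^-1)%:E * morrey_sum p q L w (fun x => `|f x|)%R a r ->
  X <= (sc * C2 * C * fine (mnorm f) * psi2 a r * U a r `^ q^-1)%:E /\
  ((psi2 a r)%:E)^-1 * (wmeas u (tball a r) `^ q^-1)^-1 * X <=
  (sc * C2 * C)%:E * mnorm f.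
Proof.
move=> Mf r0 sc0 X0 hX; have [ME M0] := morrey_normE Mf.
have h : X <= (sc * C2 * C * fine (mnorm f) * psi2 a r * U a r `^ q^-1)%:E.
  apply: (le_trans hX).
  have scU : 0 <= (sc * U a r `^ q^-1)%:E.
    by rewrite lee_fin mulr_ge0// powR_ge0.
  apply: (le_trans (lee_wpmul2l scU (morrey_sum_psi a Mf r0))).
  by rewrite -EFinM lee_fin le_eqVlt; apply/predU1P; left; ring.
split => //; rewrite -(ball_massE u_fin) poweR_EFin ME -EFinM.
apply: morrey_quotient_le => //.
- exact: psi2_ge0.
- by apply: powR_gt0; exact: (ball_mass_gt0 mw w_gt0 u_fin).
- apply: mulr_ge0 => //; apply: mulr_ge0; last exact: ltW.
  by apply: mulr_ge0 => //; exact: C2_ge0.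
Qed.

Lemma morrey_strong_conclusion :
  strong_estimate alpha p q C3 w ->
  exists K' : R, forall f : n.-tuple R -> R,
    in_morrey p (fun x => w x `^ p)%R psi1 (EFin \o f) ->
    in_morrey q u psi2 (Ialpha alpha f) /\
    morrey_norm q u psi2 (Ialpha alpha f) <= K'%:E * mnorm f.
Proof.
move=> strong; pose sc := strong_const q D tail_const C3.
have sc0 : (0 <= sc)%R.
  apply: addr_ge0; last exact: ler01.
  by apply: mulr_ge0; [exact: ler0n|exact: powR_ge0].
exists (sc * C2 * C)%R => f Mf; have [ME M0] := morrey_normE Mf.
have [[/measurable_EFinP mf _] _] := Mf.
have bound a r : (0 < r)%R ->
    Defs.Lnorm q u (tball a r) (Ialpha alpha f) <=
    (sc * C2 * C * fine (mnorm f) * psi2 a r * U a r `^ q^-1)%:E /\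
    ((psi2 a r)%:E)^-1 * (wmeas u (tball a r) `^ q^-1)^-1 *
      Defs.Lnorm q u (tball a r) (Ialpha alpha f) <= (sc * C2 * C)%:E * mnorm f.
  move=> r0; apply: quotient_bound => //; first exact: poweR_ge0.
  apply: ball_strong_bound;
    [exact: mf|reflexivity|reflexivity|exact: strong|exact: r0].
have norm_le : morrey_norm q u psi2 (Ialpha alpha f) <= (sc * C2 * C)%:E * mnorm f.
  by apply: ge_ereal_sup => _ [a [r [r0 ->]]]; have [] := bound a r r0.
split => //; split; last first.
  by apply: (le_lt_trans norm_le); rewrite ME -EFinM ltry.
split; first exact: measurable_Ialpha.
move=> a r; have [r0|r0] := ltP 0%R r.
  by have [h _] := bound a r r0; exact: (le_lt_trans h (ltry _)).
rewrite /Defs.Lnorm tball_set0; last by apply/negP; rewrite -leNgt.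
by rewrite integral_set0 poweR0r ?ltry// gt_eqF// invr_gt0.
Qed.

Lemma morrey_weak_conclusion :
  weak_estimate alpha p q C3 w ->
  exists K' : R, forall f : n.-tuple R -> R,
    in_morrey p (fun x => w x `^ p)%R psi1 (EFin \o f) ->
    in_weak_morrey q u psi2 (Ialpha alpha f) /\
    weak_morrey_norm q u psi2 (Ialpha alpha f) <= K'%:E * mnorm f.
Proof.
move=> weak; pose sc := weak_const q D tail_const C3.
have sc0 : (0 <= sc)%R.
  have t0 : (0 <= tail_const)%R by apply: mulr_ge0 => //; exact: powR_ge0.
  apply: addr_ge0; last exact: ler01.
  apply: addr_ge0; last by apply: mulr_ge0.
  by apply: mulr_ge0; [apply: mulr_ge0|exact: powR_ge0].
exists (sc * C2 * C)%R => f Mf; have [ME M0] := morrey_normE Mf.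
have [[/measurable_EFinP mf _] _] := Mf.
have norm_le : weak_morrey_norm q u psi2 (Ialpha alpha f) <=
    (sc * C2 * C)%:E * mnorm f.
  apply: ge_ereal_sup => _ [a [r [r0 ->]]].
  apply: (quotient_bound Mf r0 sc0 _ _).2.
    apply: (@le_trans _ _ (1%:E * (wmeas u [set x | tball a r x /\
        1%:E < `|Ialpha alpha f x| ]) `^ (q^-1))).
      by apply: mule_ge0; [rewrite lee_fin|exact: poweR_ge0].
    by apply: ereal_sup_ubound; exists 1%R.
  apply: ball_weak_bound;
    [exact: mf|reflexivity|reflexivity|exact: weak|exact: r0].
split => //; split; first exact: measurable_Ialpha.
by apply: (le_lt_trans norm_le); rewrite ME -EFinM ltry.
Qed.

End conclusion.

End morrey_transfer.

(** * The weak type estimate *)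

Section geometric_series.
Variable R : realType.

Lemma powRV (a r : R) : 0 <= a -> a^-1 `^ r = (a `^ r)^-1.
Proof. by move=> a0; rewrite -powR_inv1// -powRrM mulN1r powRN. Qed.

Lemma nneseries_geometric_le (c x : R) (a : nat -> \bar R) :
  0 <= c -> 0 <= x < 1 -> (forall j, 0 <= a j)%E ->
  (forall j, a j <= (c * x ^+ j)%:E)%E ->
  (\sum_(j <oo) a j <= (c / (1 - x))%:E)%E.
Proof.
move=> c0 /andP[x0 x1] a0 ac; apply: nneseries_le_bound => // N.
apply: (@le_trans _ _ (\sum_(0 <= j < N) (c * x ^+ j)%:E)%E).
  by apply: lee_sum => j _; exact: ac.
have x10 : 0 < 1 - x by rewrite subr_gt0.
rewrite sumEFin lee_fin -mulr_sumr; apply: ler_wpM2l => //.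
rewrite -[leRHS]mul1r ler_pdivlMr// big_mkord.
have := subrX1 x N; set y := \sum_(i < N) _ => h.
have -> : y * (1 - x) = 1 - x ^+ N by rewrite -[x ^+ N](subrK 1) h; ring.
by rewrite gerBl exprn_ge0.
Qed.

End geometric_series.

Section duality.
Local Open Scope ereal_scope.
Variables (R : realType) (n : nat) (alpha : R).

Lemma Ialpha_duality (f g : n.-tuple R -> R) :
  measurable_fun setT f -> measurable_fun setT g ->
  (forall x, 0 <= f x)%R -> (forall x, 0 <= g x)%R ->
  \int[@lebn R n]_x (Ialpha alpha f x * (g x)%:E) =
  \int[@lebn R n]_x (Ialpha alpha g x * (f x)%:E).
Proof.
move=> mf mg f0 g0.
pose k (z : n.-tuple R * n.-tuple R) : \bar R :=
  (f z.2 * ((tdist z.1 z.2) `^ (n%:R - alpha))^-1 * g z.1)%:E.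
have mk : measurable_fun setT k.
  apply/measurable_EFinP; apply: measurable_funM.
    apply: measurable_funM; last exact: measurable_kernel2.
    exact: (measurableT_comp mf measurable_snd).
  exact: (measurableT_comp mg measurable_fst).
have k0 z : 0 <= k z by rewrite lee_fin !mulr_ge0// kernel_ge0.
have kern0 (h : n.-tuple R -> R) x y : (forall x, 0 <= h x)%R ->
    0 <= (h y * ((tdist x y) `^ (n%:R - alpha))^-1)%:E.
  by move=> h0; rewrite lee_fin mulr_ge0// kernel_ge0.
transitivity (\int[@lebn R n]_x \int[@lebn R n]_y k (x, y)).
  apply: eq_integral => x _; rewrite /Ialpha -ge0_integralZr//.
  - exact: measurable_integrand.
  - by move=> y _; exact: kern0.
  - by rewrite lee_fin.
rewrite (fubini_tonelli k mk k0); apply: eq_integral => y _.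
rewrite /Ialpha -ge0_integralZr//.
- by apply: eq_integral => x _; rewrite /k/= -EFinM tdistC; congr EFin; ring.
- exact: measurable_integrand.
- by move=> x _; exact: kern0.
- by rewrite lee_fin.
Qed.

End duality.

Definition A1_estimate (R : realType) (n : nat) (alpha q K : R)
    (w : n.-tuple R -> R) : Prop :=
  forall a r, 0 < r -> exists N : set (n.-tuple R),
  [/\ measurable N, @lebn R n N = 0%E & forall x, tball a r x -> ~ N x ->
    ball_mass q w a r `^ q^-1 <= K * r `^ (n%:R - alpha) * w x].

Section weak_type.
Local Open Scope ereal_scope.
Variables (R : realType) (n : nat) (alpha q K : R) (w : n.-tuple R -> R).
Hypothesis n_gt0 : (0 < n)%N.
Hypothesis alpha_gt0 : (0 < alpha)%R.
Hypothesis alpha_lt : (alpha < n%:R)%R.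
Hypothesis q_gt0 : (0 < q)%R.
Hypothesis qE : (q^-1 = 1 - alpha / n%:R)%R.
Hypothesis mw : measurable_fun setT w.
Hypothesis w_gt0 : forall x, (0 < w x)%R.
Hypothesis K_ge0 : (0 <= K)%R.

Let u x := (w x `^ q)%R.
Hypothesis u_fin : forall a r, wmeas u (tball a r) < +oo.
Hypothesis A1_condition : A1_estimate alpha q K w.

Local Notation U := (ball_mass q w).
Local Notation beta := (n%:R - alpha)%R.

(** The exceptional set of the weight condition depends on the ball. Countably many rational balls
    have a common null set, and passing from them to arbitrary balls costs the power of 4. *)
Lemma A1_pointwise : exists N : set (n.-tuple R),
  [/\ measurable N, @lebn R n N = 0 & forall x r, ~ N x -> (0 < r)%R ->
   (U x r <= (K * 4 `^ beta) `^ q * (r ^+ n * w x `^ q))%R].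
Proof.
have /choice[N hN] : forall i : nat, exists N : set (n.-tuple R),
    [/\ measurable N, @lebn R n N = 0 &
    forall x, rball i x -> ~ N x ->
      (U (rational_ball R n i).1 (rational_ball R n i).2 `^ q^-1 <=
       K * (rational_ball R n i).2 `^ beta * w x)%R].
  by move=> i; apply: A1_condition; exact: rational_ball_gt0.
have mN i : measurable (N i) by have [] := hN i.
exists (\bigcup_i N i); split; first exact: bigcup_measurable.
  apply/eqP; rewrite -measure_le0.
  apply: (le_trans (measure_sigma_subadditive _ mN (bigcup_measurable _)
    (@subset_refl _ _))) => //.
  by rewrite eseries0// => i _ _; have [_ hNi _] := hN i; exact: hNi.
move=> x r Nx r0; have [i [ri ir rho4]] := rball_approx x r0.
have [_ _ hi] := hN i.
have xi : rball i x by apply: ri; rewrite /tball/= tdistxx.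
have Nix : ~ N i x by move=> h; apply: Nx; exists i.
have {}hi := hi x xi Nix.
have b0 : (0 <= beta)%R by rewrite subr_ge0 ltW.
have rho0 := rational_ball_gt0 R n i.
have wx0 := ltW (w_gt0 x).
have h : (U x r `^ q^-1 <= K * (4 * r) `^ beta * w x)%R.
  apply: (@le_trans _ _
    (U (rational_ball R n i).1 (rational_ball R n i).2 `^ q^-1)%R).
    apply: powR_le; first by rewrite invr_ge0 ltW.
      by apply: ltW; exact: (ball_mass_gt0 mw w_gt0 u_fin).
    exact: (ball_mass_le mw u_fin).
  apply: (le_trans hi); apply: ler_wpM2r => //; apply: ler_wpM2l => //.
  by apply: powR_le => //; exact: ltW.
(* For p = 1 the relation 1/q = 1 - alpha / n says that beta q = n. *)
have -> : (r ^+ n = (r `^ beta) `^ q)%R.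
  rewrite -powRrM -powR_mulrn ?(ltW r0)//; congr (_ `^ _)%R.
  have -> : q = (1 - alpha / n%:R)^-1%R by rewrite -qE invrK.
  have n0 : (n%:R != 0 :> R)%R by rewrite pnatr_eq0 -lt0n.
  by field; rewrite n0 subr_eq0 gt_eqF.
rewrite -powRM ?powR_ge0// -powRM ?mulr_ge0 ?powR_ge0//.
rewrite -[leLHS](@powRVK _ _ q) ?gt_eqF//; last first.
  by apply: ltW; exact: (ball_mass_gt0 mw w_gt0 u_fin).
apply: powR_le; [exact: ltW|exact: powR_ge0|].
apply: (le_trans h); rewrite powRM ?(ltW r0)// le_eqVlt; apply/predU1P; left.
by ring.
Qed.

Let L : R := 2.
(** [A] bounds the sum over shrinking balls, of ratio 2^-alpha, and [B] the sum over growing ones,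
    of ratio 2^-beta. *)
Let A : R := (2 `^ beta * (K * 4 `^ beta) `^ q / (1 - 2 `^ (- alpha)))%R.
Let B : R := (1 / (1 - 2 `^ (- beta)))%R.

Local Opaque ball_mass.

Let n0 : (0 < n%:R :> R)%R. Proof. by rewrite ltr0n. Qed.
Let beta0 : (0 < beta)%R. Proof. by rewrite subr_gt0. Qed.

Let powR2N_lt1 (s : R) : (0 < s)%R -> (0 <= (2 : R) `^ (- s) < 1)%R.
Proof.
move=> s0; rewrite powR_ge0/= powRN; rewrite invf_lt1 ?powR_gt0//.
by apply: powR_gt1 => //; rewrite ltr1n.
Qed.

(* With [rho^n = e / w(x)^q] the two geometric series of the dyadic decomposition
   have the same size [e^(alpha/n) w(x)]. *)
Lemma Ialpha_weight_bound (E : set (n.-tuple R)) (e : R) x :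
  measurable E -> wmeas u E = e%:E -> (0 < e)%R ->
  (forall r, (0 < r)%R ->
   (U x r <= (K * 4 `^ beta) `^ q * (r ^+ n * w x `^ q))%R) ->
  Ialpha alpha (fun y => u y * \1_E y)%R x <=
  ((A + B) * e `^ (alpha / n%:R) * w x)%:E.
Proof.
move=> mE uE e0 hU.
have mu : measurable_fun setT u by exact: measurable_wpow.
have u0 y : (0 <= u y)%R by exact: powR_ge0.
set v := (X in Ialpha _ X); set K' := ((K * 4 `^ beta) `^ q)%R in hU *.
have K'0 : (0 <= K')%R by exact: powR_ge0.
have mv : measurable_fun setT v.
  by apply: measurable_funM => //; exact: measurable_indic.
have v0 y : (0 <= v y)%R by rewrite mulr_ge0.
pose W := (w x `^ q)%R; have W0 : (0 < W)%R by rewrite powR_gt0.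
pose rho := ((e / W) `^ n%:R^-1)%R.
have eW0 : (0 < e / W)%R by rewrite divr_gt0.
have rho0 : (0 < rho)%R by rewrite powR_gt0.
(* Two bounds for one integral: the growth of the mass is used on small balls, the total mass [e] on
   large ones. *)
have ball_v r : (0 < r)%R -> \int[@lebn R n]_(y in tball x r) (v y)%:E <=
    (K' * (r ^+ n * W))%:E.
  move=> r0; apply: (@le_trans _ _ (wmeas u (tball x r))).
    apply: ge0_le_integral.
    - exact: measurable_tball.
    - by move=> y _; rewrite lee_fin.
    - by apply: measurable_funTS; exact/measurable_EFinP.
    - by apply: measurable_funTS; exact/measurable_EFinP.
    - by move=> y _; rewrite lee_fin /v ler_piMr// indicE; case: (_ \in _).
  by rewrite -(ball_massE u_fin) lee_fin; exact: hU.
have ball_e r : \int[@lebn R n]_(y in tball x r) (v y)%:E <= e%:E.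
  rewrite -uE /wmeas [leRHS]integral_mkcond.
  apply: (@le_trans _ _ (\int[@lebn R n]_y (v y)%:E)).
    apply: ge0_subset_integral.
    - exact: measurable_tball.
    - exact: measurableT.
    - exact/measurable_EFinP.
    - by move=> y _; rewrite lee_fin.
    - exact: subsetT.
  rewrite le_eqVlt; apply/predU1P; left; apply: eq_integral => y _.
  by rewrite patchE /v indicE; case: (_ \in _); rewrite ?mulr1 ?mulr0.
have int0 r : 0 <= \int[@lebn R n]_(y in tball x r) (v y)%:E.
  by apply: integral_ge0 => y _; rewrite lee_fin.
have L1 : (1 < 2 :> R)%R by rewrite ltr1n.
apply: (le_trans (Ialpha_dyadic alpha_lt mv v0 x L1 rho0)).
have inner : \sum_(j <oo) ((rho / 2 ^+ j.+1) `^ (- beta))%:E *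
    \int[@lebn R n]_(y in tball x (rho / 2 ^+ j)) (v y)%:E <=
    (2 `^ beta * K' * W * rho `^ alpha / (1 - 2 `^ (- alpha)))%:E.
  apply: nneseries_geometric_le => [||j|j].
  - by rewrite !mulr_ge0 ?powR_ge0// ltW.
  - exact: powR2N_lt1.
  - by apply: mule_ge0; [rewrite lee_fin powR_ge0|exact: int0].
  have r0 : (0 < rho / 2 ^+ j)%R by rewrite divr_gt0// exprn_gt0.
  have c0 : 0 <= ((rho / 2 ^+ j.+1) `^ (- beta))%:E by rewrite lee_fin powR_ge0.
  apply: (le_trans (lee_wpmul2l c0 (ball_v _ r0))).
  rewrite -EFinM lee_fin le_eqVlt; apply/predU1P; left.
  have -> : (rho / 2 ^+ j.+1 = rho / 2 ^+ j * 2^-1)%R.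
    by rewrite exprSr invfM mulrA.
  have -> : ((2 `^ (- alpha)) ^+ j = (2 ^+ j)^-1 `^ alpha)%R.
    by rewrite -powRXn// powRN -powRV// exprn_ge0.
  set r := (rho / 2 ^+ j)%R in r0 *.
  have -> : (2 `^ beta * K' * W * rho `^ alpha * (2 ^+ j)^-1 `^ alpha =
     2 `^ beta * K' * W * r `^ alpha)%R.
    by rewrite /r powRM ?invr_ge0 ?exprn_ge0 ?(ltW rho0)// !mulrA.
  rewrite -powR_mulrn ?(ltW r0)//.
  have -> : (r `^ n%:R = r `^ beta * r `^ alpha)%R.
    by rewrite -powRD ?(gt_eqF r0) ?implybT// subrK.
  rewrite powRM ?invr_ge0 ?(ltW r0)// !powRN (@powRV R 2%R)// invrK.
  have rb : (0 < r `^ beta)%R by rewrite powR_gt0.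
  by field; rewrite gt_eqF.
have outer : \sum_(j <oo) ((rho * 2 ^+ j) `^ (- beta))%:E *
    \int[@lebn R n]_(y in tball x (rho * 2 ^+ j.+1)) (v y)%:E <=
    (rho `^ (- beta) * e / (1 - 2 `^ (- beta)))%:E.
  apply: nneseries_geometric_le => [||j|j].
  - by rewrite mulr_ge0 ?powR_ge0// ltW.
  - exact: powR2N_lt1.
  - by apply: mule_ge0; [rewrite lee_fin powR_ge0|exact: int0].
  have c0 : 0 <= ((rho * 2 ^+ j) `^ (- beta))%:E by rewrite lee_fin powR_ge0.
  apply: (le_trans (lee_wpmul2l c0 (ball_e _))).
  rewrite -EFinM lee_fin le_eqVlt; apply/predU1P; left.
  by rewrite powRM ?exprn_ge0 ?(ltW rho0)// powRXn// mulrAC.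
apply: (le_trans (leeD inner outer)); rewrite -EFinD lee_fin.
have qiE : (beta / n%:R = q^-1)%R by rewrite qE mulrBl divff// gt_eqF.
have Wq : (W `^ q^-1 = w x)%R by rewrite powRK ?gt_eqF// ltW.
have e1 : (W * rho `^ alpha = e `^ (alpha / n%:R) * w x)%R.
  rewrite /rho -powRrM mulrC [(_^-1 * alpha)%R]mulrC.
  rewrite powRM ?invr_ge0 ?(ltW W0) ?(ltW e0)//.
  rewrite -mulrA -Wq; congr (_ * _)%R.
  rewrite powRV ?(ltW W0)// -powRN -[X in (_ * X)%R]powRr1 ?(ltW W0)//.
  by rewrite -powRD ?(gt_eqF W0) ?implybT// qE addrC.
have e2 : (rho `^ (- beta) * e = e `^ (alpha / n%:R) * w x)%R.
  rewrite /rho -powRrM mulrN mulrC [(_^-1 * beta)%R]mulrC qiE.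
  rewrite powRM ?invr_ge0 ?(ltW W0) ?(ltW e0)// mulrA.
  congr (_ * _)%R.
    rewrite -[X in (X * _)%R]powRr1 ?(ltW e0)//.
    by rewrite -powRD ?(gt_eqF e0) ?implybT// qE opprB addrC subrK.
  by rewrite powRV ?(ltW W0)// powRN invrK.
rewrite e2 -[(2 `^ beta * K' * W * _)%R]mulrA e1 /A /B -/K'.
by rewrite le_eqVlt; apply/predU1P; left; ring.
Qed.

Lemma weak_type_bound : exists2 C3 : R, (0 <= C3)%R &
  weak_estimate alpha 1 q C3 w.
Proof.
have A0 : (0 <= A)%R.
  have /andP[_ h] := powR2N_lt1 alpha_gt0.
  by rewrite divr_ge0 ?mulr_ge0 ?powR_ge0// subr_ge0 ltW.
have B0 : (0 <= B)%R.
  have /andP[_ h] := powR2N_lt1 beta0.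
  by rewrite divr_ge0// subr_ge0 ltW.
exists (A + B)%R; first exact: addr_ge0.
move=> g a r lam mg g0 lam0.
have [N [mN N0 hN]] := A1_pointwise.
have mI : measurable_fun setT (Ialpha alpha g) by exact: measurable_Ialpha.
set E := tball a r `&` _.
have mE : measurable E.
  apply: emeasurable_fun_o_infty; first exact: measurable_tball.
  exact: measurable_funTS.
have uE0 : 0 <= wmeas u E by exact: wmeas_ge0.
have uEf : wmeas u E \is a fin_num.
  rewrite ge0_fin_numE//; apply: le_lt_trans (u_fin a r).
  apply: wmeas_subset => //; [exact: measurable_tball|by move=> x []].
have mu : measurable_fun setT u by exact: measurable_wpow.
have u0 y : (0 <= u y)%R by exact: powR_ge0.
set e := fine (wmeas u E); have uE : wmeas u E = e%:E by rewrite fineK.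
have int0 : 0 <= \int[@lebn R n]_x (g x `^ 1 * w x `^ 1)%:E.
  by apply: integral_ge0 => x _; rewrite lee_fin mulr_ge0 ?powR_ge0.
rewrite invr1 poweRe1//.
have [e_eq0|en0] := eqVneq e 0%R.
  rewrite uE e_eq0 poweR0r ?mule0; last by rewrite gt_eqF// invr_gt0.
  by apply: mule_ge0 => //; rewrite lee_fin addr_ge0.
have e0 : (0 < e)%R by rewrite lt_neqAle eq_sym en0 -lee_fin -uE.
pose v y := (u y * \1_E y)%R.
have mv : measurable_fun setT v.
  by apply: measurable_funM => //; exact: measurable_indic.
have v0 y : (0 <= v y)%R by rewrite mulr_ge0.
have lower : (lam * e)%:E <= \int[@lebn R n]_x (Ialpha alpha g x * (v x)%:E).
  rewrite EFinM -uE /wmeas -ge0_integralZl; last 4 first.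
  - exact: mE.
  - by apply: measurable_funTS; exact/measurable_EFinP.
  - by move=> x _; rewrite lee_fin.
  - by rewrite lee_fin ltW.
  rewrite [leLHS]integral_mkcond; apply: ge0_le_integral.
  - exact: measurableT.
  - by move=> x _; apply: erestrict_ge0 => y _; rewrite mule_ge0// lee_fin// ltW.
  - apply: measurable_patch => //; apply: measurable_funeM.
    exact/measurable_EFinP.
  - by apply: emeasurable_funM; [exact: mI|exact/measurable_EFinP].
  - move=> x _; rewrite patchE /v indicE; case: ifPn => [/set_mem[_ h]|_].
      by rewrite mulr1 lee_wpmul2r ?lee_fin// ltW.
    by rewrite mulr0 mule0.
have upper : \int[@lebn R n]_x (Ialpha alpha v x * (g x)%:E) <=
    ((A + B) * e `^ (alpha / n%:R))%:E *
    \int[@lebn R n]_x (g x `^ 1 * w x `^ 1)%:E.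
  have mgw : measurable_fun setT (fun x => (g x `^ 1 * w x `^ 1)%:E).
    apply/measurable_EFinP; apply: measurable_funM; last exact: measurable_wpow.
    by under eq_fun do rewrite powRr1//.
  have c0 : (0 <= (A + B) * e `^ (alpha / n%:R))%R.
    by rewrite mulr_ge0 ?powR_ge0// addr_ge0.
  rewrite -ge0_integralZl; last 4 first.
  - exact: measurableT.
  - exact: mgw.
  - by move=> x _; rewrite lee_fin mulr_ge0 ?powR_ge0.
  - by rewrite lee_fin.
  apply: ae_ge0_le_integral.
  - exact: measurableT.
  - by move=> x _; rewrite mule_ge0 ?lee_fin// Ialpha_ge0.
  - apply: emeasurable_funM; last exact/measurable_EFinP.
    exact: measurable_Ialpha.
  - by move=> x _; rewrite -EFinM lee_fin mulr_ge0// mulr_ge0 ?powR_ge0.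
  - exact: measurable_funeM.
  exists N; split => // x /= /not_implyP[_ h]; apply: contrapT => Nx.
  apply: h; rewrite !powRr1 ?(ltW (w_gt0 x))//.
  have gx0 : 0 <= (g x)%:E by rewrite lee_fin.
  have := lee_wpmul2r gx0 (Ialpha_weight_bound mE uE e0 (fun r => hN x r Nx)).
  move=> /le_trans; apply; rewrite -!EFinM lee_fin le_eqVlt.
  by apply/predU1P; left; ring.
have := le_trans lower; rewrite (Ialpha_duality alpha mg mv g0 v0).
move=> /(_ _ upper).
have ea0 : (0 < e `^ (alpha / n%:R))%R by rewrite powR_gt0.
(* Since 1 = alpha / n + 1/q, cancelling the power alpha / n of the finite positive mass [e] leaves
   exactly the weak bound. *)
have -> : (lam * e = e `^ (alpha / n%:R) * (lam * e `^ q^-1))%R.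
  rewrite mulrCA -powRD; first by rewrite qE addrC subrK powRr1// ltW.
  by rewrite (gt_eqF e0) implybT.
rewrite [((A + B) * _)%R]mulrC !EFinM -muleA.
by rewrite lee_pmul2l ?lte_fin// uE poweR_EFin.
Qed.

End weak_type.

(** * The strong type estimate *)

Section hoelder_condition.
Local Open Scope ereal_scope.
Variables (R : realType) (n : nat) (alpha p p' q K : R).
Variables w v : n.-tuple R -> R.
Hypothesis p_gt0 : (0 < p)%R.
Hypothesis p'_gt0 : (0 < p')%R.
Hypothesis pp' : (p^-1 + p'^-1 = 1)%R.
Hypothesis mw : measurable_fun setT w.
Hypothesis mv : measurable_fun setT v.
Hypothesis w_gt0 : forall x, (0 < w x)%R.
Hypothesis v_gt0 : forall x, (0 < v x)%R.
Hypothesis wv : forall x, (w x * v x = 1)%R.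
Hypothesis w_fin : forall a r, wmeas (fun x => w x `^ q)%R (tball a r) < +oo.
Hypothesis v_fin : forall a r, wmeas (fun x => v x `^ p')%R (tball a r) < +oo.
Hypothesis A_condition : forall a (r : R), (0 < r)%R ->
  (ball_mass q w a r `^ q^-1 * ball_mass p' v a r `^ p'^-1 <=
   K * r `^ (n%:R - alpha))%R.

(** Hölder for f = (f w) v. Keeping [v] as a weight with w v = 1 makes the setting symmetric, so
    that [w] and [v] can be exchanged. *)
Lemma hoelder_local_bound : local_estimate alpha p q K w.
Proof.
move=> f a r mf f0 r0; have mB := @measurable_tball R n a r.
have mfw : measurable_fun setT (fun x => f x * w x)%R by exact: measurable_funM.
have fw0 x : (0 <= f x * w x)%R by rewrite mulr_ge0// ltW.
have v0 x : (0 <= v x)%R by exact: ltW.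
have := hoelder_on (@lebn R n) mB mfw mv fw0 v0 p_gt0 p'_gt0 pp'.
have -> : \int[@lebn R n]_(x in tball a r) (f x * w x * v x)%:E =
    \int[@lebn R n]_(x in tball a r) (f x)%:E.
  by apply: eq_integral => x _; rewrite -mulrA wv mulr1.
have -> : \int[@lebn R n]_(x in tball a r) ((f x * w x) `^ p)%:E =
    \int[@lebn R n]_(x in tball a r) (f x `^ p * w x `^ p)%:E.
  by apply: eq_integral => x _; rewrite powRM// ltW.
rewrite -[X in _ <= _ * X `^ _ -> _]/(wmeas (fun x => v x `^ p')%R (tball a r)).
rewrite -(ball_massE v_fin) -(ball_massE w_fin) !poweR_EFin.
set N := (X in X * _); set J := integral _ _ _ => h.
have U0 : 0 <= (ball_mass q w a r `^ q^-1)%:E by rewrite lee_fin powR_ge0.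
apply: (le_trans (lee_wpmul2l U0 h)); rewrite muleCA muleC.
apply: lee_wpmul2r; first exact: poweR_ge0.
by rewrite -EFinM lee_fin; exact: A_condition.
Qed.

End hoelder_condition.

(** * Hedberg's argument with the mass of balls in place of the radius *)

Section hedberg.
Variables (R : realType) (n : nat) (alpha p q t kap L theta D C5 K N g : R).
Variables (x : n.-tuple R) (f : n.-tuple R -> R) (U : R -> R).
Hypothesis n_gt0 : (0 < n)%N.
Hypothesis alpha_gt0 : 0 < alpha.
Hypothesis alpha_lt : alpha < n%:R.
Hypothesis p_gt0 : 0 < p.
Hypothesis q_gt0 : 0 < q.
Hypothesis pqE : q^-1 = p^-1 - alpha / n%:R.
Hypothesis tE : t = kap / p.
Hypothesis L_gt1 : 1 < L.
Hypothesis theta01 : 0 < theta < 1.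
Hypothesis D_gt0 : 0 < D.
Hypothesis C5_ge0 : 0 <= C5.
Hypothesis K_ge0 : 0 <= K.
Hypothesis N_gt0 : 0 < N.
Hypothesis g_gt0 : 0 < g.
Hypothesis U_gt0 : forall r, 0 < r -> 0 < U r.
Hypothesis U_le : forall r s, r <= s -> U r <= U s.
Hypothesis U_doubling : forall r, 0 < r -> U (L * r) <= D * U r.
Hypothesis U_reverse : forall r, 0 < r -> U r <= theta * U (L * r).
Hypothesis mf : measurable_fun setT f.
Hypothesis f_ge0 : forall y, 0 <= f y.

Local Notation J r := (\int[@lebn R n]_(y in tball x r) (f y)%:E)%E.
Local Notation beta := (n%:R - alpha).

Hypothesis J_small : forall r, 0 < r ->
  (J r <= (C5 * r `^ beta * (U r `^ (alpha / n%:R) * g `^ t))%:E)%E.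
Hypothesis J_large : forall r, 0 < r ->
  (J r <= (K * r `^ beta * ((U r `^ q^-1)^-1 * N))%:E)%E.

Lemma mass_scale_up j r : 0 < r -> U r <= theta ^+ j * U (L ^+ j * r).
Proof.
have L0 : 0 < L by exact: lt_trans L_gt1.
have /andP[th0 _] := theta01.
move=> r0; elim: j => [|j IH]; first by rewrite !expr0 !mul1r.
apply: (le_trans IH).
rewrite exprSr [L ^+ j.+1]exprS -(mulrA (theta ^+ j)) -(mulrA L).
apply: ler_wpM2l; first exact/exprn_ge0/ltW.
by apply: U_reverse; rewrite mulr_gt0// exprn_gt0.
Qed.

(* At the radius where [U rho] is comparable with [N^p g^-kap] the bounds
   [J_small] and [J_large] balance. *)
Lemma exists_radius tau : 0 < tau -> exists rho,
  [/\ 0 < rho, U rho <= tau & tau <= D * U rho].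
Proof.
move=> tau0; have L0 : 0 < L by exact: lt_trans L_gt1.
have /andP[th0 th1] := theta01.
have thV : 1 < theta^-1 by rewrite invf_gt1.
(* Reverse doubling pushes the mass below [tau] at a small radius and above it at a large one. The
   radius sought is the last one, in steps of [L], whose mass is below [tau]. *)
have [j hj] := expr_unbounded (U 1 / tau) thV.
pose rho0 := (L ^+ j)^-1; have rho00 : 0 < rho0 by rewrite invr_gt0 exprn_gt0.
have Urho0 : U rho0 < tau.
  apply: (le_lt_trans (mass_scale_up j rho00)).
  rewrite /rho0 mulfV ?gt_eqF ?exprn_gt0//.
  by move: hj; rewrite ltr_pdivrMr// exprVn -ltr_pdivlMl ?exprn_gt0// mulrC
    ltr_pdivrMr ?exprn_gt0// mulrC.
have ex : exists k, tau <= U (L ^+ k * rho0).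
  have [k hk] := expr_unbounded (tau / U rho0) thV; exists k.
  have h := mass_scale_up k rho00; have U0 := U_gt0 rho00.
  move: hk; rewrite ltr_pdivrMr// exprVn mulrC => /ltW/le_trans; apply.
  by rewrite ler_pdivrMr ?exprn_gt0// mulrC.
case: (ex_minnP ex) => -[|k] hk kmin.
  by move: hk; rewrite expr0 mul1r leNgt Urho0.
exists (L ^+ k * rho0); split.
- by rewrite mulr_gt0// exprn_gt0.
- by rewrite leNgt; apply/negP => /ltW/kmin; rewrite ltnn.
- apply: (le_trans hk); rewrite exprS -mulrA; apply: U_doubling.
  by rewrite mulr_gt0// exprn_gt0.
Qed.

(** Two geometric series of ratios theta^(alpha / n) and theta^(1 / q); the power of [D] accounts
    for a mass at [rho] only comparable to the balancing value. *)
Definition hedberg_const : R :=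
  L `^ beta * C5 / (1 - theta `^ (alpha / n%:R)) +
  L `^ beta * K / (1 - theta `^ q^-1) * D `^ q^-1.

Lemma theta_pow_lt1 (s : R) : 0 < s -> 0 <= theta `^ s < 1.
Proof.
move=> s0; have /andP[th0 th1] := theta01; rewrite powR_ge0/=.
suff : theta `^ s < 1 `^ s by rewrite powR1.
by apply: gt0_ltr_powR; rewrite ?nnegrE// ltW.
Qed.

Lemma hedberg : (Ialpha alpha f x <=
  (hedberg_const * (N `^ (p * alpha / n%:R) * g `^ (kap / q)))%:E)%E.
Proof.
have L0 : 0 < L by exact: lt_trans L_gt1.
have n0 : 0 < n%:R :> R by rewrite ltr0n.
have an0 : 0 < alpha / n%:R by rewrite divr_gt0.
have qi0 : 0 < q^-1 by rewrite invr_gt0.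
have /andP[th0 th1] := theta01.
(* The solution of U^(alpha / n) g^t = U^(-1/q) N, because alpha / n + 1/q = 1/p and t = kap / p. *)
have tau0 : 0 < N `^ p * g `^ (- kap) by rewrite mulr_gt0 ?powR_gt0.
have [rho [rho0 U1 U2]] := exists_radius tau0.
apply: (le_trans (Ialpha_dyadic alpha_lt mf f_ge0 x L_gt1 rho0)).
have intJ r : (0 <= J r)%E by apply: integral_ge0 => y _; rewrite lee_fin.
have Lb r : 0 < r -> (r / L) `^ (- beta) * r `^ beta = L `^ beta.
  move=> r0; rewrite powRM ?invr_ge0 ?(ltW r0) ?(ltW L0)// !powRN.
  rewrite (@powRV R L) ?(ltW L0)// invrK.
  have rb : 0 < r `^ beta by rewrite powR_gt0.
  by field; rewrite gt_eqF.
have inner : (\sum_(j <oo) ((rho / L ^+ j.+1) `^ (- beta))%:E *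
    J (rho / L ^+ j) <= (L `^ beta * C5 * (U rho `^ (alpha / n%:R) * g `^ t) /
    (1 - theta `^ (alpha / n%:R)))%:E)%E.
  apply: nneseries_geometric_le => [||j|j].
  - by rewrite !mulr_ge0 ?powR_ge0.
  - exact: theta_pow_lt1.
  - by apply: mule_ge0; [rewrite lee_fin powR_ge0|exact: intJ].
  have r0 : 0 < rho / L ^+ j by rewrite divr_gt0// exprn_gt0.
  have c0 : (0 <= ((rho / L ^+ j.+1) `^ (- beta))%:E)%E by rewrite lee_fin powR_ge0.
  apply: (le_trans (lee_wpmul2l c0 (J_small r0))); rewrite -EFinM lee_fin.
  have -> : rho / L ^+ j.+1 = rho / L ^+ j / L.
    by rewrite exprSr invfM mulrA.
  have -> : (rho / L ^+ j / L) `^ (- beta) * (C5 * (rho / L ^+ j) `^ beta *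
      (U (rho / L ^+ j) `^ (alpha / n%:R) * g `^ t)) =
      L `^ beta * C5 * (U (rho / L ^+ j) `^ (alpha / n%:R) * g `^ t).
    by rewrite -(Lb _ r0); ring.
  rewrite -[leRHS]mulrA; apply: ler_wpM2l; first by rewrite mulr_ge0 ?powR_ge0.
  rewrite mulrAC; apply: ler_wpM2r; first exact: powR_ge0.
  rewrite -powRXn ?(ltW th0)// -powRM ?exprn_ge0 ?(ltW th0) ?(ltW (U_gt0 _))//.
  apply: powR_le; [exact: ltW|exact/ltW/U_gt0|].
  have Lj : L ^+ j * (rho / L ^+ j) = rho.
    by rewrite mulrC divfK// gt_eqF// exprn_gt0.
  have := mass_scale_up j r0; rewrite Lj => h0.
  by rewrite [leRHS]mulrC.
have outer : (\sum_(j <oo) ((rho * L ^+ j) `^ (- beta))%:E *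
    J (rho * L ^+ j.+1) <= (L `^ beta * K * ((U rho `^ q^-1)^-1 * N) /
    (1 - theta `^ q^-1))%:E)%E.
  apply: nneseries_geometric_le => [||j|j].
  - by rewrite !mulr_ge0 ?invr_ge0 ?powR_ge0// ltW.
  - exact: theta_pow_lt1.
  - by apply: mule_ge0; [rewrite lee_fin powR_ge0|exact: intJ].
  have r0 : 0 < rho * L ^+ j.+1 by rewrite mulr_gt0// exprn_gt0.
  have c0 : (0 <= ((rho * L ^+ j) `^ (- beta))%:E)%E by rewrite lee_fin powR_ge0.
  apply: (le_trans (lee_wpmul2l c0 (J_large r0))); rewrite -EFinM lee_fin.
  have -> : rho * L ^+ j = rho * L ^+ j.+1 / L.
    by rewrite exprSr mulrA mulfK// gt_eqF.
  have -> : (rho * L ^+ j.+1 / L) `^ (- beta) * (K * (rho * L ^+ j.+1) `^ beta *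
      ((U (rho * L ^+ j.+1) `^ q^-1)^-1 * N)) =
      L `^ beta * K * ((U (rho * L ^+ j.+1) `^ q^-1)^-1 * N).
    by rewrite -(Lb _ r0); ring.
  rewrite -[leRHS]mulrA; apply: ler_wpM2l; first by rewrite mulr_ge0 ?powR_ge0.
  rewrite mulrAC; apply: ler_wpM2r; first exact: ltW.
  have r1 : 0 < rho * L ^+ j by rewrite mulr_gt0// exprn_gt0.
  have V0 := U_gt0 rho0; have V1 := U_gt0 r0.
  rewrite -powRXn ?(ltW th0)// ler_pdivlMl ?powR_gt0//.
  rewrite ler_pdivrMr ?powR_gt0// -powRM ?exprn_ge0 ?(ltW th0) ?(ltW V1)//.
  apply: powR_le; [exact: ltW|exact: ltW|].
  apply: (le_trans (mass_scale_up j rho0)).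
  apply: ler_wpM2l; first by rewrite exprn_ge0// ltW.
  apply: U_le; rewrite mulrC; apply: ler_wpM2l; first exact: ltW.
  by apply: ler_weXn2l => //; exact: ltW.
apply: (le_trans (leeD inner outer)); rewrite -EFinD lee_fin.
set X := N `^ (p * alpha / n%:R) * g `^ (kap / q).
have e1 : U rho `^ (alpha / n%:R) * g `^ t <= X.
  apply: (@le_trans _ _ ((N `^ p * g `^ (- kap)) `^ (alpha / n%:R) * g `^ t)).
    apply: ler_wpM2r; first exact: powR_ge0.
    by apply: powR_le; [exact: ltW|exact/ltW/U_gt0|].
  rewrite powRM ?powR_ge0// -!powRrM -mulrA -powRD ?(gt_eqF g_gt0) ?implybT//.
  rewrite /X mulrA le_eqVlt; apply/predU1P; left; congr (_ * _ `^ _).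
  by rewrite tE pqE; ring.
have e2 : (U rho `^ q^-1)^-1 * N <= D `^ q^-1 * X.
  have V0 := U_gt0 rho0.
  have h : (N `^ p * g `^ (- kap)) `^ q^-1 <= D `^ q^-1 * U rho `^ q^-1.
    rewrite -powRM ?(ltW D_gt0) ?(ltW V0)//.
    by apply: powR_le; [exact: ltW|exact: ltW|].
  rewrite ler_pdivrMl ?powR_gt0//.
  have -> : N = (N `^ p * g `^ (- kap)) `^ q^-1 * X.
    rewrite powRM ?powR_ge0// -!powRrM /X.
    have -> : N `^ (p / q) * g `^ (- kap / q) *
       (N `^ (p * alpha / n%:R) * g `^ (kap / q)) =
       (N `^ (p / q) * N `^ (p * alpha / n%:R)) *
       (g `^ (- kap / q) * g `^ (kap / q)) by ring.
    rewrite -!powRD ?(gt_eqF g_gt0) ?(gt_eqF N_gt0) ?implybT//.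
    rewrite mulNr addNr powRr0 mulr1.
    have -> : p / q + p * alpha / n%:R = 1.
      by rewrite pqE; field; rewrite !gt_eqF.
    by rewrite powRr1// ltW.
  have X0 : 0 <= X by rewrite mulr_ge0 ?powR_ge0.
  apply: (le_trans (ler_wpM2r X0 h)).
  by rewrite [leRHS]mulrA [U rho `^ _ * _]mulrC.
have /andP[_ th2] := theta_pow_lt1 an0.
have /andP[_ th3] := theta_pow_lt1 qi0.
have a0 : 0 <= L `^ beta * C5 / (1 - theta `^ (alpha / n%:R)).
  by rewrite divr_ge0 ?mulr_ge0 ?powR_ge0// subr_ge0 ltW.
have b0 : 0 <= L `^ beta * K / (1 - theta `^ q^-1).
  by rewrite divr_ge0 ?mulr_ge0 ?powR_ge0// subr_ge0 ltW.
rewrite /hedberg_const mulrDl; apply: lerD.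
  rewrite mulrAC; exact: ler_wpM2l.
rewrite mulrAC -[leRHS]mulrA; exact: ler_wpM2l.
Qed.

End hedberg.

(** * Exponent arithmetic for p > 1 *)

Section fractional_exponents.
Variables (R : realType) (n : nat) (alpha p p' q : R).
Hypothesis n_gt0 : (0 < n)%N.
Hypothesis p_gt1 : 1 < p.
Hypothesis pp' : p^-1 + p'^-1 = 1.
Hypothesis q_gt0 : 0 < q.
Hypothesis pqE : q^-1 = p^-1 - alpha / n%:R.

Lemma conjugate_exponentE : p' = p / (p - 1).
Proof.
have p0 : 0 < p by exact: lt_trans p_gt1.
have h : p'^-1 = (p - 1) / p.
  have -> : p'^-1 = 1 - p^-1 by rewrite -pp'; ring.
  by field; rewrite gt_eqF.
by rewrite -[p']invrK h invf_div.
Qed.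

Lemma conjugate_exponent_gt1 : 1 < p'.
Proof.
by rewrite conjugate_exponentE ltr_pdivlMr ?subr_gt0// mul1r ltrBlDr ltrDl.
Qed.

(** This is kap / p, and 1 / t is the power p / kap applied to the inner maximal function. *)
Let t := p^-1 * (1 + p' / q).

Lemma fractional_exponent_gt0 : 0 < t.
Proof.
have p0 : 0 < p by exact: lt_trans p_gt1.
have p'0 : 0 < p' by exact: lt_trans conjugate_exponent_gt1.
by rewrite mulr_gt0 ?invr_gt0// addr_gt0// divr_gt0.
Qed.

(** Raise the first inequality to the power [t] and eliminate the mass [S] of sigma by the weight
    condition. The exponents close up since t - p' / q = alpha / n and (n - alpha) p' - n t = n -
    alpha. *)
Lemma fractional_exponent_bound (c r j S U g Ds Du K : R) :
  0 < c -> 0 < r -> 0 <= j -> 0 < S -> 0 < U -> 0 <= g -> 0 < Ds -> 0 < Du ->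
  0 <= K ->
  j `^ t^-1 * (c * r ^+ n) <= (Ds * S) `^ t^-1 * (Du * U * g) ->
  U `^ q^-1 * S `^ p'^-1 <= K * r `^ (n%:R - alpha) ->
  j <= Ds * (Du / c) `^ t * K `^ p' * r `^ (n%:R - alpha) *
    (U `^ (alpha / n%:R) * g `^ t).
Proof.
move=> c0 r0 j0 S0 U0 g0 Ds0 Du0 K0 h1 h2.
have t0 := fractional_exponent_gt0.
have p0 : 0 < p by exact: lt_trans p_gt1.
have p'1 := conjugate_exponent_gt1; have p'0 : 0 < p' by exact: lt_trans p'1.
have n0 : 0 < n%:R :> R by rewrite ltr0n.
have SE : S <= K `^ p' * r `^ ((n%:R - alpha) * p') * U `^ (- (p' / q)).
  have : S `^ p'^-1 <= K * r `^ (n%:R - alpha) * (U `^ q^-1)^-1.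
    by rewrite ler_pdivlMr ?powR_gt0// mulrC.
  move/(powR_le (ltW p'0) (powR_ge0 _ _)).
  rewrite powRVK ?(gt_eqF p'0) ?(ltW S0)//.
  rewrite powRM ?mulr_ge0 ?invr_ge0 ?powR_ge0//.
  rewrite powRM ?powR_ge0// -!powRN -!powRrM.
  by rewrite mulNr [q^-1 * p']mulrC.
have h3 : j * (c * r ^+ n) `^ t <= Ds * S * (Du * U * g) `^ t.
  have A0 : 0 <= c * r ^+ n by rewrite mulr_ge0 ?exprn_ge0// ltW.
  have B0 : 0 <= Du * U * g by rewrite !mulr_ge0// ltW.
  have E0 : 0 <= Ds * S by rewrite mulr_ge0// ltW.
  move: (c * _) (Du * _ * _) (Ds * _) A0 B0 E0 h1 => A B E A0 B0 E0 h1.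
  have := powR_le (ltW t0) (mulr_ge0 (powR_ge0 _ _) A0) h1.
  by rewrite !powRM ?powR_ge0// !powRVK ?(gt_eqF t0).
have cr0 : 0 < (c * r ^+ n) `^ t by rewrite powR_gt0// mulr_gt0// exprn_gt0.
rewrite -(ler_pM2r cr0); apply: (le_trans h3).
have X0 : 0 <= Ds * (Du * U * g) `^ t by rewrite mulr_ge0 ?powR_ge0// ltW.
rewrite mulrAC mulrC; apply: (le_trans (ler_wpM2r X0 SE)).
rewrite le_eqVlt; apply/predU1P; left.
rewrite !powRM ?mulr_ge0 ?invr_ge0 ?exprn_ge0 ?(ltW c0) ?(ltW r0) ?(ltW Du0)
  ?(ltW U0)//.
have -> : c^-1 `^ t = (c `^ t)^-1 by rewrite powRV// ltW.
have -> : r `^ ((n%:R - alpha) * p') = r `^ (n%:R - alpha) * (r ^+ n) `^ t.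
  rewrite -powR_mulrn ?(ltW r0)// -powRrM -powRD ?(gt_eqF r0) ?implybT//.
  have -> // : (n%:R - alpha) * p' = n%:R - alpha + n%:R * t.
  have -> : alpha = n%:R * (p^-1 - q^-1).
    by rewrite pqE; field; rewrite !gt_eqF.
  rewrite /t conjugate_exponentE.
  by field; rewrite !gt_eqF// subr_gt0.
have -> : U `^ (alpha / n%:R) = U `^ (- (p' / q)) * U `^ t.
  rewrite -powRD ?(gt_eqF U0) ?implybT//.
  have -> // : alpha / n%:R = - (p' / q) + t.
  have -> : alpha / n%:R = p^-1 - q^-1 by rewrite pqE; ring.
  rewrite /t conjugate_exponentE.
  by field; rewrite !gt_eqF// subr_gt0.
by field; rewrite gt_eqF// powR_gt0.
Qed.

End fractional_exponents.

Lemma Ialpha_eq0 (R : realType) (n : nat) (alpha : R) (f : n.-tuple R -> R) x :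
  alpha < n%:R -> measurable_fun setT f -> (forall y, 0 <= f y) ->
  (forall r, 0 < r -> (\int[@lebn R n]_(y in tball x r) (f y)%:E <= 0)%E) ->
  Ialpha alpha f x = 0%E.
Proof.
move=> an mf f0 h.
have J0 r : 0 < r -> (\int[@lebn R n]_(y in tball x r) (f y)%:E = 0)%E.
  move=> r0; apply/eqP; rewrite eq_le (h _ r0)/=.
  by apply: integral_ge0 => y _; rewrite lee_fin.
have L1 : (1 : R) < 2 by rewrite ltr1n.
have r1 : (0 : R) < 1 by [].
apply/eqP; rewrite eq_le Ialpha_ge0// andbT.
apply: (le_trans (Ialpha_dyadic an mf f0 x L1 r1)).
have p2 j : (0 : R) < 2 ^+ j by rewrite exprn_gt0.
rewrite !eseries0 ?adde0// => j _ _.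
  by rewrite J0 ?mule0// mulr_gt0.
by rewrite J0 ?mule0// divr_gt0.
Qed.

Lemma weak11_const_ge0 (R : realType) (A s : R) : 0 <= A -> 1 < s ->
  0 <= weak11_const A s.
Proof.
move=> A0 s1; rewrite /weak11_const.
have h : 1 < 2 `^ (s - 1) by apply: powR_gt1; rewrite ?ltr1n ?subr_gt0.
by rewrite !mulr_ge0 ?powR_ge0// invr_ge0 subr_ge0 ltW.
Qed.

(** * The strong bound through two weighted maximal functions *)

Section strong_type.
Local Open Scope ereal_scope.
Variables (R : realType) (n : nat) (alpha p p' q K : R).
Variables w v : n.-tuple R -> R.
Hypothesis n_gt0 : (0 < n)%N.
Hypothesis alpha_gt0 : (0 < alpha)%R.
Hypothesis alpha_lt : (alpha < n%:R)%R.
Hypothesis p_gt1 : (1 < p)%R.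
Hypothesis pp' : (p^-1 + p'^-1 = 1)%R.
Hypothesis q_gt0 : (0 < q)%R.
Hypothesis pqE : (q^-1 = p^-1 - alpha / n%:R)%R.
Hypothesis mw : measurable_fun setT w.
Hypothesis mv : measurable_fun setT v.
Hypothesis w_gt0 : forall x, (0 < w x)%R.
Hypothesis v_gt0 : forall x, (0 < v x)%R.
Hypothesis wv : forall x, (w x * v x = 1)%R.
Hypothesis K_ge0 : (0 <= K)%R.
Hypothesis u_fin : forall a r, wmeas (fun x => w x `^ q)%R (tball a r) < +oo.
Hypothesis sigma_fin : forall a r, wmeas (fun x => v x `^ p')%R (tball a r) < +oo.
Hypothesis A_condition : forall a (r : R), (0 < r)%R ->
  (ball_mass q w a r `^ q^-1 * ball_mass p' v a r `^ p'^-1 <=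
   K * r `^ (n%:R - alpha))%R.

Let p_gt0 : (0 < p)%R. Proof. exact: lt_trans p_gt1. Qed.
Let p'_gt1 : (1 < p')%R. Proof. exact: (conjugate_exponent_gt1 p_gt1 pp'). Qed.
Let p'_gt0 : (0 < p')%R. Proof. exact: lt_trans p'_gt1. Qed.

Let local_bound := hoelder_local_bound p_gt0 p'_gt0 pp' mw mv w_gt0 v_gt0 wv
  u_fin sigma_fin A_condition.

Lemma q_gt_p : (p < q)%R.
Proof.
have n0 : (0 < n%:R :> R)%R by rewrite ltr0n.
rewrite -ltf_pV2 ?posrE// pqE ltrBlDr ltrDl.
by rewrite divr_gt0.
Qed.

(* The dual weight satisfies the same condition with the exponents [q'] and
   [p'] in place of [p] and [q], hence its powers are doubling as well. *)
Lemma dual_mass_doubling (lam : R) : (1 <= lam)%R -> exists2 D : R, (0 < D)%R &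
  forall a (r : R), (0 < r)%R ->
    (ball_mass p' v a (lam * r) <= D * ball_mass p' v a r)%R.
Proof.
have qi1 : (0 < 1 - q^-1)%R.
  by rewrite subr_gt0 invf_lt1// (lt_trans p_gt1 q_gt_p).
pose q' := (1 - q^-1)^-1%R.
have q'0 : (0 < q')%R by rewrite invr_gt0.
have q'1 : (1 <= q')%R.
  by rewrite /q' invf_ge1// lerBlDr lerDl invr_ge0 ltW.
have q'q : (q'^-1 + q^-1 = 1)%R by rewrite invrK subrK.
have p'q' : (p'^-1 = q'^-1 - alpha / n%:R)%R.
  have -> : (p'^-1 = 1 - p^-1)%R by rewrite -pp'; ring.
  by rewrite invrK pqE; ring.
have vw x : (v x * w x = 1)%R by rewrite mulrC wv.
have A' a (r : R) : (0 < r)%R -> (ball_mass p' v a r `^ p'^-1 *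
    ball_mass q w a r `^ q^-1 <= K * r `^ (n%:R - alpha))%R.
  by move=> r0; rewrite mulrC; exact: A_condition.
have lb := hoelder_local_bound q'0 q_gt0 q'q mv mw v_gt0 w_gt0 vw
  sigma_fin u_fin A'.
exact: (ball_mass_doubling n_gt0 alpha_gt0 q'1 p'_gt0 p'q' mv v_gt0 K_ge0
  sigma_fin lb).
Qed.

Variables Du Ds : R.
Hypothesis Du_gt0 : (0 < Du)%R.
Hypothesis Ds_gt0 : (0 < Ds)%R.
Hypothesis u_doubling : forall a (r : R), (0 < r)%R ->
  (ball_mass q w a (4 * r) <= Du * ball_mass q w a r)%R.
Hypothesis sigma_doubling : forall a (r : R), (0 < r)%R ->
  (ball_mass p' v a (4 * r) <= Ds * ball_mass p' v a r)%R.

Let u x := (w x `^ q)%R.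
Let sigma x := (v x `^ p')%R.
Let u0 x : (0 <= u x)%R. Proof. exact: powR_ge0. Qed.
Let sigma0 x : (0 <= sigma x)%R. Proof. exact: powR_ge0. Qed.
Let mu_ : measurable_fun setT u. Proof. exact: measurable_wpow. Qed.
Let msigma : measurable_fun setT sigma. Proof. exact: measurable_wpow. Qed.

Let u_gt0 a (r : R) : (0 < r)%R -> 0 < wmeas u (tball a r).
Proof. by move=> r0; rewrite -(ball_massE u_fin) lte_fin ball_mass_gt0. Qed.

Let sigma_gt0 a (r : R) : (0 < r)%R -> 0 < wmeas sigma (tball a r).
Proof. by move=> r0; rewrite -(ball_massE sigma_fin) lte_fin ball_mass_gt0. Qed.

Let uD a (r : R) : (0 < r)%R ->
  wmeas u (tball a (4 * r)) <= Du%:E * wmeas u (tball a r).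
Proof.
by move=> r0; rewrite -!(ball_massE u_fin) -EFinM lee_fin u_doubling.
Qed.

Let sigmaD a (r : R) : (0 < r)%R ->
  wmeas sigma (tball a (4 * r)) <= Ds%:E * wmeas sigma (tball a r).
Proof.
by move=> r0; rewrite -!(ball_massE sigma_fin) -EFinM lee_fin sigma_doubling.
Qed.

Let t := (p^-1 * (1 + p' / q))%R.
Let t_gt0 : (0 < t)%R. Proof. exact: fractional_exponent_gt0. Qed.

Section two_maximal_functions.
Variable f : n.-tuple R -> R.
Hypothesis mf : measurable_fun setT f.
Hypothesis f_ge0 : forall x, (0 <= f x)%R.

(* [f = (f w^p') sigma], and [dual_maxf f] dominates the sigma-average of
   [f w^p'] at every point of a ball; averaging its power [1 / t] over the ball
   against [u] brings in a second maximal function, taken with respect to [u]. *)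
Definition dual_maxf : n.-tuple R -> \bar R :=
  maxf sigma (fun x => (f x * w x `^ p')%:E).

(** Dividing by [u] makes its u-integral over a ball a plain Lebesgue integral of a power of
    [dual_maxf], which a bound valid at every point of the ball controls from below. *)
Definition transplanted x := dual_maxf x `^ t^-1 * ((u x)^-1)%:E.

Definition double_maxf : n.-tuple R -> \bar R := maxf u transplanted.

Let h_ge0 x : 0 <= (f x * w x `^ p')%:E.
Proof. by rewrite lee_fin mulr_ge0 ?powR_ge0. Qed.

Let mh : measurable_fun setT (fun x => (f x * w x `^ p')%:E).
Proof.
by apply/measurable_EFinP; apply: measurable_funM => //; exact: measurable_wpow.
Qed.

Let dual_maxf_ge0 x : 0 <= dual_maxf x.
Proof. exact: (maxf_ge0 sigma0 sigma_gt0 sigma_fin h_ge0). Qed.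

Let transplanted_ge0 x : 0 <= transplanted x.
Proof. by apply: mule_ge0; rewrite ?poweR_ge0// lee_fin invr_ge0. Qed.

Let measurable_transplanted : measurable_fun setT transplanted.
Proof.
apply: emeasurable_funM.
  apply: (measurableT_comp (measurable_poweR t^-1)); exact: measurable_maxf.
have -> : (fun x => ((u x)^-1)%:E) = (fun x => (w x `^ (- q))%:E).
  by apply/funext => x; rewrite powRN.
by apply/measurable_EFinP; exact: measurable_wpow.
Qed.

Lemma double_maxf_ge0 x : 0 <= double_maxf x.
Proof. exact: (maxf_ge0 u0 u_gt0 u_fin transplanted_ge0). Qed.

Let w_sigma x : (w x `^ p' * sigma x = 1)%R.
Proof.
by rewrite -powRM ?(ltW (w_gt0 x)) ?(ltW (v_gt0 x))// wv powR1.
Qed.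

Let transplantedM x : transplanted x * (u x)%:E = dual_maxf x `^ t^-1.
Proof.
rewrite /transplanted -muleA -EFinM mulVf ?mule1//.
by rewrite gt_eqF// powR_gt0.
Qed.

Lemma fractional_average a (r g : R) : (0 < r)%R -> double_maxf a = g%:E ->
  \int[@lebn R n]_(x in tball a r) (f x)%:E <=
  (Ds * (Du / (2 / n.+1%:R) ^+ n) `^ t * K `^ p' * r `^ (n%:R - alpha) *
    (ball_mass q w a r `^ (alpha / n%:R) * g `^ t))%:E.
Proof.
move=> r0 ga; have mB := @measurable_tball R n a r.
have U0 := ball_mass_gt0 mw w_gt0 u_fin a r0.
have S0 := ball_mass_gt0 mv v_gt0 sigma_fin a r0.
have g0 : (0 <= g)%R by rewrite -lee_fin -ga double_maxf_ge0.
have ti0 : (0 <= t^-1)%R by rewrite invr_ge0 ltW.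
set J := integral _ _ _.
have J0 : 0 <= J by apply: integral_ge0 => x _; rewrite lee_fin.
have JF x : tball a r x -> J <= (Ds * ball_mass p' v a r)%:E * dual_maxf x.
  move=> Bx.
  have := maxf_average msigma sigma0 sigma_gt0 sigma_fin sigmaD mh h_ge0 r0 Bx.
  rewrite -(ball_massE sigma_fin) -EFinM.
  suff -> : \int[@lebn R n]_(y in tball a r)
    ((f y * w y `^ p')%:E * (sigma y)%:E) = J by [].
  by apply: eq_integral => y _; rewrite -EFinM -mulrA w_sigma mulr1.
have haa : tball a r a by rewrite /tball/= tdistxx.
have FU : \int[@lebn R n]_(x in tball a r) (dual_maxf x `^ t^-1) <=
    (Du * ball_mass q w a r * g)%:E.
  have := maxf_average mu_ u0 u_gt0 u_fin uD measurable_transplanted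
    transplanted_ge0 r0 haa.
  rewrite -/double_maxf ga -(ball_massE u_fin) -!EFinM.
  suff -> : \int[@lebn R n]_(y in tball a r) (transplanted y * (u y)%:E) =
    \int[@lebn R n]_(x in tball a r) (dual_maxf x `^ t^-1) by [].
  by apply: eq_integral => y _; exact: transplantedM.
have DS0 : (0 <= Ds * ball_mass p' v a r)%R.
  exact: mulr_ge0 (ltW Ds_gt0) (ltW S0).
(* The bound [JF], raised to the power 1 / t, is integrated over the ball; its constant left side
   produces the volume. *)
have key : J `^ t^-1 * ((2 / n.+1%:R) ^+ n * r ^+ n)%:E <=
    ((Ds * ball_mass p' v a r) `^ t^-1 * (Du * ball_mass q w a r * g))%:E.
  have /andP[vol _] := tball_volume a r0.
  apply: (@le_trans _ _ (J `^ t^-1 * @lebn R n (tball a r))).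
    by apply: lee_wpmul2l => //; exact: poweR_ge0.
  have <- : \int[@lebn R n]_(x in tball a r) cst (J `^ t^-1) x =
      J `^ t^-1 * @lebn R n (tball a r) by rewrite integral_cst.
  rewrite EFinM -poweR_EFin.
  have p0 : 0 <= (Ds * ball_mass p' v a r)%:E `^ t^-1 by exact: poweR_ge0.
  apply: le_trans (lee_wpmul2l p0 FU).
  rewrite -ge0_integralZl//; last first.
  - by move=> x _; exact: poweR_ge0.
  - apply: measurable_funTS; apply: (measurableT_comp (measurable_poweR t^-1)).
    exact: measurable_maxf.
  apply: ge0_le_integral_nonmeasurable => x Bx; first exact: poweR_ge0.
  rewrite [cst _ _]/= -poweRM ?lee_fin//; apply: lee_poweR => //.
  exact: JF.
(* Local integrability of [f] is a consequence: an infinite [J] would make the left side of [key]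
   infinite. *)
have Jfin : J \is a fin_num.
  rewrite ge0_fin_numE// ltNge leye_eq; apply/negP => /eqP Joo.
  move: key; rewrite Joo poweRyr ?invr_eq0 ?gt_eqF// gt0_mulye ?lte_fin.
    by rewrite leye_eq.
  by rewrite mulr_gt0// exprn_gt0// divr_gt0.
have [j Jj] : exists j, J = j%:E by exists (fine J); rewrite fineK.
move: J0 key; rewrite Jj poweR_EFin -EFinM !lee_fin => j0 key.
apply: (fractional_exponent_bound n_gt0 p_gt1 pp' q_gt0 pqE _ r0 j0 S0 U0 g0
  Ds_gt0 Du_gt0 K_ge0 key (A_condition a r0)).
by rewrite exprn_gt0// divr_gt0.
Qed.

Let kap := (1 + p' / q)%R.

Let c1 := weak11_const (2 * Ds) p.
Let c2 := weak11_const (2 * Du) kap.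

Lemma double_maxf_strong :
  \int[@lebn R n]_x (double_maxf x `^ kap * (u x)%:E) <=
  (c2 * c1)%:E * \int[@lebn R n]_x (f x `^ p * w x `^ p)%:E.
Proof.
have kap1 : (1 < kap)%R by rewrite ltrDl divr_gt0.
have kap0 : (0 < kap)%R by exact: lt_trans kap1.
have ti0 : (0 < t^-1)%R by rewrite invr_gt0.
have c20 : 0 <= c2%:E.
  by rewrite lee_fin; apply: weak11_const_ge0 => //; rewrite mulr_ge0// ltW.
have h2 := maxf_strong mu_ u0 u_gt0 u_fin (ltW Du_gt0) uD kap1
  measurable_transplanted transplanted_ge0.
have h1 := maxf_strong msigma sigma0 sigma_gt0 sigma_fin (ltW Ds_gt0)
  sigmaD p_gt1 mh h_ge0.
apply: (le_trans h2).
suff h3 : \int[@lebn R n]_x (transplanted x `^ kap * (u x)%:E) <=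
    c1%:E * \int[@lebn R n]_x (f x `^ p * w x `^ p)%:E.
  have h := lee_wpmul2l c20 h3.
  by rewrite muleA -EFinM in h; exact: h.
(* Here kap / t = p and u^(1 - kap) = w^(-p') = sigma. *)
have -> : \int[@lebn R n]_x (transplanted x `^ kap * (u x)%:E) =
    \int[@lebn R n]_x (dual_maxf x `^ p * (sigma x)%:E).
  apply: eq_integral => x _.
  have ux0 : (0 < u x)%R by rewrite powR_gt0.
  rewrite /transplanted poweRM ?poweR_ge0 ?lee_fin ?invr_ge0//.
  rewrite -poweRrM poweR_EFin -muleA -EFinM; congr (_ `^ _ * _%:E).
    by rewrite /t -/kap; field; rewrite !gt_eqF.
  have W0 : (0 < w x `^ p')%R by rewrite powR_gt0.
  have -> : ((u x)^-1 `^ kap = (u x * w x `^ p')^-1)%R.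
    rewrite powRV; last exact: u0.
    rewrite /kap powRD ?(gt_eqF ux0) ?implybT// powRr1 ?u0// /u -powRrM.
    by have -> : (q * (p' / q) = p')%R by field; rewrite gt_eqF.
  rewrite invfM mulrAC mulVf ?mul1r ?gt_eqF//.
  by apply: (mulfI (negbT (gt_eqF W0))); rewrite mulfV ?w_sigma ?gt_eqF.
suff <- : \int[@lebn R n]_x ((f x * w x `^ p')%:E `^ p * (sigma x)%:E) =
  \int[@lebn R n]_x (f x `^ p * w x `^ p)%:E by exact: h1.
apply: eq_integral => x _; rewrite poweR_EFin -EFinM; congr _%:E.
rewrite powRM ?powR_ge0// -mulrA; congr (_ * _)%R.
have -> : (w x `^ p' `^ p = w x `^ p * w x `^ p')%R.
  rewrite -powRrM -powRD ?(gt_eqF (w_gt0 x)) ?implybT//; congr (_ `^ _)%R.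
  by rewrite (conjugate_exponentE p_gt1 pp'); field; rewrite gt_eqF ?subr_gt0.
by rewrite -mulrA w_sigma mulr1.
Qed.

End two_maximal_functions.

Variables L theta D : R.
Hypothesis L_gt1 : (1 < L)%R.
Hypothesis theta01 : (0 < theta < 1)%R.
Hypothesis D_gt0 : (0 < D)%R.
Hypothesis u_doubling_L : forall a (r : R), (0 < r)%R ->
  (ball_mass q w a (L * r) <= D * ball_mass q w a r)%R.
Hypothesis u_reverse : forall a (r : R), (0 < r)%R ->
  (ball_mass q w a r <= theta * ball_mass q w a (L * r))%R.

Let kap := (1 + p' / q)%R.
Let C5 := (Ds * (Du / (2 / n.+1%:R) ^+ n) `^ t * K `^ p')%R.
Let Ch := hedberg_const n alpha q L theta D C5 K.

Lemma integral_ball_le_norm (f : n.-tuple R -> R) (N : R) a (r : R) :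
  measurable_fun setT f -> (forall y, 0 <= f y)%R -> (0 < r)%R ->
  (\int[@lebn R n]_y (f y `^ p * w y `^ p)%:E) `^ p^-1 = N%:E ->
  \int[@lebn R n]_(y in tball a r) (f y)%:E <=
    (K * r `^ (n%:R - alpha) * ((ball_mass q w a r `^ q^-1)^-1 * N))%:E.
Proof.
move=> mf f0 r0 NE.
apply: (le_trans (integral_ball_le mw w_gt0 u_fin local_bound mf f0 a r0)).
rewrite [X in _ <= X]EFinM; apply: lee_wpmul2l.
  by rewrite lee_fin mulr_ge0 ?powR_ge0.
rewrite [X in _ <= X]EFinM [X in _ <= X]muleC; apply: lee_wpmul2r.
  by rewrite lee_fin invr_ge0 powR_ge0.
rewrite -NE; apply: lee_poweR; first by rewrite invr_ge0 ltW.
  by apply: integral_ge0 => y _; rewrite lee_fin mulr_ge0 ?powR_ge0.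
apply: ge0_subset_integral => //.
- exact: measurable_tball.
- apply/measurable_EFinP; apply: measurable_funM; last exact: measurable_wpow.
  by apply: measurable_wpow.
- by move=> y _; rewrite lee_fin mulr_ge0 ?powR_ge0.
Qed.

(** Hedberg's bound to the power [q], where (p alpha / n) q = q - p. The constant |Ch| + 1 is
    positive, which settles the points where [double_maxf] is infinite. *)
Lemma Ialpha_le_double_maxf (f : n.-tuple R -> R) (N : R) x :
  measurable_fun setT f -> (forall y, 0 <= f y)%R -> (0 < N)%R ->
  (\int[@lebn R n]_y (f y `^ p * w y `^ p)%:E) `^ p^-1 = N%:E ->
  Ialpha alpha f x `^ q <=
  ((`|Ch| + 1) `^ q * N `^ (q - p))%:E * double_maxf f x `^ kap.
Proof.
move=> mf f0 N0 NE.
have kap0 : (0 < kap)%R by rewrite addr_gt0// divr_gt0.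
have Ch0 : (0 < `|Ch| + 1)%R by rewrite ltr_wpDl.
have c0 : (0 < (`|Ch| + 1) `^ q * N `^ (q - p))%R.
  by rewrite mulr_gt0 ?powR_gt0.
have I0 : 0 <= Ialpha alpha f x by exact: Ialpha_ge0.
have K5 : (0 <= C5)%R.
  by rewrite mulr_ge0 ?powR_ge0// mulr_ge0 ?powR_ge0// ltW.
have G0 := double_maxf_ge0 f x.
case Gx : (double_maxf f x) G0 => [g| |//] G0; last first.
  by rewrite poweRyr ?gt_eqF// gt0_muley ?lte_fin// leey.
rewrite lee_fin in G0.
have small r : (0 < r)%R -> \int[@lebn R n]_(y in tball x r) (f y)%:E <=
    (C5 * r `^ (n%:R - alpha) *
      (ball_mass q w x r `^ (alpha / n%:R) * g `^ t))%:E.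
  by move=> r0; exact: (fractional_average mf f0 r0 Gx).
(* The balancing radius involves a negative power of [g]. At g = 0 the small-ball bound already
   annihilates every ball integral, hence the potential. *)
have [g0|gn0] := eqVneq g 0%R.
  rewrite Ialpha_eq0//; last first.
    move=> r /small; rewrite g0 powR0 ?gt_eqF//.
    by rewrite !mulr0.
  have -> : 0%:E `^ q = 0%:E :> \bar R by rewrite poweR_EFin powR0 ?gt_eqF.
  by rewrite mule_ge0 ?poweR_ge0// lee_fin ltW.
have g_gt0 : (0 < g)%R by rewrite lt_neqAle eq_sym gn0.
have large r : (0 < r)%R -> \int[@lebn R n]_(y in tball x r) (f y)%:E <=
    (K * r `^ (n%:R - alpha) * ((ball_mass q w x r `^ q^-1)^-1 * N))%:E.
  by move=> r0; exact: integral_ball_le_norm.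
have U_gt0 r : (0 < r)%R -> (0 < ball_mass q w x r)%R by exact: ball_mass_gt0.
have U_le (r s : R) : (r <= s)%R -> (ball_mass q w x r <= ball_mass q w x s)%R.
  by move=> rs; apply: ball_mass_le => //; exact: tball_le.
have tE : t = (kap / p)%R by rewrite /t mulrC.
have := hedberg n_gt0 alpha_gt0 alpha_lt p_gt0 q_gt0 pqE tE L_gt1 theta01 D_gt0
  K5 K_ge0 N0 g_gt0 U_gt0 U_le (u_doubling_L x) (u_reverse x) mf f0 small large.
set X := (N `^ _ * g `^ _)%R.
have X0 : (0 <= X)%R by rewrite mulr_ge0 ?powR_ge0.
move=> h; have {}h : Ialpha alpha f x <= ((`|Ch| + 1) * X)%:E.
  apply: (le_trans h); rewrite lee_fin; apply: ler_wpM2r => //.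
  by apply: (le_trans (ler_norm _)); rewrite lerDl.
apply: (le_trans (lee_poweR (ltW q_gt0) I0 h)).
rewrite !poweR_EFin -EFinM lee_fin -[leRHS]mulrA.
have -> : (N `^ (q - p) * g `^ kap = X `^ q)%R.
  rewrite powRM ?powR_ge0// -!powRrM divfK ?gt_eqF//.
  have -> // : (p * alpha / n%:R * q = q - p)%R.
  have -> : (p * alpha / n%:R = p * (p^-1 - q^-1))%R by rewrite pqE; ring.
  by field; rewrite !gt_eqF.
by rewrite -powRM ?(ltW Ch0).
Qed.

Let c12 := (weak11_const (2 * Du) kap * weak11_const (2 * Ds) p)%R.

Lemma strong_type_estimate :
  strong_estimate alpha p q ((`|Ch| + 1) * c12 `^ q^-1 + 1)%R w.
Proof.
move=> f mf f0.
have kap1 : (1 < kap)%R by rewrite ltrDl divr_gt0.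
have kap0 : (0 < kap)%R by exact: lt_trans kap1.
have c120 : (0 <= c12)%R.
  by rewrite mulr_ge0// weak11_const_ge0// mulr_ge0// ltW.
have Ch0 : (0 < `|Ch| + 1)%R by rewrite ltr_wpDl.
have C30 : (0 < (`|Ch| + 1) * c12 `^ q^-1 + 1)%R.
  by rewrite ltr_wpDl// mulr_ge0 ?powR_ge0// ltW.
have M0 : 0 <= \int[@lebn R n]_x (f x `^ p * w x `^ p)%:E.
  by apply: integral_ge0 => x _; rewrite lee_fin mulr_ge0 ?powR_ge0.
case ME : (\int[@lebn R n]_x (f x `^ p * w x `^ p)%:E) M0 => [m| |//] M0;
  last first.
  by rewrite !poweRyr ?invr_eq0 ?gt_eqF// gt0_muley ?lte_fin ?powR_gt0// leey.
(* A zero norm admits no balancing radius either; the local estimate then makes [f] integrate to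
   zero on every ball. *)
have [m0|mn0] := eqVneq m 0%R.
  rewrite integral0_eq; last first.
    move=> x _; rewrite Ialpha_eq0//.
      have -> : 0%:E `^ q = 0%:E :> \bar R by rewrite poweR_EFin powR0 ?gt_eqF.
      by rewrite mul0e.
    move=> r r0; have NE : (\int[@lebn R n]_x (f x `^ p * w x `^ p)%:E) `^ p^-1
        = 0%:E.
      by rewrite ME m0 poweR_EFin powR0// gt_eqF// invr_gt0.
    by apply: (le_trans (integral_ball_le_norm x mf f0 r0 NE)); rewrite !mulr0.
  by apply: mule_ge0; rewrite ?poweR_ge0// lee_fin powR_ge0.
have m_gt0 : (0 < m)%R by rewrite lt_neqAle eq_sym mn0 -lee_fin.
pose N := (m `^ p^-1)%R; have N0 : (0 < N)%R by exact: powR_gt0.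
have NE : (\int[@lebn R n]_x (f x `^ p * w x `^ p)%:E) `^ p^-1 = N%:E.
  by rewrite ME.
have pt := Ialpha_le_double_maxf _ mf f0 N0 NE.
set c := ((`|Ch| + 1) `^ q * N `^ (q - p))%R in pt.
have c0 : 0 <= c%:E by rewrite lee_fin mulr_ge0 ?powR_ge0.
apply: (@le_trans _ _ (\int[@lebn R n]_x
    (c%:E * (double_maxf f x `^ kap * (u x)%:E)))).
  apply: ge0_le_integral_nonmeasurable => x _.
    by apply: mule_ge0; rewrite ?poweR_ge0// lee_fin powR_ge0.
  rewrite muleA; apply: lee_wpmul2r; first by rewrite lee_fin powR_ge0.
  exact: pt.
rewrite ge0_integralZl//; last 2 first.
- apply: emeasurable_funM; last exact/measurable_EFinP.
  by apply: (measurableT_comp (measurable_poweR kap)); exact: measurable_maxf.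
- by move=> x _; apply: mule_ge0; rewrite ?poweR_ge0// lee_fin.
have h := double_maxf_strong mf f0; rewrite ME -EFinM in h.
apply: (le_trans (lee_wpmul2l c0 h)).
rewrite !poweR_EFin -!EFinM lee_fin -/N.
have mE : m = (N `^ p)%R by rewrite /N powRVK ?(ltW m_gt0)// gt_eqF.
have -> : (c * (c12 * m) = ((`|Ch| + 1) * c12 `^ q^-1) `^ q * N `^ q)%R.
  rewrite powRM ?powR_ge0 ?(ltW Ch0)// powRVK ?(gt_eqF q_gt0)//.
  have -> : (N `^ q = N `^ (q - p) * N `^ p)%R.
    by rewrite -powRD ?(gt_eqF N0) ?implybT// subrK.
  by rewrite /c mE; ring.
apply: ler_wpM2r; first exact: powR_ge0.
apply: powR_le; first exact: ltW.
  by rewrite mulr_ge0 ?powR_ge0// ltW.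
by rewrite lerDl.
Qed.

End strong_type.

(** * Morrey bounds for everywhere positive weights *)

Section positive_weight.
Local Open Scope ereal_scope.
Variables (R : realType) (n : nat) (alpha p q K C : R).
Variables (w : n.-tuple R -> R) (psi1 psi2 : n.-tuple R -> R -> R).
Hypothesis alpha_gt0 : (0 < alpha)%R.
Hypothesis alpha_lt : (alpha < n%:R)%R.
Hypothesis p_ge1 : (1 <= p)%R.
Hypothesis q_gt0 : (0 < q)%R.
Hypothesis pqE : (q^-1 = p^-1 - alpha / n%:R)%R.
Hypothesis mw : measurable_fun setT w.
Hypothesis w_gt0 : forall x, (0 < w x)%R.
Hypothesis K_ge0 : (0 <= K)%R.
Hypothesis u_fin : forall a r, wmeas (fun x => w x `^ q)%R (tball a r) < +oo.
Hypothesis psi1_ge0 : forall a (r : R), (0 < r)%R -> (0 <= psi1 a r)%R.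
Hypothesis psi2_ge0 : forall a (r : R), (0 < r)%R -> (0 <= psi2 a r)%R.
Hypothesis C_gt0 : (0 < C)%R.
Hypothesis psi_hyp : zygmund_condition p q w psi1 psi2 C.

Let n_gt0 : (0 < n)%N.
Proof. by rewrite -(@ltr0n R); exact: lt_trans alpha_gt0 alpha_lt. Qed.

Let p_gt0 : (0 < p)%R. Proof. exact: lt_le_trans p_ge1. Qed.

Lemma morrey_bound_gt1 (p' : R) (v : n.-tuple R -> R) : (1 < p)%R ->
  (p^-1 + p'^-1 = 1)%R -> measurable_fun setT v ->
  (forall x, 0 < v x)%R -> (forall x, w x * v x = 1)%R ->
  (forall a r, wmeas (fun x => v x `^ p')%R (tball a r) < +oo) ->
  (forall a (r : R), (0 < r)%R ->
    (ball_mass q w a r `^ q^-1 * ball_mass p' v a r `^ p'^-1 <=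
     K * r `^ (n%:R - alpha))%R) ->
  exists K' : R, forall f : n.-tuple R -> R,
    in_morrey p (fun x => (w x `^ p)%R) psi1 (EFin \o f) ->
    in_morrey q (fun x => (w x `^ q)%R) psi2 (Ialpha alpha f) /\
    morrey_norm q (fun x => (w x `^ q)%R) psi2 (Ialpha alpha f)
      <= K'%:E * morrey_norm p (fun x => (w x `^ p)%R) psi1 (EFin \o f).
Proof.
move=> p1 pp' mv v_gt0 wv sigma_fin A.
have p'0 : (0 < p')%R.
  by apply: lt_trans (conjugate_exponent_gt1 p1 pp').
have lb := hoelder_local_bound p_gt0 p'0 pp' mw mv w_gt0 v_gt0 wv u_fin
  sigma_fin A.
(* Reverse doubling dictates [L], and doubling is then taken with this same [L]; the maximal
   functions use doubling with factor 4. *)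
have [L [theta [L4 th01 rev]]] := ball_mass_reverse_doubling n_gt0 alpha_gt0
  p_ge1 q_gt0 pqE mw w_gt0 K_ge0 u_fin lb.
have L1 : (1 < L)%R by apply: lt_le_trans L4; rewrite ltr1n.
have [D D0 hD] := ball_mass_doubling n_gt0 alpha_gt0 p_ge1 q_gt0 pqE mw w_gt0
  K_ge0 u_fin lb (ltW L1).
have four : (1 <= 4 :> R)%R by rewrite ler1n.
have [Du Du0 hDu] := ball_mass_doubling n_gt0 alpha_gt0 p_ge1 q_gt0 pqE mw
  w_gt0 K_ge0 u_fin lb four.
have [Ds Ds0 hDs] := dual_mass_doubling n_gt0 alpha_gt0 p1 pp' q_gt0 pqE mw mv
  w_gt0 v_gt0 wv K_ge0 u_fin sigma_fin A four.
have st := strong_type_estimate n_gt0 alpha_gt0 alpha_lt p1 pp' q_gt0 pqE mw mv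
  w_gt0 v_gt0 wv K_ge0 u_fin sigma_fin A Du0 Ds0 hDu hDs L1 th01 D0 hD rev.
exact: (morrey_strong_conclusion alpha_lt p_gt0 q_gt0 mw w_gt0 K_ge0 L4 D0
  u_fin lb hD (wmeas_wpow_fin n_gt0 alpha_gt0 p_ge1 q_gt0 pqE mw u_fin)
  psi1_ge0 psi2_ge0 C_gt0 psi_hyp st).
Qed.

Lemma A1_local_bound : p = 1%R -> A1_estimate alpha q K w ->
  local_estimate alpha p q K w.
Proof.
move=> p1 A f a r mf f0 r0; rewrite p1.
have mB := @measurable_tball R n a r.
have mfw : measurable_fun setT (fun x => f x * w x)%R by exact: measurable_funM.
have k0 : (0 <= K * r `^ (n%:R - alpha))%R by rewrite mulr_ge0 ?powR_ge0.
have [N [mN N0 hN]] := A a r r0.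
rewrite invr1 poweRe1; last first.
  by apply: integral_ge0 => x _; rewrite lee_fin mulr_ge0 ?powR_ge0.
rewrite -(ball_massE u_fin) poweR_EFin.
have -> : \int[@lebn R n]_(x in tball a r) (f x `^ 1 * w x `^ 1)%:E =
    \int[@lebn R n]_(x in tball a r) (f x * w x)%:E.
  by apply: eq_integral => x _; rewrite !powRr1// ltW.
rewrite -!ge0_integralZl//; last first.
- by rewrite lee_fin powR_ge0.
- by move=> x _; rewrite lee_fin.
- by apply: measurable_funTS; exact/measurable_EFinP.
- by move=> x _; rewrite lee_fin mulr_ge0// ltW.
- by apply: measurable_funTS; exact/measurable_EFinP.
have U0 : (0 <= ball_mass q w a r `^ q^-1)%R by exact: powR_ge0.
apply: ae_ge0_le_integral => //.
- by move=> x _; rewrite lee_fin mulr_ge0.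
- apply: measurable_funTS; apply/measurable_EFinP.
  by apply: measurable_funM.
- move=> x _; rewrite lee_fin.
  exact: mulr_ge0 k0 (mulr_ge0 (f0 x) (ltW (w_gt0 x))).
- apply: measurable_funTS; apply/measurable_EFinP.
  by apply: measurable_funM.
exists N; split => // x /= nle; apply: contrapT => nNx; apply: nle => Bx.
rewrite -!EFinM lee_fin [leRHS]mulrCA [leLHS]mulrC.
by apply: ler_wpM2l => //; exact: hN.
Qed.

Lemma weak_morrey_bound_1 : p = 1%R -> A1_estimate alpha q K w ->
  exists K' : R, forall f : n.-tuple R -> R,
    in_morrey p (fun x => (w x `^ p)%R) psi1 (EFin \o f) ->
    in_weak_morrey q (fun x => (w x `^ q)%R) psi2 (Ialpha alpha f) /\
    weak_morrey_norm q (fun x => (w x `^ q)%R) psi2 (Ialpha alpha f)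
      <= K'%:E * morrey_norm p (fun x => (w x `^ p)%R) psi1 (EFin \o f).
Proof.
move=> p1 A; have lb := A1_local_bound p1 A.
have [L [theta [L4 th01 rev]]] := ball_mass_reverse_doubling n_gt0 alpha_gt0
  p_ge1 q_gt0 pqE mw w_gt0 K_ge0 u_fin lb.
have L1 : (1 <= L)%R by apply: le_trans L4; rewrite ler1n.
have [D D0 hD] := ball_mass_doubling n_gt0 alpha_gt0 p_ge1 q_gt0 pqE mw w_gt0
  K_ge0 u_fin lb L1.
have qE : (q^-1 = 1 - alpha / n%:R)%R by rewrite pqE p1 invr1.
have [C3 C30 wt] := weak_type_bound n_gt0 alpha_gt0 alpha_lt q_gt0 qE mw w_gt0
  K_ge0 u_fin A.
rewrite -p1 in wt.
exact: (morrey_weak_conclusion alpha_lt p_gt0 q_gt0 mw w_gt0 K_ge0 L4 D0 C30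
  u_fin lb hD (wmeas_wpow_fin n_gt0 alpha_gt0 p_ge1 q_gt0 pqE mw u_fin)
  psi1_ge0 psi2_ge0 C_gt0 psi_hyp wt).
Qed.

End positive_weight.

(** * The weight condition *)

Section ae_equal_weights.
Local Open Scope ereal_scope.
Variables (R : realType) (n : nat) (v v' : n.-tuple R -> R).
Hypothesis mv : measurable_fun setT v.
Hypothesis mv' : measurable_fun setT v'.
Hypothesis v_ge0 : forall x, (0 <= v x)%R.
Hypothesis v'_ge0 : forall x, (0 <= v' x)%R.
Variable N : set (n.-tuple R).
Hypothesis mN : measurable N.
Hypothesis N_null : @lebn R n N = 0.
Hypothesis vv' : forall x, ~ N x -> v x = v' x.

Lemma wmeas_ae E : measurable E -> wmeas v E = wmeas v' E.
Proof.
move=> mE; apply: (@ge0_ae_eq_integral _ _ R (@lebn R n)) => //.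
- by apply: measurable_funTS; exact/measurable_EFinP.
- by apply: measurable_funTS; exact/measurable_EFinP.
- by move=> x _; rewrite lee_fin.
- by move=> x _; rewrite lee_fin.
exists N; split => // x /= h; apply: contrapT => nNx; apply: h => _.
by rewrite vv'.
Qed.

Lemma Lnorm_ae (s : R) E g : measurable E -> measurable_fun setT g ->
  Defs.Lnorm s v E g = Defs.Lnorm s v' E g.
Proof.
move=> mE mg; rewrite /Defs.Lnorm.
have mgs : measurable_fun setT (fun x => `|g x| `^ s).
  apply: (measurableT_comp (measurable_poweR s)).
  exact: (measurableT_comp (@abse_measurable R setT)).
suff -> : \int[@lebn R n]_(x in E) (`|g x| `^ s * (v x)%:E) =
  \int[@lebn R n]_(x in E) (`|g x| `^ s * (v' x)%:E) by [].
apply: (@ge0_ae_eq_integral _ _ R (@lebn R n)) => //.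
- apply: measurable_funTS; apply: emeasurable_funM => //.
  exact/measurable_EFinP.
- apply: measurable_funTS; apply: emeasurable_funM => //.
  exact/measurable_EFinP.
- by move=> x _; apply: mule_ge0; rewrite ?poweR_ge0// lee_fin.
- by move=> x _; apply: mule_ge0; rewrite ?poweR_ge0// lee_fin.
exists N; split => // x /= h; apply: contrapT => nNx; apply: h => _.
by rewrite vv'.
Qed.

Lemma WLnorm_ae (s : R) a r g : measurable_fun setT g ->
  WLnorm s v (tball a r) g = WLnorm s v' (tball a r) g.
Proof.
move=> mg; rewrite /WLnorm; congr ereal_sup.
have mlev (c : R) : measurable [set x | tball a r x /\ c%:E < `|g x|].
  have ma : measurable_fun setT (fun x => `|g x|).
    exact: (measurableT_comp (@abse_measurable R setT)).
  apply: measurableI; first exact: measurable_tball.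
  by rewrite -[X in measurable X]setTI; exact: emeasurable_fun_o_infty.
by apply/seteqP; split => y [c [c0 ->]]; exists c; split => //;
  rewrite wmeas_ae.
Qed.

Lemma morrey_norm_ae (s : R) psi g : measurable_fun setT g ->
  morrey_norm s v psi g = morrey_norm s v' psi g.
Proof.
move=> mg; rewrite /morrey_norm; congr ereal_sup.
have mB a (r : R) := @measurable_tball R n a r.
by apply/seteqP; split => y [a [r [r0 ->]]]; exists a, r; split => //;
  rewrite (wmeas_ae (mB a r)) (Lnorm_ae s (mB a r) mg).
Qed.

Lemma weak_morrey_norm_ae (s : R) psi g : measurable_fun setT g ->
  weak_morrey_norm s v psi g = weak_morrey_norm s v' psi g.
Proof.
move=> mg; rewrite /weak_morrey_norm; congr ereal_sup.
have mB a (r : R) := @measurable_tball R n a r.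
by apply/seteqP; split => y [a [r [r0 ->]]]; exists a, r; split => //;
  rewrite (wmeas_ae (mB a r)) (WLnorm_ae s a r mg).
Qed.

Lemma in_morrey_ae (s : R) psi g : in_morrey s v psi g -> in_morrey s v' psi g.
Proof.
move=> [[mg h1] h2]; split; first split => //.
- by move=> a r; rewrite -Lnorm_ae//; exact: measurable_tball.
- by rewrite -morrey_norm_ae.
Qed.

End ae_equal_weights.

Section null_weight.
Local Open Scope ereal_scope.
Variables (R : realType) (n : nat) (s : R) (psi : n.-tuple R -> R -> R).
Variable g : n.-tuple R -> \bar R.
Hypothesis s_gt0 : (0 < s)%R.

Let si_gt0 : (0 < s^-1)%R. Proof. by rewrite invr_gt0. Qed.

Let powe0 (t : R) : (0 < t)%R -> (0 : \bar R) `^ t = 0.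
Proof. by move=> t0; rewrite poweR_EFin powR0 ?gt_eqF. Qed.

Lemma Lnorm_null_weight E : Defs.Lnorm s (fun=> 0%R) E g = 0.
Proof.
rewrite /Defs.Lnorm integral0_eq; first exact: powe0.
by move=> x _; rewrite mule0.
Qed.

Lemma WLnorm_null_weight E : WLnorm s (fun=> 0%R) E g <= 0.
Proof.
apply: ge_ereal_sup => _ [c [c0 ->]].
by rewrite /wmeas integral0_eq// powe0// mule0.
Qed.

Lemma morrey_norm_null_weight : morrey_norm s (fun=> 0%R) psi g <= 0.
Proof.
apply: ge_ereal_sup => _ [a [r [r0 ->]]].
by rewrite Lnorm_null_weight mule0.
Qed.

Lemma weak_morrey_norm_null_weight :
  weak_morrey_norm s (fun=> 0%R) psi g <= 0.
Proof.
apply: ge_ereal_sup => _ [a [r [r0 ->]]].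
have -> : WLnorm s (fun=> 0%R) (tball a r) g = 0.
  apply/eqP; rewrite eq_le WLnorm_null_weight/=.
  apply: ereal_sup_ubound; exists 1%R; split => //.
  by rewrite /wmeas integral0_eq// powe0// mule0.
by rewrite mule0.
Qed.

End null_weight.

Section muckenhoupt_wheeden.
Local Open Scope ereal_scope.
Variables (R : realType) (n : nat) (alpha p q : R) (w : n.-tuple R -> R).
Hypothesis n_gt0 : (0 < n)%N.
Hypothesis p_ge1 : (1 <= p)%R.
Hypothesis q_gt0 : (0 < q)%R.
Hypothesis pqE : (q^-1 = p^-1 - alpha / n%:R)%R.
Hypothesis mw : measurable_fun setT w.
Hypothesis w_ge0 : forall x, (0 <= w x)%R.
Hypothesis w_int : forall a (r : R), wmeas w (tball a r) < +oo.
Hypothesis wApq : Apq p q w.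

Let p_gt0 : (0 < p)%R. Proof. exact: lt_le_trans p_ge1. Qed.

Definition zeros := [set x | w x = 0%R].

Lemma measurable_zeros : measurable zeros.
Proof.
have -> : zeros = setT `&` w @^-1` [set 0%R] by rewrite setTI.
exact: mw.
Qed.

(* Changing the weight to [1] where it vanishes costs nothing when it vanishes
   only on a null set. *)
Definition positive_version x : R := (w x + \1_zeros x)%R.

Lemma measurable_positive_version : measurable_fun setT positive_version.
Proof.
apply: measurable_funD => //; apply: measurable_indic.
exact: measurable_zeros.
Qed.

Lemma positive_version_zeros x : zeros x -> positive_version x = 1%R.
Proof. by move=> zx; rewrite /positive_version indicE mem_set// zx add0r. Qed.

Lemma positive_versionE x : ~ zeros x -> positive_version x = w x.
Proof. by move=> zx; rewrite /positive_version indicE memNset// addr0. Qed.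

Lemma positive_version_gt0 x : (0 < positive_version x)%R.
Proof.
have [zx|zx] := pselect (zeros x); first by rewrite positive_version_zeros.
by rewrite positive_versionE// lt_neqAle w_ge0 andbT eq_sym; apply/eqP.
Qed.

Lemma measurable_positive_version_inv :
  measurable_fun setT (fun x => (positive_version x)^-1)%R.
Proof.
have -> : (fun x => (positive_version x)^-1)%R =
    (fun x => positive_version x `^ (-1))%R.
  by apply/funext => x; rewrite powR_inv1 ?(ltW (positive_version_gt0 x)).
exact: (measurable_wpow measurable_positive_version).
Qed.

Lemma wnegpow_ge0 s x : 0 <= wnegpow w s x.
Proof. by rewrite /wnegpow; case: ifP => _; rewrite ?leey ?lee_fin ?powR_ge0. Qed.

Lemma le_wnegpow s x : ((positive_version x)^-1%R `^ s)%:E <= wnegpow w s x.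
Proof.
rewrite /wnegpow; have [wx|wx] := eqVneq (w x) 0%R; first by rewrite leey.
rewrite positive_versionE; last exact/eqP.
by rewrite lee_fin powRN powRV.
Qed.

Let b a r := fine (@lebn R n (tball a r)).

Lemma lebn_tballE a (r : R) : (0 < r)%R -> exists2 b : R,
  @lebn R n (tball a r) = b%:E & (0 < b <= 2 ^+ n * r ^+ n)%R.
Proof.
move=> r0; have /andP[_ ub] := tball_volume a r0.
have gt0 := lebn_tball_gt0 a r0.
exists (b a r); rewrite /b.
  by rewrite fineK// ge0_fin_numE ?(ltW gt0)// (le_lt_trans ub)// ltry.
by move: ub gt0; case: (lebn _) => [c|//|//]; rewrite lee_fin lte_fin => -> ->.
Qed.

Let avgE a (r c : R) g : (0 < c)%R -> @lebn R n (tball a r) = c%:E ->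
  avg (tball a r) g = (c^-1)%:E * \int[@lebn R n]_(x in tball a r) g x.
Proof. by move=> c0 cE; rewrite /avg cE inver gt_eqF. Qed.

Lemma avg_gt0 a (r : R) g : (0 < r)%R ->
  0 < \int[@lebn R n]_(x in tball a r) g x -> 0 < avg (tball a r) g.
Proof.
move=> r0 g0; have [c cE /andP[c0 _]] := lebn_tballE a r0.
by rewrite (avgE _ c0 cE) mule_gt0// lte_fin invr_gt0.
Qed.

Lemma avg_lty a (r : R) g : (0 < r)%R -> avg (tball a r) g < +oo ->
  \int[@lebn R n]_(x in tball a r) g x < +oo.
Proof.
move=> r0; have [c cE /andP[c0 _]] := lebn_tballE a r0.
rewrite (avgE _ c0 cE) !ltNge !leye_eq; apply: contra => /eqP ->.
by rewrite gt0_muley// lte_fin invr_gt0.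
Qed.

Lemma le_esssup_on E (g : n.-tuple R -> \bar R) c :
  (forall N, measurable N -> @lebn R n N = 0 -> forall y,
    (forall x, E x -> ~ N x -> g x <= y) -> c <= y) -> c <= esssup_on E g.
Proof.
by move=> h; apply: le_ereal_inf_tmp => y [N [mN [N0 hN]]]; exact: h N0 _ hN.
Qed.

Lemma esssup_on_lt E (g : n.-tuple R -> \bar R) c :
  esssup_on E g < c -> exists N : set (n.-tuple R),
  [/\ measurable N, @lebn R n N = 0 & forall x, E x -> ~ N x -> g x <= c].
Proof.
move=> /ereal_inf_lt[y [N [mN [N0 hN]]] yc]; exists N; split => // x Ex nNx.
exact: le_trans (hN x Ex nNx) (ltW yc).
Qed.

Lemma not_null_exists (E N : set (n.-tuple R)) :
  measurable E -> measurable N -> @lebn R n N = 0 ->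
  @lebn R n E != 0 -> exists2 x, E x & ~ N x.
Proof.
move=> mE mN N0 E0; apply: contrapT => h; move/eqP: E0; apply.
apply/eqP; rewrite eq_le measure_ge0 andbT -N0.
apply: le_measure; rewrite ?inE// => x Ex; apply: contrapT => nNx.
by apply: h; exists x.
Qed.

Lemma integral_wpow_eq0 a (r : R) :
  \int[@lebn R n]_(x in tball a r) (w x `^ q)%:E = 0 ->
  @lebn R n (tball a r `&` ~` zeros) = 0.
Proof.
move=> h; apply/eqP; apply: contrapT => /negP E0.
have mB := @measurable_tball R n a r.
have mE : measurable (tball a r `&` ~` zeros).
  by apply: measurableI => //; apply: measurableC; exact: measurable_zeros.
have : 0 < \int[@lebn R n]_(x in tball a r `&` ~` zeros)
    (positive_version x `^ q)%:E.
  apply: integral_gt0 => //.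
  - exact: (measurable_wpow measurable_positive_version).
  - by move=> x; rewrite powR_gt0// positive_version_gt0.
  - by rewrite measure_gt0.
have -> : \int[@lebn R n]_(x in tball a r `&` ~` zeros)
    (positive_version x `^ q)%:E =
    \int[@lebn R n]_(x in tball a r `&` ~` zeros) (w x `^ q)%:E.
  by apply: eq_integral => x; rewrite inE => -[_ zx]; rewrite positive_versionE.
rewrite ltNge => /negP; apply; rewrite -h; apply: ge0_subset_integral => //.
- apply: measurable_funTS; apply/measurable_EFinP; exact: measurable_wpow.
- by move=> x _; rewrite lee_fin powR_ge0.
Qed.

(* If [w] vanishes on a set of positive measure in a ball, the second factor of
   the [A_{p,q}] condition is infinite there, hence the first one is zero. *)
Lemma degenerate_ball a (r : R) : (0 < r)%R ->
  @lebn R n (tball a r `&` zeros) != 0 ->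
  @lebn R n (tball a r `&` ~` zeros) = 0.
Proof.
move=> r0 Z0; have mB := @measurable_tball R n a r.
have mBZ : measurable (tball a r `&` zeros).
  by apply: measurableI => //; exact: measurable_zeros.
apply: integral_wpow_eq0; apply/eqP; apply: contrapT => /negP I0.
have I1 : 0 < avg (tball a r) (fun x => (w x `^ q)%:E).
  apply: avg_gt0 => //; rewrite lt0e I0/=.
  by apply: integral_ge0 => x _; rewrite lee_fin powR_ge0.
have X0 := poweR_gt0 q^-1 I1.
have [A1 A2] := wApq.
move: p_ge1; rewrite le_eqVlt => /predU1P[p1|p1].
  have [C /(_ a r r0)] := A2 (esym p1).
  have -> : esssup_on (tball a r) (wnegpow w 1) = +oo.
    apply/eqP; rewrite -leye_eq; apply: le_esssup_on => N mN N0 y hy.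
    have [x [Bx zx] nNx] := not_null_exists mBZ mN N0 Z0.
    by have := hy x Bx nNx; rewrite /wnegpow zx eqxx.
  by rewrite gt0_muley// leye_eq.
have [C /(_ a r r0)] := A1 p1.
have -> : avg (tball a r) (wnegpow w (p / (p - 1))) = +oo.
  have [c cE /andP[c0 _]] := lebn_tballE a r0.
  rewrite (avgE _ c0 cE).
  suff -> : \int[@lebn R n]_(x in tball a r) wnegpow w (p / (p - 1)) x = +oo.
    by rewrite gt0_muley// lte_fin invr_gt0.
  apply/eqP; rewrite -leye_eq.
  have <- : \int[@lebn R n]_(x in tball a r `&` zeros) cst +oo x = +oo.
    by rewrite integral_cst// gt0_mulye// measure_gt0.
  rewrite integral_mkcondr; apply: ge0_le_integral_nonmeasurable => x _.
    by rewrite patchE; case: ifP => /= _ //; exact: leey.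
  rewrite patchE; case: ifP => [|_]; last exact: wnegpow_ge0.
  by rewrite inE => zx; rewrite /wnegpow zx eqxx.
rewrite poweRyr ?invr_eq0 ?gt_eqF ?divr_gt0 ?subr_gt0//.
by rewrite gt0_muley// leye_eq.
Qed.

Lemma null_exhaustion (E : set (n.-tuple R)) : measurable E ->
  (forall k : nat, @lebn R n (tball [tuple 0%R | i < n] k%:R `&` E) = 0) ->
  @lebn R n E = 0.
Proof.
move=> mE h; apply: measure_negligible => //.
have -> : E = \bigcup_k (tball [tuple 0%R | i < n] k%:R `&` E).
  apply/seteqP; split => [x Ex|x [k _ []]//].
  pose m := (Num.truncn (tdist [tuple 0%R | i < n] x)).+1.
  exists m => //; split => //; rewrite /tball/=.
  exact: truncnS_gt.
apply: negligible_bigcup => k; apply/negligibleP; last exact: h.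
by apply: measurableI => //; exact: measurable_tball.
Qed.

(** Otherwise one large ball would meet both sets in positive measure, against [degenerate_ball]. *)
Lemma zeros_dichotomy : @lebn R n zeros = 0 \/ @lebn R n (~` zeros) = 0.
Proof.
have mZ := measurable_zeros; have mZC := measurableC mZ.
apply: contrapT => /not_orP[h1 h2].
have far E : measurable E -> @lebn R n E <> 0 -> exists k : nat,
    forall m, (k <= m)%N ->
    @lebn R n (tball [tuple 0%R | i < n] m%:R `&` E) != 0.
  move=> mE E0; have /existsNP[k hk] : ~ forall k : nat,
      @lebn R n (tball [tuple 0%R | i < n] k%:R `&` E) = 0.
    by move=> h; apply: E0; exact: null_exhaustion.
  exists k => m km; rewrite -measure_gt0.
  apply: (@lt_le_trans _ _ (@lebn R n (tball [tuple 0%R | i < n] k%:R `&` E))).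
    by rewrite measure_gt0; exact/eqP.
  apply: le_measure; rewrite ?inE; try by
    apply: measurableI => //; exact: measurable_tball.
  by apply: setSI; apply: tball_le; rewrite ler_nat.
have [k1 hk1] := far _ mZ h1; have [k2 hk2] := far _ mZC h2.
pose k := (k1 + k2).+1.
have k0 : (0 < k%:R :> R)%R by rewrite ltr0n.
have := degenerate_ball k0 (hk1 k (leqW (leq_addr _ _))).
by apply/eqP; apply: hk2; exact/leqW/leq_addl.
Qed.

Hypothesis zeros_null : @lebn R n zeros = 0.

Let w' := positive_version.
Let mw' : measurable_fun setT w'. Proof. exact: measurable_positive_version. Qed.
Let w'_gt0 x : (0 < w' x)%R. Proof. exact: positive_version_gt0. Qed.

Lemma wmeas_positive_version (s : R) E : measurable E ->
  wmeas (fun x => w x `^ s)%R E = wmeas (fun x => w' x `^ s)%R E.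
Proof.
apply: (wmeas_ae _ _ _ _ measurable_zeros zeros_null).
- exact: measurable_wpow.
- exact: measurable_wpow.
- by move=> x; exact: powR_ge0.
- by move=> x; exact: powR_ge0.
- by move=> x zx; rewrite /w' positive_versionE.
Qed.

Let wmeas_gt0 (v : n.-tuple R -> R) (s : R) a (r : R) :
  measurable_fun setT v -> (forall x, 0 < v x)%R -> (0 < r)%R ->
  0 < wmeas (fun x => v x `^ s)%R (tball a r).
Proof.
move=> mv v0 r0; apply: integral_gt0.
- exact: measurable_tball.
- exact: measurable_wpow.
- by move=> x; rewrite powR_gt0.
- exact: lebn_tball_gt0.
Qed.

Let avg_wpow_gt0 a (r : R) : (0 < r)%R ->
  0 < avg (tball a r) (fun x => (w x `^ q)%:E).
Proof.
move=> r0; apply: avg_gt0 => //.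
have := wmeas_positive_version q (@measurable_tball R n a r).
by rewrite /wmeas => ->; exact: wmeas_gt0.
Qed.

Let wmeas_nonpos (v : n.-tuple R -> R) a (r : R) : ~ (0 < r)%R ->
  wmeas v (tball a r) < +oo.
Proof. by move=> r0; rewrite tball_set0// /wmeas integral_set0. Qed.

(** This is how one factor of the weight condition is shown finite: the other one is positive. *)
Let mul_lty (x y : \bar R) c : 0 < x -> 0 <= y -> x * y <= c%:E -> y < +oo.
Proof.
move=> x0 y0; rewrite ltNge leye_eq => h; apply/negP => /eqP yoo.
by move: h; rewrite yoo gt0_muley// leye_eq.
Qed.

Section exponent_gt1.
Hypothesis p_gt1 : (1 < p)%R.
Let p' := (p / (p - 1))%R.
Let v x := (w' x)^-1%R.
Let p'_gt0 : (0 < p')%R. Proof. by rewrite divr_gt0// subr_gt0. Qed.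
Let mv : measurable_fun setT v. Proof. exact: measurable_positive_version_inv. Qed.
Let v_gt0 x : (0 < v x)%R. Proof. by rewrite invr_gt0. Qed.

Let avg_wnegpow_gt0 a (r : R) : (0 < r)%R ->
  0 < avg (tball a r) (wnegpow w p').
Proof.
move=> r0; apply: avg_gt0 => //.
apply: (@lt_le_trans _ _ (wmeas (fun x => v x `^ p')%R (tball a r))).
  exact: wmeas_gt0.
apply: ge0_le_integral_nonmeasurable => x _; first by rewrite lee_fin powR_ge0.
exact: le_wnegpow.
Qed.

Lemma Apq_finite_gt1 a (r : R) :
  wmeas (fun x => w' x `^ q)%R (tball a r) < +oo.
Proof.
have [r0|r0] := pselect (0 < r)%R; last exact: wmeas_nonpos.
have [/(_ p_gt1)[C /(_ a r r0) h] _] := wApq.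
have mB := @measurable_tball R n a r.
rewrite -wmeas_positive_version//; apply: avg_lty => //.
apply: (@lty_poweRy _ _ q^-1); first by rewrite invr_eq0 gt_eqF.
rewrite muleC in h; apply: mul_lty h; last exact: poweR_ge0.
exact/poweR_gt0/avg_wnegpow_gt0.
Qed.

Lemma Apq_dual_finite_gt1 a (r : R) :
  wmeas (fun x => v x `^ p')%R (tball a r) < +oo.
Proof.
have [r0|r0] := pselect (0 < r)%R; last exact: wmeas_nonpos.
have [/(_ p_gt1)[C /(_ a r r0) h] _] := wApq.
apply: (@le_lt_trans _ _ (\int[@lebn R n]_(x in tball a r) wnegpow w p' x)).
  apply: ge0_le_integral_nonmeasurable => x _; first by rewrite lee_fin powR_ge0.
  exact: le_wnegpow.
apply: avg_lty => //.
apply: (@lty_poweRy _ _ p'^-1); first by rewrite invr_eq0 gt_eqF.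
by apply: mul_lty h; [exact/poweR_gt0/avg_wpow_gt0|exact: poweR_ge0].
Qed.

Lemma Apq_condition_gt1 : exists2 K : R, (0 <= K)%R &
  forall a (r : R), (0 < r)%R ->
  (ball_mass q w' a r `^ q^-1 * ball_mass p' v a r `^ p'^-1 <=
   K * r `^ (n%:R - alpha))%R.
Proof.
have [/(_ p_gt1)[C hC] _] := wApq.
(* Clearing the two averages leaves the volume to this power, which is of order r^(n - alpha). *)
have pp' : (q^-1 + p'^-1 = (n%:R - alpha) / n%:R)%R.
  rewrite pqE /p'; field.
  by rewrite !gt_eqF ?ltr0n// subr_gt0.
exists (`|C| * 2 `^ (n%:R - alpha))%R; first by rewrite mulr_ge0 ?powR_ge0.
move=> a r r0; have mB := @measurable_tball R n a r.
have [c cE /andP[c0 cle]] := lebn_tballE a r0.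
have U0 := ball_mass_gt0 mw' w'_gt0 Apq_finite_gt1 a r0.
have S0 := ball_mass_gt0 mv v_gt0 Apq_dual_finite_gt1 a r0.
have ci0 : (0 <= c^-1)%R by rewrite invr_ge0 ltW.
have UE := ball_massE Apq_finite_gt1 a r.
have SE := ball_massE Apq_dual_finite_gt1 a r.
move: (ball_mass q w' a r) (ball_mass p' v a r) U0 S0 UE SE => U S U0 S0 UE SE.
have h : ((c^-1 * U) `^ q^-1 * (c^-1 * S) `^ p'^-1 <= C)%R.
  have := hC a r r0; rewrite !(avgE _ c0 cE).
  rewrite -[X in (_ * X) `^ q^-1]/(wmeas (fun x => w x `^ q)%R (tball a r)).
  rewrite wmeas_positive_version// -UE -EFinM poweR_EFin => h.
  rewrite -lee_fin; apply: le_trans h; rewrite EFinM; apply: lee_wpmul2l.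
    by rewrite lee_fin powR_ge0.
  rewrite -poweR_EFin; apply: lee_poweR; first by rewrite invr_ge0 ltW.
    by rewrite lee_fin mulr_ge0// ltW.
  rewrite EFinM; apply: lee_wpmul2l; first by rewrite lee_fin.
  rewrite SE; apply: ge0_le_integral_nonmeasurable => x _.
    by rewrite lee_fin powR_ge0.
  exact: le_wnegpow.
have {}h : (U `^ q^-1 * S `^ p'^-1 <= C * c `^ (q^-1 + p'^-1))%R.
  move: h; rewrite !powRM ?ci0 ?(ltW U0) ?(ltW S0)// !powRV ?(ltW c0)//.
  rewrite powRD ?(gt_eqF c0) ?implybT//.
  have c1 : (0 < c `^ q^-1)%R by rewrite powR_gt0.
  have c2 : (0 < c `^ p'^-1)%R by rewrite powR_gt0.
  by rewrite mulrACA -invfM ler_pdivrMl ?mulr_gt0// [leRHS]mulrC.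
apply: (le_trans h).
apply: (@le_trans _ _ (`|C| * c `^ (q^-1 + p'^-1))%R).
  by apply: ler_wpM2r; [exact: powR_ge0|exact: ler_norm].
rewrite -mulrA; apply: ler_wpM2l => //.
apply: (@le_trans _ _ ((2 ^+ n * r ^+ n) `^ (q^-1 + p'^-1))%R).
  by apply: powR_le; [rewrite addr_ge0 ?invr_ge0 ?ltW|exact: ltW|].
rewrite -exprMn -powR_mulrn; last by rewrite mulr_ge0// ltW.
rewrite -powRrM pp' [(n%:R * _)%R]mulrC divfK ?pnatr_eq0 -?lt0n//.
by rewrite powRM// ltW.
Qed.

End exponent_gt1.

Section exponent_1.
Hypothesis p1 : p = 1%R.

(** If 1 / w were essentially below c / (m + 1) on a ball of volume [c] and w-mass [m], its mass
    would be at least m + 1. This is where local integrability of [w] enters. *)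
Let esssup_gt0 a (r : R) : (0 < r)%R ->
  0 < esssup_on (tball a r) (wnegpow w 1).
Proof.
move=> r0; have mB := @measurable_tball R n a r.
have [c cE /andP[c0 _]] := lebn_tballE a r0.
have I0 : 0 <= wmeas w (tball a r) by apply: integral_ge0 => x _; rewrite lee_fin.
have [m mE] : exists m, wmeas w (tball a r) = m%:E.
  by exists (fine (wmeas w (tball a r))); rewrite fineK// ge0_fin_numE.
have m0 : (0 <= m)%R by rewrite -lee_fin -mE.
have m1 : (0 < m + 1)%R by rewrite ltr_wpDl.
apply: (@lt_le_trans _ _ (c / (m + 1))%:E); first by rewrite lte_fin divr_gt0.
apply: le_esssup_on => N mN N0 y hy; rewrite leNgt; apply/negP => yc.
have : \int[@lebn R n]_(x in tball a r) cst ((m + 1) / c)%:E x <=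
    wmeas w (tball a r).
  apply: ae_ge0_le_integral => //.
  - by move=> x _; rewrite lee_fin divr_ge0// ltW.
  - by move=> x _; rewrite lee_fin.
  - by apply: measurable_funTS; exact/measurable_EFinP.
  exists N; split => // x /= h; apply: contrapT => nNx; apply: h => Bx.
  have := le_lt_trans (hy x Bx nNx) yc; rewrite /wnegpow.
  have [//|wx] := eqVneq (w x) 0%R; rewrite lte_fin lee_fin powRN powRr1//.
  have wx0 : (0 < w x)%R by rewrite lt_neqAle eq_sym wx w_ge0.
  move=> h; rewrite -(invf_div c) -[leRHS]invrK.
  by rewrite lef_pV2 ?posrE ?invr_gt0 ?divr_gt0// ltW.
rewrite integral_cst// mE.
have -> : ((m + 1) / c)%:E * @lebn R n (tball a r) = (m + 1)%:E.
  by rewrite cE -EFinM divfK ?gt_eqF.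
rewrite lee_fin.
by rewrite leNgt ltrDl ltr01.
Qed.

Let Apq_lt a (r : R) C : (0 < r)%R ->
  avg (tball a r) (fun x => (w x `^ q)%:E) `^ q^-1
    * esssup_on (tball a r) (wnegpow w 1) <= C%:E ->
  avg (tball a r) (fun x => (w x `^ q)%:E) `^ q^-1 < +oo.
Proof.
move=> r0 h; rewrite muleC in h; apply: mul_lty h; last exact: poweR_ge0.
exact: esssup_gt0.
Qed.

Lemma Apq_finite_1 a (r : R) :
  wmeas (fun x => w' x `^ q)%R (tball a r) < +oo.
Proof.
have [r0|r0] := pselect (0 < r)%R; last exact: wmeas_nonpos.
have [_ /(_ p1)[C /(_ a r r0) h]] := wApq.
have mB := @measurable_tball R n a r.
rewrite -wmeas_positive_version//; apply: avg_lty => //.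
apply: (@lty_poweRy _ _ q^-1); first by rewrite invr_eq0 gt_eqF.
exact: Apq_lt h.
Qed.

Lemma Apq_condition_1 : exists2 K : R, (0 <= K)%R &
  forall a (r : R), (0 < r)%R -> exists N : set (n.-tuple R),
    [/\ measurable N, @lebn R n N = 0 & forall x, tball a r x -> ~ N x ->
    (ball_mass q w' a r `^ q^-1 <= K * r `^ (n%:R - alpha) * w' x)%R].
Proof.
have [_ /(_ p1)[C hC]] := wApq.
have qn : (n%:R * q^-1 = n%:R - alpha)%R.
  by rewrite pqE p1; field; rewrite gt_eqF// ltr0n.
(* The extra 1 makes the bound on the essential supremum strict, so that some null set realizes
   it. *)
exists ((`|C| + 1) * 2 `^ (n%:R - alpha))%R.
  by rewrite mulr_ge0 ?powR_ge0// addr_ge0.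
move=> a r r0; have mB := @measurable_tball R n a r.
have [c cE /andP[c0 cle]] := lebn_tballE a r0.
have U0 := ball_mass_gt0 mw' w'_gt0 Apq_finite_1 a r0.
have UE := ball_massE Apq_finite_1 a r.
move: (ball_mass q w' a r) U0 UE => U U0 UE.
have ci0 : (0 < c^-1)%R by rewrite invr_gt0.
have C1 : (0 < `|C| + 1)%R by rewrite ltr_wpDl.
pose X := ((c^-1 * U) `^ q^-1)%R.
have X0 : (0 < X)%R by rewrite powR_gt0// mulr_gt0.
have h : X%:E * esssup_on (tball a r) (wnegpow w 1) <= C%:E.
  have := hC a r r0; rewrite !(avgE _ c0 cE).
  rewrite -[X in (_ * X) `^ q^-1]/(wmeas (fun x => w x `^ q)%R (tball a r)).
  by rewrite wmeas_positive_version// -UE -EFinM poweR_EFin.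
have {}h : esssup_on (tball a r) (wnegpow w 1) < ((`|C| + 1) / X)%:E.
  apply: (@le_lt_trans _ _ (C / X)%:E).
    by rewrite EFinM lee_pdivlMr// muleC.
  rewrite lte_fin ltr_pM2r ?invr_gt0//.
  by apply: le_lt_trans (ler_norm _) _; rewrite ltrDl.
have [N [mN N0 hN]] := esssup_on_lt h.
exists (N `|` zeros); split.
- by apply: measurableU => //; exact: measurable_zeros.
- by rewrite measureU0//; exact: measurable_zeros.
move=> x Bx /not_orP[nNx zx]; rewrite /w' positive_versionE//.
have := hN x Bx nNx; rewrite /wnegpow.
have [//|wx] := eqVneq (w x) 0%R; rewrite lee_fin powRN powRr1//.
have wx0 : (0 < w x)%R by rewrite lt_neqAle eq_sym wx w_ge0.
rewrite ler_pdivlMr// mulrC ler_pdivrMr// => hx.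
have Xc : (U `^ q^-1 = X * c `^ q^-1)%R.
  rewrite /X powRM ?(ltW U0) ?(ltW ci0)// powRV ?(ltW c0)// mulrAC mulVf ?mul1r//.
  by rewrite gt_eqF// powR_gt0.
rewrite Xc.
have cq : (c `^ q^-1 <= 2 `^ (n%:R - alpha) * r `^ (n%:R - alpha))%R.
  apply: (@le_trans _ _ ((2 ^+ n * r ^+ n) `^ q^-1)%R).
    by apply: powR_le; [rewrite invr_ge0 ltW|exact: ltW|].
  rewrite -exprMn -powR_mulrn; last by rewrite mulr_ge0// ltW.
  by rewrite -powRrM qn powRM// ltW.
apply: (@le_trans _ _ ((`|C| + 1) * w x * c `^ q^-1)%R).
  by apply: ler_wpM2r => //; exact: powR_ge0.
rewrite -!mulrA; apply: ler_wpM2l; first exact: ltW.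
by rewrite mulrC mulrA; apply: ler_wpM2r.
Qed.

End exponent_1.

End muckenhoupt_wheeden.

(** * Combination of the positive and the degenerate case *)

Theorem theorem4p2 (R : realType) (n : nat) (alpha p q : R)
  (w : n.-tuple R -> R) (psi1 psi2 : n.-tuple R -> R -> R) (C : R) :
  0 < alpha -> alpha < n%:R ->
  1 <= p -> p < n%:R / alpha ->
  q^-1 = p^-1 - alpha / n%:R ->
  weight w -> Apq p q w ->
  (forall a r, 0 < r -> 0 <= psi1 a r) ->
  (forall a r, 0 < r -> 0 <= psi2 a r) ->
  0 < C ->
  (forall (a : n.-tuple R) (r : R), 0 < r ->
     (\int[@lebesgue_measure R]_(t in [set t : R | (r < t)%R])
        ((wmeas (fun x => (w x `^ p)%R) (tball a t)) `^ (p^-1)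
         * ((wmeas (fun x => (w x `^ q)%R) (tball a t)) `^ (q^-1))^-1
         * ((psi1 a t) / t)%R%:E) <= (C * psi2 a r)%:E)%E) ->
  (1 < p ->
    exists K : R, forall f : n.-tuple R -> R,
      in_morrey p (fun x => (w x `^ p)%R) psi1 (EFin \o f) ->
      in_morrey q (fun x => (w x `^ q)%R) psi2 (Ialpha alpha f) /\
      (morrey_norm q (fun x => (w x `^ q)%R) psi2 (Ialpha alpha f)
        <= K%:E * morrey_norm p (fun x => (w x `^ p)%R) psi1 (EFin \o f))%E) /\
  (p = 1 ->
    exists K : R, forall f : n.-tuple R -> R,
      in_morrey 1 w psi1 (EFin \o f) ->
      in_weak_morrey q (fun x => (w x `^ q)%R) psi2 (Ialpha alpha f) /\
      (weak_morrey_norm q (fun x => (w x `^ q)%R) psi2 (Ialpha alpha f)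
        <= K%:E * morrey_norm 1 w psi1 (EFin \o f))%E).
Proof.
move=> alpha_gt0 alpha_lt p_ge1 p_lt pqE [mw [w_ge0 w_int]] wApq psi1_ge0
  psi2_ge0 C_gt0 psi_hyp.
have p_gt0 : 0 < p by exact: lt_le_trans p_ge1.
have n0 : 0 < n%:R :> R by exact: lt_trans alpha_gt0 alpha_lt.
have n_gt0 : (0 < n)%N by rewrite -(@ltr0n R).
(* The condition p < n / alpha says exactly that 1/q is positive. *)
have q_gt0 : 0 < q.
  rewrite -invr_gt0 pqE subr_gt0 -(invf_div n%:R).
  by rewrite ltf_pV2 ?posrE ?divr_gt0.
have mZ := measurable_zeros mw; have mZC := measurableC mZ.
have mwp s : measurable_fun setT (fun x => w x `^ s) by exact: measurable_wpow.
have wp0 s x : 0 <= w x `^ s by exact: powR_ge0.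
have mI (f : n.-tuple R -> R) : measurable_fun setT (EFin \o f) ->
    measurable_fun setT (Ialpha alpha f).
  by move=> /measurable_EFinP; exact: measurable_Ialpha.
have [zeros_null|w_null] := zeros_dichotomy p_ge1 mw w_ge0 wApq;
  last first.
  have m0 : measurable_fun setT (fun _ : n.-tuple R => 0 : R).
    exact: measurable_cst.
  have z0 (x : n.-tuple R) : 0 <= 0 :> R by [].
  have wE s : 0 < s -> forall x, ~ (~` zeros w) x -> w x `^ s = 0.
    by move=> s0 x /contrapT ->; rewrite powR0// gt_eqF.
  split => [_|p1]; exists 0 => f [[mf _] _]; rewrite mul0e.
    have e := morrey_norm_ae (mwp q) m0 (wp0 q) z0 mZC w_null
      (wE q q_gt0) q psi2 (mI _ mf).
    have h : (morrey_norm q (fun x => w x `^ q)%R psi2 (Ialpha alpha f) <= 0)%E.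
      by rewrite e; exact: morrey_norm_null_weight.
    split; last exact: h.
    split; last exact: (le_lt_trans h (ltry 0)).
    split; first exact: mI.
    move=> a r; rewrite (Lnorm_ae (mwp q) m0 (wp0 q) z0 mZC w_null
      (wE q q_gt0) q (@measurable_tball R n a r) (mI _ mf)).
    by rewrite Lnorm_null_weight.
  have e := weak_morrey_norm_ae (mwp q) m0 (wp0 q) z0 mZC w_null
    (wE q q_gt0) q psi2 (mI _ mf).
  have h : (weak_morrey_norm q (fun x => w x `^ q)%R psi2 (Ialpha alpha f) <= 0)%E.
    by rewrite e; exact: weak_morrey_norm_null_weight.
  split; last exact: h.
  split; first exact: mI.
  exact: (le_lt_trans h (ltry 0)).
(* Masses and norms are integrals and ignore the null set [zeros w], so the hypothesis on the psi's
   and the conclusion pass between the two weights. *)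
set w' := positive_version w.
have mw' : measurable_fun setT w' := measurable_positive_version mw.
have w'_gt0 x : 0 < w' x := positive_version_gt0 w_ge0 x.
have mwp' s : measurable_fun setT (fun x => w' x `^ s) by exact: measurable_wpow.
have wp0' s x : 0 <= w' x `^ s by exact: powR_ge0.
have ww' s x : ~ zeros w x -> w x `^ s = w' x `^ s.
  by move=> zx; rewrite /w' positive_versionE.
have w'w s x (zx : ~ zeros w x) : w' x `^ s = w x `^ s := esym (ww' s x zx).
have psi_hyp' : zygmund_condition p q w' psi1 psi2 C.
  move=> a r r0; apply: le_trans (psi_hyp a r r0).
  rewrite le_eqVlt; apply/predU1P; left; apply: eq_integral => t _.
  have mB := @measurable_tball R n a t.
  by rewrite !(wmeas_positive_version mw zeros_null).
split => [p1|p1].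
  have pp' : p^-1 + (p / (p - 1))^-1 = 1.
    by field; rewrite !gt_eqF// subr_gt0.
  have mv := measurable_positive_version_inv mw w_ge0.
  have v_gt0 x : 0 < (w' x)^-1 by rewrite invr_gt0.
  have wv x : w' x * (w' x)^-1 = 1 by rewrite mulfV// gt_eqF.
  have u_fin := Apq_finite_gt1 q_gt0 mw w_ge0 wApq zeros_null p1.
  have sigma_fin := Apq_dual_finite_gt1 p_ge1 mw w_ge0 wApq zeros_null p1.
  have [K K0 A] := Apq_condition_gt1 n_gt0 p_ge1 q_gt0 pqE mw w_ge0 wApq
    zeros_null p1.
  have [K' hK'] := morrey_bound_gt1 alpha_gt0 alpha_lt p_ge1 q_gt0 pqE mw' w'_gt0
    K0 u_fin psi1_ge0 psi2_ge0 C_gt0 psi_hyp' p1 pp' mv v_gt0 wv sigma_fin A.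
  exists K' => f hf; have [[mf _] _] := hf.
  have [h1 h2] := hK' f (in_morrey_ae (mwp p) (mwp' p) (wp0 p) (wp0' p) mZ
    zeros_null (ww' p) hf).
  split.
    exact: (in_morrey_ae (mwp' q) (mwp q) (wp0' q) (wp0 q) mZ zeros_null
      (w'w q) h1).
  rewrite (morrey_norm_ae (mwp q) (mwp' q) (wp0 q) (wp0' q) mZ zeros_null
    (ww' q) q psi2 (mI _ mf)).
  by rewrite (morrey_norm_ae (mwp p) (mwp' p) (wp0 p) (wp0' p) mZ zeros_null
    (ww' p) p psi1 mf).
have u_fin := Apq_finite_1 q_gt0 mw w_ge0 w_int wApq zeros_null p1.
have [K K0 A] := Apq_condition_1 n_gt0 q_gt0 pqE mw w_ge0 w_int wApq zeros_null p1.
have [K' hK'] := weak_morrey_bound_1 alpha_gt0 alpha_lt p_ge1 q_gt0 pqE mw'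
  w'_gt0 K0 u_fin psi1_ge0 psi2_ge0 C_gt0 psi_hyp' p1 A.
have wpE : (fun x => w x `^ p) = w.
  by apply/funext => x; rewrite p1 powRr1.
exists K' => f; rewrite -{1}p1 -{1}wpE => hf; have [[mf _] _] := hf.
have [[h1 h2] h3] := hK' f (in_morrey_ae (mwp p) (mwp' p) (wp0 p) (wp0' p) mZ
  zeros_null (ww' p) hf).
have e := weak_morrey_norm_ae (mwp q) (mwp' q) (wp0 q) (wp0' q) mZ zeros_null
  (ww' q) q psi2 (mI _ mf).
split; first by split; [exact: h1|rewrite e; exact: h2].
rewrite e -{1}p1 -{1}wpE.
by rewrite (morrey_norm_ae (mwp p) (mwp' p) (wp0 p) (wp0' p) mZ zeros_null
    (ww' p) p psi1 mf).
Qed.
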